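(* Let $(X,x)$ be a non-F-pure simple elliptic singularity over an algebraically closed field $k$ of characteristic $p>0$, presented as $X=\operatorname{Spec}R$ with $R=\bigoplus_{n\ge0}H^0(E,L^n)t^n$, where $E$ is the elliptic exceptional curve on the minimal resolution $\widetilde{X}$. Suppose $E^2\le-2$ and $d=-E^2$ is not a power of the characteristic $p$. Then $\widetilde{X}$ is the normalization of the $e$-th F-blowup $\mathrm{FB}_e(X)$ for all $e\ge1$.
   Context: Blowup at a module: for a Noetherian integral scheme $X$ and a coherent sheaf $\mathcal{M}$, a modification $f:Y\to X$ is a flattening of $\mathcal{M}$ if the torsion-free pullback $f^{\star}\mathcal{M}=(f^*\mathcal{M})/\mathrm{tors}$ is flat (equivalently locally free); the blowup of $X$ at $\mathcal{M}$ is the universal flattening, through which every other flattening factors. The $e$-th F-blowup $\mathrm{FB}_e(X)$ is the blowup of $X$ at $F^e_*\mathcal{O}_X$ ($F$ the absolute Frobenius). Simple elliptic singularities: a simple elliptic singularity is a normal surface singularity whose minimal resolution has a single smooth elliptic curve $E$ as exceptional curve. It is quasi-homogeneous, so one takes $X=\operatorname{Spec}R$ with $R=R(E,L)=\bigoplus_{n\ge0}H^0(E,L^n)t^n$, $L$ an ample line bundle on the elliptic curve $E$, $\deg t=1$. The minimal resolution is $f:\widetilde{X}=\operatorname{Spec}_E\big(\bigoplus_{n\ge0}L^nt^n\big)\to X$, whose exceptional curve is the zero section, identified with $E$; $E^2=-\deg L$. Non-F-pure means that $\mathcal{O}_X\to F_*\mathcal{O}_X$ is not pure; this is equivalent to $E$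 being a supersingular elliptic curve. *)

(* Defs.v *)
(* Algebraic geometry in the language of Chevalley's "schemas" (EGA I, section 8)
   and of Zariski-Samuel, Commutative Algebra II, chapter VI, section 17.  An
   integral separated scheme with function field K is determined by the set of
   its local rings, which are subrings of K; such schemes are therefore sets of
   subsets of K.  A birational morphism Y' -> Y inducing the identity of K
   exists, and is then unique, iff every local ring of Y' dominates a local
   ring of Y; Y' and Y are isomorphic in this way iff the two sets are equal. *)

From HB Require Import structures.
From mathcomp Require Import all_boot all_order all_algebra.
From mathcomp Require Import boolp classical_sets cardinality.
From mathcomp Require Import freeg.

Set Implicit Arguments.
Unset Strict Implicit.
Unset Printing Implicit Defensive.

Import Order.TTheory GRing.Theory Num.Theory.
Local Open Scope classical_set_scope.
Local Open Scope ring_scope.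

(** * Modules over a subring A of a field, tensor products, purity, flatness *)

Section Modules.
Variable K : fieldType.
Implicit Types A : set K.

Definition is_subring A :=
  [/\ A 1, forall x y, A x -> A y -> A (x - y)
         & forall x y, A x -> A y -> A (x * y)].

(* The value of [mact a u] matters only for a in the base ring A and u in the
   carrier: see [is_module]. *)
Record moddata := ModData {
  msort :> zmodType;
  mcar : set msort;
  mact : K -> msort -> msort }.

Definition is_module A (M : moddata) :=
  [/\ mcar (0 : M) /\ (forall u v : M, mcar u -> mcar v -> mcar (u - v)),
      forall a (u : M), A a -> mcar u -> mcar (mact a u),
      forall a (u v : M), A a -> mcar u -> mcar v ->
        mact a (u + v) = mact a u + mact a v,
      forall a b (u : M), A a -> A b -> mcar u ->
        mact (a + b) u = mact a u + mact b u /\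
        mact (a * b) u = mact a (mact b u)
    & forall u : M, mcar u -> mact 1 u = u].

Definition is_linear A (N N' : moddata) (f : N -> N') :=
  [/\ forall u, mcar u -> mcar (f u),
      forall u v, mcar u -> mcar v -> f (u + v) = f u + f v
    & forall a u, A a -> mcar u -> f (mact a u) = mact a (f u)].

Definition is_bilinear A (N M U : moddata) (b : N -> M -> U) :=
  (forall x, mcar x -> is_linear A (b x)) /\
  (forall y, mcar y -> is_linear A (fun x => b x y)).

(* The element \sum_i x_i (x) y_i of the tensor product of N and M over A is
   zero iff it is killed by all A-bilinear maps. *)
Definition tensor_zero A (N M : moddata) n (x : 'I_n -> N) (y : 'I_n -> M) :=
  forall (U : moddata) (b : N -> M -> U), is_module A U -> is_bilinear A b ->
  \sum_(i < n) b (x i) (y i) = 0.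

(* Injectivity of the map N (x) M -> N' (x) M induced by f. *)
Definition tensor_injective A (N N' M : moddata) (f : N -> N') :=
  forall n (x : 'I_n -> N) (y : 'I_n -> M),
  (forall i, mcar (x i)) -> (forall i, mcar (y i)) ->
  tensor_zero A (f \o x) y -> tensor_zero A x y.

Definition pure A (N N' : moddata) (f : N -> N') :=
  forall M, is_module A M -> tensor_injective A M f.

Definition flat A (M : moddata) :=
  forall (N N' : moddata) (f : N -> N'),
  is_module A N -> is_module A N' -> is_linear A f ->
  (forall u v, mcar u -> mcar v -> f u = f v -> u = v) ->
  tensor_injective A M f.

Definition regular A := @ModData K A *%R.

(* F^e_* A, where F is the Frobenius of A in characteristic p. *)
Definition frobenius_pushforward (p e : nat) A :=
  @ModData K A (fun a x => a ^+ (p ^ e) * x).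

Definition F_pure (p : nat) A :=
  pure A (fun x : regular A => (x ^+ p : frobenius_pushforward p 1 A)).

(* For an R-module M contained in a K-vector space V = K (x)_R M (whose scalar
   multiplication is [mact]), the image of O (x)_R M in V, i.e. the quotient of
   O (x)_R M by its torsion; see [frobenius_pullback_torsion] below. *)
Definition torsion_free_pullback (O : set K) (M : moddata) :=
  @ModData M
    [set u | exists n (a : 'I_n -> K) (m : 'I_n -> M),
       [/\ forall i, O (a i), forall i, mcar (m i)
         & u = \sum_(i < n) mact (a i) (m i)]]
    (@mact M).

End Modules.

(** * Schemes as sets of local rings *)

Section Schemes.
Variable K : fieldType.
Implicit Types (A O R V P : set K) (Y : set (set K)).

Definition is_prime A P :=
  [/\ P `<=` A /\ P 0, forall x y, P x -> P y -> P (x + y),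
      forall a x, A a -> P x -> P (a * x), ~ P 1
    & forall x y, A x -> A y -> P (x * y) -> P x \/ P y].

Definition localization A P : set K :=
  [set x | exists a b, [/\ A a, A b, ~ P b & x = a / b]].

(* The set of local rings of Spec A. *)
Definition spec A : set (set K) :=
  [set O | exists2 P, is_prime A P & O = localization A P].

Definition nonunits O : set K := [set x | O x /\ (x = 0 \/ ~ O x^-1)].

Definition dominates O' O := O `<=` O' /\ nonunits O `<=` nonunits O'.

Definition is_valuation_ring V :=
  is_subring V /\ forall x, V x \/ V x^-1.

Definition finitely_generated_over R A :=
  [/\ is_subring A, R `<=` A
    & exists2 s : seq K, (forall x, x \in s -> A x)
        & forall B, is_subring B -> R `<=` B ->
            (forall x, x \in s -> B x) -> A `<=` B].

(* Proper birational integral schemes over Spec R, when K = Frac R: finite type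
   together with the valuative criterion (unique centres for the valuation
   rings of K), which expresses both separatedness and properness. *)
Definition is_modification R Y :=
  (exists n (A : 'I_n -> set K),
     (forall i, finitely_generated_over R (A i)) /\
     Y = [set O | exists i, spec (A i) O]) /\
  (forall V, is_valuation_ring V -> R `<=` V ->
     exists! O, Y O /\ dominates V O).

Definition scheme_dominates Y' Y :=
  forall O', Y' O' -> exists2 O, Y O & dominates O' O.

Definition integral_closure A : set K :=
  [set x | exists p : {poly K},
     [/\ p \is monic, forall i, A p`_i & root p x]].

(* Union of the spectra of the integral closures in K of the local rings. *)
Definition normalization Y : set (set K) :=
  [set O' | exists2 O, Y O & spec (integral_closure O) O'].

Definition is_flattening R (M : moddata K) Y :=
  is_modification R Y /\ forall O, Y O -> flat O (torsion_free_pullback O M).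

(* The blowup of Spec R at M: the universal flattening. *)
Definition is_module_blowup R (M : moddata K) Y :=
  is_flattening R M Y /\
  forall Y', is_flattening R M Y' -> scheme_dominates Y' Y.

Definition is_F_blowup (p e : nat) R Y :=
  is_module_blowup R (frobenius_pushforward p e R) Y.

End Schemes.

(** * Curves given by their function field *)

Section Curves.
Variables (k F : fieldType) (iota : {rmorphism k -> F}).

Definition is_function_field :=
  exists x : F, ~ algebraicOver iota x /\
  exists n (s : 'I_n -> F), forall f : F,
  exists (h : {poly k}) (c : 'I_n -> {poly k}), h != 0 /\
    (map_poly iota h).[x] * f = \sum_(i < n) (map_poly iota (c i)).[x] * s i.

(* Normalized discrete valuations of F trivial on k; the value at 0, really
   +oo, is fixed to 0. *)
Definition is_place (v : F -> int) :=
  [/\ v 0 = 0 /\ (forall c, c != 0 -> v (iota c) = 0),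
      forall x y, x != 0 -> y != 0 -> v (x * y) = v x + v y,
      forall x y, x != 0 -> y != 0 -> x + y != 0 ->
        Num.min (v x) (v y) <= v (x + y)
    & exists2 x, x != 0 & v x = 1].

(* The closed points of the smooth projective curve with function field F. *)
Record place := Place { place_val :> F -> int; placeP : is_place place_val }.

HB.instance Definition _ := gen_eqMixin place.
HB.instance Definition _ := gen_choiceMixin place.

(* A divisor D stands for the line bundle O(D), every line bundle on the curve
   being of this form. *)
Local Notation divisor := {freeg place}.
Implicit Types (D : divisor) (U : set place).

(* Sections of O(D) over U. *)
Definition sections D U : set F :=
  [set f | f = 0 \/ forall P : place, U P -> 0 <= P f + coeff P D].

Definition has_rank (W : set F) n :=
  exists B : 'I_n -> F, (forall i, W (B i)) /\
  forall f, W f -> exists! c : {ffun 'I_n -> k},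
    f = \sum_(i < n) iota (c i) * B i.

(* g is the maximum of deg D + 1 - h^0(D). *)
Definition has_genus (g : int) :=
  (forall D n, has_rank (sections D setT) n -> deg D + 1 - n%:Z <= g) /\
  (exists D n, has_rank (sections D setT) n /\ deg D + 1 - n%:Z = g).

Definition is_elliptic := is_function_field /\ has_genus 1.

(* The affine open subsets of the curve are the complements of the nonempty
   finite sets of closed points. *)
Definition affine_open U := exists2 S, finite_set S /\ S !=set0 & U = ~` S.

(* Every point P lies in the locus where some section f of O(nD), n > 0, does
   not vanish, and that locus is affine, i.e. f vanishes somewhere. *)
Definition ample D :=
  forall P : place, exists n f,
    [/\ (0 < n)%N, f != 0, sections (D *+ n) setT f,
        P f + coeff P (D *+ n) = 0
      & exists Q : place, 0 < Q f + coeff Q (D *+ n)].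

Definition Kt := {fraction {poly F}}.

(* \bigoplus_(n >= 0) H^0(U, O(nD)) t^n, inside F(t). *)
Definition section_ring D U : set Kt :=
  [set z | exists2 q : {poly F},
     forall n, sections (D *+ n) U q`_n & z = FracField.tofrac q].

(* Spec_E (\bigoplus_(n >= 0) O(nD) t^n), glued from its affine open subsets
   lying over the affine open subsets U of E. *)
Definition min_resolution D : set (set Kt) :=
  [set O | exists2 U, affine_open U & spec (section_ring D U) O].

(* Self-intersection in [min_resolution D] of the zero section, whose conormal
   bundle is O(D). *)
Definition zero_section_self_intersection D : int := - deg D.

End Curves.

(** * The torsion-free pullback of F^e_* R *)

Section TorsionFreePullback.
Variables (K : fieldType) (p e : nat) (R O : set K).
Hypotheses (pcharK : p \in [pchar K]) (subR : is_subring R)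
  (subO : is_subring O) (subRO : R `<=` O)
  (fracR : forall x, exists a b, [/\ R a, R b, b != 0 & x = a / b]).

Let q := (p ^ e)%N.

Let frobD (a b : K) : (a + b) ^+ q = a ^+ q + b ^+ q.
Proof.
rewrite /q; elim: e => [|n IH]; first by rewrite expn0 !expr1.
by rewrite expnSr !exprM IH -!(pFrobenius_autE pcharK) pFrobenius_autD_comm //; exact: mulrC.
Qed.

Let sub0 (A : set K) : is_subring A -> A 0.
Proof. by case=> A1 AB _; rewrite -(subrr 1); apply: AB. Qed.

Let subD (A : set K) x y : is_subring A -> A x -> A y -> A (x + y).
Proof.
move=> sA Ax Ay; case: (sA) => _ AB _.
by rewrite -(opprK y) -[- y]sub0r; apply: (AB) => //; apply: (AB) => //; exact: sub0.
Qed.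

Let subX (A : set K) x n : is_subring A -> A x -> A (x ^+ n).
Proof.
move=> sA Ax; elim: n => [|n IH]; first by rewrite expr0; case: sA.
by rewrite exprS; case: sA => _ _; exact.
Qed.

Lemma frobenius_pushforward_module (A : set K) :
  is_subring A -> is_module A (frobenius_pushforward p e A).
Proof.
move=> sA; have [A1 AB AM] := sA; split=> /=.
- by split=> //; exact: sub0.
- by move=> a u Aa Au; apply: (AM) => //; exact: subX.
- by move=> a u v _ _ _; rewrite mulrDr.
- by move=> a b u _ _ _; rewrite frobD mulrDl exprMn mulrA.
- by move=> u _; rewrite expr1n mul1r.
Qed.

Let common_denominator n (a : 'I_n -> K) :
  exists c, [/\ R c, c != 0 & forall i, R (c * a i)].
Proof.
have [R1 _ RM] := subR.
elim: n a => [|n IH] a; first by exists 1; split=> //; [exact: oner_neq0|case].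
have [c [Rc c0 Rca]] := IH (fun i => a (fintype.lift ord0 i)).
have [x [y [Rx Ry y0 axy]]] := fracR (a ord0).
exists (c * y); split; [exact: RM|by rewrite mulf_neq0|move=> i].
case: (unliftP ord0 i) => [j ->|->].
  by rewrite mulrAC; exact: RM.
by rewrite axy -mulrA (mulrC y) divfK //; exact: RM.
Qed.

(* The kernel of O (x)_R F^e_* R -> [torsion_free_pullback O (F^e_* R)] consists
   of the torsion elements. *)
Lemma frobenius_pullback_torsion n (a m : 'I_n -> K) :
  (forall i, O (a i)) -> (forall i, R (m i)) ->
  \sum_(i < n) a i ^+ q * m i = 0 <->
  exists2 c, O c /\ c != 0 &
    tensor_zero R (N := regular O) (M := frobenius_pushforward p e R)
      (fun i => c * a i) m.
Proof.
move=> Oa Rm; have [O1 OB OM] := subO; have [R1 RB RM] := subR; split.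
  move=> am0; have [c [Rc c0 Rca]] := common_denominator a.
  exists c; first by split=> //; exact: subRO.
  move=> U b mU [bl br].
  have bi i : b (c * a i) (m i) = b 1 ((c * a i) ^+ q * m i).
    have [_ _ /(_ (c * a i) 1 (Rca i) O1) /=] := br _ (Rm i).
    rewrite mulr1 => ->.
    by have [_ _ /(_ (c * a i) (m i) (Rca i) (Rm i)) /= ->] := bl _ O1.
  rewrite (eq_bigr _ (fun i _ => bi i)).
  have [_ badd _] := bl _ O1.
  have b0 : b 1 0 = 0.
    by have /eqP := badd 0 0 (sub0 subR) (sub0 subR);
       rewrite addr0 -subr_eq0 opprD addNKr oppr_eq0 => /eqP.
  have Rs r (P : pred 'I_n) : R (\sum_(i <- r | P i) (c * a i) ^+ q * m i).
    elim/big_ind: _ => [|x y Rx Ry|i _]; [exact: sub0|exact: subD|].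
    by apply: (RM) => //; exact: subX.
  have -> : \sum_(i < n) b 1 ((c * a i) ^+ q * m i)
          = b 1 (\sum_(i < n) (c * a i) ^+ q * m i).
    elim: (index_enum _) => [|i r IH]; first by rewrite !big_nil b0.
    rewrite !big_cons IH badd //=.
    by apply: (RM) => //; exact: subX.
  rewrite (eq_bigr (fun i => c ^+ q * (a i ^+ q * m i))); last first.
    by move=> i _; rewrite exprMn mulrA.
  by rewrite -mulr_sumr am0 mulr0.
case=> c [Oc c0] /(_ (frobenius_pushforward p e setT) (fun x y => x ^+ q * y)).
have sT : is_subring (setT : set K) by [].
have mT : is_module R (frobenius_pushforward p e setT).
  by split=> //= *; rewrite ?mulrDr ?frobD ?mulrDl ?exprMn ?mulrA ?expr1n ?mul1r.
move=> /(_ mT) am0; have {am0} : \sum_(i < n) (c * a i) ^+ q * m i = 0.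
  apply: am0; split=> [x _|y _]; split=> //=.
  - by move=> u v _ _; rewrite mulrDr.
  - by move=> r u _ _; rewrite mulrCA.
  - by move=> u v _ _; rewrite frobD mulrDl.
  - by move=> r u _ _; rewrite exprMn mulrA.
rewrite (eq_bigr (fun i => c ^+ q * (a i ^+ q * m i))); last first.
  by move=> i _; rewrite exprMn mulrA.
by rewrite -mulr_sumr => /eqP; rewrite mulf_eq0 expf_eq0 (negbTE c0) andbF /= => /eqP.
Qed.

End TorsionFreePullback.

(* Main.v *)
(* Let q = p^e, let d = deg L, and let O' be a local ring of the minimal resolution over a point
   P of the curve.  Sections of i L and of (i + q) L, 0 <= i < q, of orders 0, .., q - 1 at P give q^2
   elements of R which form a basis of the q-th powers of O' times R over the q-th powers of O'.
   This is where d is not a power of p: for i d < q, H^0(i L) is spanned by sections of distinct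
   orders < q, for i d > q all these orders occur, and i d = q is excluded.  So the minimal
   resolution is a flattening of F^e_* R, and it dominates FB_e(X).  Conversely let O be a local
   ring of FB_e(X) dominated by O'.  By flatness of the pullback to O, the coordinates in the
   above basis of every element of R lie in O.  For a section of q L of order q + 1 at P, one of
   them is a function f on the curve with a simple zero at P.  Hence the integral closure of O
   contains all functions regular where f is, and it has O' as a localization. *)

Require Import Defs.
From HB Require Import structures.
From mathcomp Require Import all_boot all_order all_algebra.
From mathcomp Require Import boolp classical_sets cardinality.
From mathcomp Require Import freeg.
From mathcomp Require Import ring zify.

Set Implicit Arguments.
Unset Strict Implicit.
Unset Printing Implicit Defensive.

Import Order.TTheory GRing.Theory Num.Theory.
Local Open Scope classical_set_scope.
Local Open Scope ring_scope.


(** The hypothesis on the genus gives Riemann's inequality and one divisor where it is sharp. No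
    duality is used: finiteness of zeros and poles, degree 0 of principal divisors, h^0(D) = deg D
    for deg D >= 1 and [F : F^q] <= q all come from comparing dimensions of spaces of sections. For
    q-th powers the decisive remark is that their orders are divisible by q, so summands whose
    orders are distinct modulo q cannot cancel; the independence of the basis and the integrality of
    coordinates both follow. On the side of the blowup the obstacle is that over O the basis is
    known to lie in the pullback, but not to generate it; this is what flatness has to supply. It
    yields only one function f with a simple zero, and the functions regular where f is are finite
    over k[f] without lying in it, which is why an integral closure appears. An equality of sets of
    local rings also demands that the normalization contain nothing else: each of its members is
    dominated by a valuation ring (Chevalley), whose centres on the two schemes are compared. *)

(** * Linear algebra over k inside F *)

Section LinearAlgebra.
Variables (k F : fieldType) (iota : {rmorphism k -> F}).
Implicit Types W : set F.

Definition in_span m (y : 'I_m -> F) (x : F) :=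
  exists c : 'I_m -> k, x = \sum_(i < m) iota (c i) * y i.

Definition independent n (x : 'I_n -> F) :=
  forall c : 'I_n -> k, \sum_(i < n) iota (c i) * x i = 0 -> forall i, c i = 0.

Definition spanned_by W n := exists y : 'I_n -> F, forall f, W f -> in_span y f.

Definition is_subspace W :=
  [/\ W 0, forall x y, W x -> W y -> W (x + y) & forall c x, W x -> W (iota c * x)].

Lemma subspace_sum W n (x : 'I_n -> F) (c : 'I_n -> k) :
  is_subspace W -> (forall i, W (x i)) -> W (\sum_(i < n) iota (c i) * x i).
Proof.
by case=> W0 WD WZ Wx; elim/big_ind: _ => // i _; apply: WZ.
Qed.

Lemma dependent_of_span n m (x : 'I_n -> F) (y : 'I_m -> F) : (m < n)%N ->
  (forall i, in_span y (x i)) ->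
  exists2 c : 'I_n -> k, (exists i, c i != 0) & \sum_(i < n) iota (c i) * x i = 0.
Proof.
move=> mn /choice[C xC].
pose A : 'M[k]_(n, m) := \matrix_(i, j) C i j.
have : kermx A != 0.
  rewrite -mxrank_eq0 mxrank_ker -lt0n subn_gt0.
  exact: leq_ltn_trans (rank_leq_col A) mn.
case/rowV0Pn=> v /sub_kermxP vA v0.
exists (v 0); first by case/rV0Pn: v0 => i vi; exists i.
under eq_bigr => i _ do rewrite xC mulr_sumr.
rewrite exchange_big big1 //= => j _.
have vAj : \sum_i v 0 i * C i j = 0.
  have /rowP/(_ j) := vA; rewrite !mxE => vA0.
  by rewrite -[RHS]vA0; apply: eq_bigr => i _; rewrite mxE.
under eq_bigr => i _ do rewrite mulrA -rmorphM.
by rewrite -mulr_suml -rmorph_sum vAj rmorph0 mul0r.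
Qed.

Lemma independent_size W n m (x : 'I_n -> F) :
  independent x -> (forall i, W (x i)) -> spanned_by W m -> (n <= m)%N.
Proof.
move=> ix Wx [y Wy]; rewrite leqNgt; apply/negP => mn.
have [c [i ci] xc] := dependent_of_span mn (fun i => Wy _ (Wx i)).
by move/eqP: ci; apply; exact: ix.
Qed.

Lemma spanned_byS W W' n : W `<=` W' -> spanned_by W' n -> spanned_by W n.
Proof. by move=> WW' [y yW']; exists y => f /WW'; exact: yW'. Qed.

Definition oapp_lift n (T : Type) (x0 : T) (x : 'I_n -> T) : 'I_n.+1 -> T :=
  fun i => oapp x x0 (unlift ord0 i).

Lemma oapp_lift0 n T (x0 : T) (x : 'I_n -> T) : oapp_lift x0 x ord0 = x0.
Proof. by rewrite /oapp_lift unlift_none. Qed.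

Lemma oapp_liftS n T (x0 : T) (x : 'I_n -> T) i : oapp_lift x0 x (fintype.lift ord0 i) = x i.
Proof. by rewrite /oapp_lift liftK. Qed.

Lemma spanned_by_add W W' n v :
  (forall f, W' f -> exists c, W (f - iota c * v)) ->
  spanned_by W n -> spanned_by W' n.+1.
Proof.
move=> WW' [y Wy]; exists (oapp_lift v y) => f /WW'[c /Wy[b fb]].
exists (oapp_lift c b); rewrite big_ord_recl !oapp_lift0.
under eq_bigr => i _ do rewrite !oapp_liftS.
by rewrite -fb addrC subrK.
Qed.

Lemma independent_add n (x : 'I_n -> F) v :
  independent x -> ~ in_span x v -> independent (oapp_lift v x).
Proof.
move=> ix vx c; rewrite big_ord_recl oapp_lift0.
under eq_bigr => i _ do rewrite oapp_liftS.
have [c0|c0 e] := eqVneq (c ord0) 0.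
  rewrite c0 rmorph0 mul0r add0r => /ix ci i.
  by case: (unliftP ord0 i) => [j ->|->].
case: vx; exists (fun i => - (c (fintype.lift ord0 i) / c ord0)).
apply: (mulfI (_ : iota (c ord0) != 0)); first by rewrite fmorph_eq0.
rewrite mulr_sumr.
under eq_bigr => i _ do rewrite rmorphN fmorph_div mulrA mulrN mulrCA mulfV ?fmorph_eq0 // mulr1 mulNr.
by rewrite sumrN; apply/eqP; rewrite -addr_eq0; apply/eqP.
Qed.

(** A maximal independent family is a basis. The hypothesis on the genus speaks only of spaces that
    have a rank, so finite generation has to be turned into one. *)
Lemma has_rank_exists W N : is_subspace W -> spanned_by W N ->
  exists n, has_rank iota W n /\
    exists x : 'I_n -> F, independent x /\ forall i, W (x i).
Proof.
move=> sW WN.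
pose Q n := `[< exists x : 'I_n -> F, independent x /\ forall i, W (x i) >].
have Q0 : exists n, Q n.
  by exists 0; apply/asboolP; exists (fun _ => 0); split=> [c _ []|[]].
have Qb n : Q n -> (n <= N)%N.
  by case/asboolP=> x [ix Wx]; exact: independent_size ix Wx WN.
case: (ex_maxnP Q0 Qb) => n /asboolP[x [ix Wx]] nmax.
exists n; split; last by exists x.
exists x; split=> // f Wf.
have [c fc] : in_span x f.
  apply: contrapT => nf.
  suff /nmax : Q n.+1 by rewrite ltnn.
  apply/asboolP; exists (oapp_lift f x); split; first exact: independent_add.
  by move=> i; rewrite /oapp_lift; case: unlift => [j|] /=.
exists [ffun i => c i]; split.
  by under eq_bigr => i _ do rewrite ffunE.
move=> b fb; apply/ffunP => i; rewrite ffunE; apply/eqP; rewrite -subr_eq0; apply/eqP.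
apply: (ix (fun i => c i - b i)) => {i}.
under eq_bigr => i _ do rewrite rmorphB mulrBl.
by rewrite sumrB -fc -fb subrr.
Qed.

Lemma has_rank_span W n : W 0 -> has_rank iota W n ->
  spanned_by W n.
Proof. by move=> W0 [B [WB Bf]]; exists B => f /Bf[c [fc _]]; exists c. Qed.

Lemma dependent_of_span_fin (I J : finType) (x : I -> F) (y : J -> F) :
  (#|J| < #|I|)%N ->
  (forall i, exists c : J -> k, x i = \sum_j iota (c j) * y j) ->
  exists2 c : I -> k, (exists i, c i != 0) & \sum_i iota (c i) * x i = 0.
Proof.
move=> JI xy.
have [i|c [i ci] xc] := @dependent_of_span _ _ (x \o enum_val) (y \o enum_val) JI.
  have [c xc] := xy (enum_val i); exists (c \o enum_val) => /=.
  by rewrite xc (reindex (@enum_val J J)) //; exact: onW_bij (enum_val_bij J).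
exists (c \o enum_rank); first by exists (enum_val i); rewrite /= enum_valK.
rewrite (reindex (@enum_val I I)); last exact: onW_bij (enum_val_bij I).
by rewrite -[RHS]xc; apply: eq_bigr => j _; rewrite /= enum_valK.
Qed.

End LinearAlgebra.

(** * Algebraic dependence of two functions over k *)

Section AlgebraicDependence.
Variables (k F : fieldType) (iota : {rmorphism k -> F}).

Definition evk (x : F) : {poly k} -> F := horner_eval x \o map_poly iota.

HB.instance Definition _ x := GRing.RMorphism.on (evk x).

Lemma evkE x h : evk x h = (map_poly iota h).[x]. Proof. by []. Qed.

Lemma evkC x c : evk x c%:P = iota c.
Proof. by rewrite evkE map_polyC hornerC. Qed.

Lemma evkX x : evk x 'X = x.
Proof. by rewrite evkE map_polyX hornerX. Qed.

Lemma evk_sum x (h : {poly k}) d : (size h <= d)%N ->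
  evk x h = \sum_(i < d) iota h`_i * x ^+ i.
Proof.
move=> hd; rewrite evkE (horner_coef_wide _ (leq_trans (size_poly _ _) hd)).
by apply: eq_bigr => i _; rewrite coef_map.
Qed.

(** Dimension count. F is spanned by the s_i over k(x0); let V d be the space of sums of c_i(x0) s_i
    with c_i of size at most d, of dimension at most n d. Multiplication by H x or H f, with H a
    common denominator, raises d by a constant e', so the (M + 1)^2 monomials x^a f^b, multiplied by
    H^(2M + 1), lie in a space of dimension linear in M. *)
Lemma algebraically_dependent (x f : F) : is_function_field iota ->
  exists2 p : {poly {poly k}}, p != 0 & (map_poly (evk x) p).[f] = 0.
Proof.
case=> x0 [x0tr [n [s gen]]].
have /choice[hc hcP] : forall g : F, exists hc : {poly k} * ('I_n -> {poly k}),
    hc.1 != 0 /\ evk x0 hc.1 * g = \sum_(i < n) evk x0 (hc.2 i) * s i.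
  by move=> g; have [h [c [h0 E]]] := gen g; exists (h, c).
pose V d (z : F) := exists2 c : 'I_n -> {poly k}, (forall i, (size (c i) <= d)%N) &
  z = \sum_(i < n) evk x0 (c i) * s i.
have VD d z z' : V d z -> V d z' -> V d (z + z').
  move=> [c cd ->] [c' c'd ->]; exists (fun i => c i + c' i).
    by move=> i; rewrite (leq_trans (size_polyD _ _)) // geq_max cd c'd.
  by rewrite -big_split /=; apply: eq_bigr => i _; rewrite rmorphD mulrDl.
have V0 d : V d 0.
  by exists (fun=> 0) => [i|]; rewrite ?size_poly0 // big1 // => i _; rewrite rmorph0 mul0r.
have VW d d' z : (d <= d')%N -> V d z -> V d' z.
  by move=> dd' [c cd ->]; exists c => // i; exact: leq_trans (cd i) dd'.
have VM d d' (a : {poly k}) z : (size a <= d')%N -> V d z -> V (d + d')%N (evk x0 a * z).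
  move=> ad [c cd ->]; exists (fun i => a * c i).
    move=> i; apply: leq_trans (size_polyMleq _ _) _.
    by apply: leq_trans (leq_pred _) _; rewrite addnC leq_add.
  by rewrite mulr_sumr; apply: eq_bigr => i _; rewrite rmorphM mulrA.
pose G : seq F := 1 :: [seq g * s i | g <- [:: x; f], i <- enum 'I_n].
have [H [e [H0 HG]]] : exists H e, H != 0 /\ forall g, g \in G -> V e (evk x0 H * g).
  elim: G => [|g G [H [e [H0 IH]]]]; first by exists 1, 0%N; split; rewrite ?oner_neq0.
  have [h0 hE] := hcP g.
  pose d := (\max_(i < n) size ((hc g).2 i))%N.
  exists (H * (hc g).1), (maxn (d + size H) (e + size (hc g).1))%N.
  split; first by rewrite mulf_neq0.
  move=> g'; rewrite inE => /orP[/eqP->|/IH Vg'].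
    rewrite rmorphM -mulrA hE; apply: (VW) (leq_maxl _ _) _; apply: VM => //.
    by exists (hc g).2 => // i; rewrite /d (leq_bigmax i).
  by rewrite rmorphM (mulrC (evk x0 H)) -mulrA; apply: VW (leq_maxr _ _) _; exact: VM.
have Vstep g d z : g \in [:: x; f] -> V d z -> V (d + e)%N (evk x0 H * g * z).
  move=> gxf [c cd ->]; rewrite mulr_sumr; elim/big_ind: _ => [|a b|i _]; [exact: V0|exact: VD|].
  rewrite mulrCA addnC; apply: VM (cd i) _; rewrite -mulrA; apply: HG.
  rewrite inE; apply/orP; right; apply/allpairsP; exists (g, i); split=> //=.
  by rewrite mem_enum.

have VH d z : V d z -> V (d + size H)%N (evk x0 H * z) by exact: VM.
have [e' [ee' VH1 VHz Vsteps]] : exists e', [/\ (0 < e')%N, V e' (evk x0 H),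
    forall d z, V d z -> V (d + e')%N (evk x0 H * z) &
    forall g d z, g \in [:: x; f] -> V d z -> V (d + e')%N (evk x0 H * g * z)].
  exists (e + size H).+1; split=> //.
  - apply: (VW e); first by rewrite (leq_trans (leq_addr (size H) e)).
    by rewrite -[evk x0 H]mulr1; apply: HG; rewrite inE eqxx.
  - by move=> d z /VH; apply: VW; rewrite leq_add2l (leq_trans (leq_addl e _)).
  - by move=> g d z gxf /(Vstep _ _ _ gxf); apply: VW; rewrite leq_add2l (leq_trans (leq_addr (size H) e)).
have Vpow g d z m : (g = evk x0 H \/ exists2 g', g' \in [:: x; f] & g = evk x0 H * g') ->
    V d z -> V (d + m * e')%N (g ^+ m * z).
  move=> gg Vz; elim: m => [|m IH]; first by rewrite mul0n addn0 expr0 mul1r.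
  rewrite exprS -mulrA mulSn (addnC e') addnA.
  by case: gg IH => [->|[g' g'xf ->]] IH; [exact: VHz|exact: Vsteps].
(* Of the 2M + 1 factors H, one is the starting element of V, a + b accompany x and f, and the
   others are spare. *)
have Vmon M a b : (a <= M)%N -> (b <= M)%N ->
    V ((M + M).+1 * e')%N (evk x0 H ^+ (M + M).+1 * (x ^+ a * f ^+ b)).
  move=> aM bM.
  have -> : evk x0 H ^+ (M + M).+1 * (x ^+ a * f ^+ b) =
      evk x0 H ^+ (M + M - a - b) * ((evk x0 H * x) ^+ a * ((evk x0 H * f) ^+ b * evk x0 H)).
    have -> : (M + M).+1 = ((M + M - a - b) + a + b + 1)%N by lia.
    rewrite !exprD expr1 !exprMn.
    move: (evk x0 H) => u; move: (u ^+ (M + M - a - b)) (u ^+ a) (u ^+ b) (x ^+ a) (f ^+ b).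
    by move=> *; ring.
  have -> : ((M + M).+1 * e' = e' + b * e' + a * e' + (M + M - a - b) * e')%N by nia.
  apply: (Vpow); first by left.
  apply: (Vpow); first by right; exists x; rewrite ?inE ?eqxx.
  by apply: (Vpow) => //; right; exists f; rewrite ?inE ?eqxx ?orbT.
(* With this M the target has dimension n (2M + 1) e' = M^2 + M / 2 < (M + 1)^2. *)
pose M := (2 * n * e')%N.
pose D := ((M + M).+1 * e')%N.
have [|i|c [[a0 b0] ci] xc] := @dependent_of_span_fin _ _ iota ('I_M.+1 * 'I_M.+1)%type ('I_n * 'I_D)%type
  (fun ij => evk x0 H ^+ (M + M).+1 * (x ^+ ij.1 * f ^+ ij.2)) (fun ij => x0 ^+ ij.2 * s ij.1).
- by rewrite !card_prod !card_ord /D /M; nia.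
- have [b bD ->] := Vmon M i.1 i.2 (leq_ord _) (leq_ord _).
  exists (fun j : ('I_n * 'I_D)%type => (b j.1)`_(j.2 : nat)).
  rewrite -(pair_bigA _ (fun j1 (j2 : 'I_D) => iota (b j1)`_j2 * (x0 ^+ j2 * s j1))) /=.
  apply: eq_bigr => j _; rewrite (evk_sum _ (bD j)) mulr_suml.
  by apply: eq_bigr => l _; rewrite mulrA.
pose p : {poly {poly k}} := \poly_(b < M.+1) \poly_(a < M.+1) c (inord a, inord b).
exists p.
  apply/eqP => /polyP/(_ b0); rewrite coef_poly ltn_ord coef0 => /polyP/(_ a0).
  by rewrite coef_poly ltn_ord coef0 !inord_val => /eqP; exact/negP.
have hH : evk x0 H ^+ (M + M).+1 != 0.
  rewrite expf_neq0 //; apply/eqP => evH0; apply: x0tr; exists H => //.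
  by rewrite /root -evkE evH0.
apply: (mulfI hH); rewrite mulr0 -[RHS]xc.
rewrite (horner_coef_wide _ (leq_trans (size_poly _ _) (size_poly _ _))) mulr_sumr.
rewrite [RHS](_ : _ = \sum_(a < M.+1) \sum_(b < M.+1)
    iota (c (a, b)) * (evk x0 H ^+ (M + M).+1 * (x ^+ a * f ^+ b))); last first.
  by rewrite pair_bigA; apply: eq_bigr => -[].
rewrite [RHS]exchange_big /=; apply: eq_bigr => b _.
rewrite coef_map /= coef_poly ltn_ord (evk_sum _ (size_poly _ _)) mulr_suml mulr_sumr.
apply: eq_bigr => a _; rewrite coef_poly ltn_ord !inord_val; ring.
Qed.

End AlgebraicDependence.

(** * Orders at a place *)

Section Places.
Variables (k F : fieldType) (iota : {rmorphism k -> F}).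
Implicit Types (P : place iota) (x y : F) (n : int).

Lemma place0 P : P 0 = 0. Proof. by case: (placeP P) => -[]. Qed.

Lemma placeC P c : P (iota c) = 0.
Proof.
have [->|c0] := eqVneq c 0; first by rewrite rmorph0 place0.
by case: (placeP P) => -[_ + _ _ _]; exact.
Qed.

Lemma place1 P : P 1 = 0. Proof. by rewrite -(rmorph1 iota) placeC. Qed.

Lemma placeM P x y : x != 0 -> y != 0 -> P (x * y) = P x + P y.
Proof. by case: (placeP P) => _ + _ _; exact. Qed.

Lemma placeV P x : P x^-1 = - P x.
Proof.
have [->|x0] := eqVneq x 0; first by rewrite invr0 place0 oppr0.
by apply/eqP; rewrite -addr_eq0 -placeM ?invr_eq0 // mulVf // place1.
Qed.

Lemma place_div P x y : x != 0 -> y != 0 -> P (x / y) = P x - P y.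
Proof. by move=> x0 y0; rewrite placeM ?invr_eq0 // placeV. Qed.

Lemma placeX P x m : P (x ^+ m) = P x *+ m.
Proof.
have [->|x0] := eqVneq x 0.
  by case: m => [|m]; rewrite ?expr0 ?place1 // exprS mul0r place0 mul0rn.
elim: m => [|m IH]; first by rewrite expr0 place1.
by rewrite exprS mulrS placeM ?IH // expf_neq0.
Qed.

Lemma placeN P x : P (- x) = P x.
Proof.
have [->|x0] := eqVneq x 0; first by rewrite oppr0.
rewrite -mulN1r placeM // ?oppr_eq0 ?oner_neq0 //.
by rewrite -(rmorph1 iota) -rmorphN placeC add0r.
Qed.

Lemma placeZ P c x : c != 0 -> P (iota c * x) = P x.
Proof.
move=> c0; have [->|x0] := eqVneq x 0; first by rewrite mulr0.
by rewrite placeM ?fmorph_eq0 // placeC add0r.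
Qed.

(* "The order of x at P is at least n", the order of 0 being infinite. *)
Definition order_ge P n x := x = 0 \/ n <= P x.

Lemma order_ge0 P n : order_ge P n 0. Proof. by left. Qed.

Lemma order_geE P n x : x != 0 -> order_ge P n x <-> n <= P x.
Proof. by move=> /eqP x0; split=> [[]|] //; right. Qed.

Lemma order_geD P n x y : order_ge P n x -> order_ge P n y -> order_ge P n (x + y).
Proof.
move=> [->|nx]; first by rewrite add0r.
move=> [->|ny]; first by rewrite addr0; right.
have [->|x0] := eqVneq x 0; first by rewrite add0r; right.
have [->|y0] := eqVneq y 0; first by rewrite addr0; right.
have [->|xy0] := eqVneq (x + y) 0; first by left.
right; case: (placeP P) => _ _ /(_ x y x0 y0 xy0) + _; apply: le_trans.
by rewrite le_min nx.
Qed.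

Lemma order_geN P n x : order_ge P n x -> order_ge P n (- x).
Proof. by move=> [->|nx]; [left; rewrite oppr0|right; rewrite placeN]. Qed.

Lemma order_geB P n x y : order_ge P n x -> order_ge P n y -> order_ge P n (x - y).
Proof. by move=> nx ny; apply: order_geD => //; exact: order_geN. Qed.

Lemma order_geM P n m x y :
  order_ge P n x -> order_ge P m y -> order_ge P (n + m) (x * y).
Proof.
move=> [->|nx]; first by left; rewrite mul0r.
move=> [->|ny]; first by left; rewrite mulr0.
have [->|x0] := eqVneq x 0; first by left; rewrite mul0r.
have [->|y0] := eqVneq y 0; first by left; rewrite mulr0.
by right; rewrite placeM // lerD.
Qed.

Lemma order_geX P n x m : order_ge P n x -> order_ge P (n *+ m) (x ^+ m).
Proof.
move=> nx; elim: m => [|m IH]; first by right; rewrite place1.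
by rewrite exprS mulrS; exact: order_geM.
Qed.

Lemma order_geC P c : order_ge P 0 (iota c).
Proof. by right; rewrite placeC. Qed.

Lemma order_geZ P n c x : order_ge P n x -> order_ge P n (iota c * x).
Proof. by move=> nx; rewrite -[n]add0r; apply: order_geM => //; exact: order_geC. Qed.

Lemma order_geW P n m x : m <= n -> order_ge P n x -> order_ge P m x.
Proof. by move=> mn [->|nx]; [left|right; exact: le_trans nx]. Qed.

Lemma order_ge_sum P n (I : Type) (r : seq I) (Q : pred I) (f : I -> F) :
  (forall i, Q i -> order_ge P n (f i)) -> order_ge P n (\sum_(i <- r | Q i) f i).
Proof.
by move=> nf; elim/big_ind: _ => //; [exact: order_ge0|move=> x y; exact: order_geD].
Qed.

Lemma place_addl P x y : x != 0 -> order_ge P (P x + 1) y ->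
  x + y != 0 /\ P (x + y) = P x.
Proof.
move=> x0 yx.
have xy0 : x + y != 0.
  apply/eqP => /eqP; rewrite addrC addr_eq0 => /eqP yE.
  case: yx => [y0|]; first by move/eqP: yE; rewrite y0 eq_sym oppr_eq0 (negbTE x0).
  by rewrite yE placeN; lia.
split=> //; apply/le_anti/andP; split.
  rewrite leNgt; apply/negP => lt.
  have : order_ge P (P x + 1) (x + y - y).
    by apply: order_geB => //; right; lia.
  by rewrite addrK order_geE //; lia.
have : order_ge P (P x) (x + y).
  by apply: order_geD; [right|apply: order_geW yx; lia].
by rewrite order_geE.
Qed.

(** The term of least order is alone in its order, so the sum has that order and cannot vanish.
    Independence and integrality over q-th powers rest on this. *)
Lemma place_sum_distinct P (I : finType) (x : I -> F) :
  (forall i j, x i != 0 -> x j != 0 -> P (x i) = P (x j) -> i = j) ->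
  forall j, x j != 0 -> \sum_i x i != 0 /\ P (\sum_i x i) <= P (x j).
Proof.
move=> dist j xj.
case: (@Order.TotalTheory.arg_minP _ _ _ j (fun i => x i != 0) (fun i => P (x i)) xj) => j0 xj0 min.
rewrite (bigD1 j0) //=.
have [|s0 sE] := @place_addl P (x j0) (\sum_(i | i != j0) x i) xj0.
  apply: order_ge_sum => i ij0; have [->|xi] := eqVneq (x i) 0; first exact: order_ge0.
  right; have := min i xi; rewrite le_eqVlt => /orP[/eqP e|]; last by lia.
  by rewrite (dist _ _ xj0 xi e) eqxx in ij0.
by split=> //; rewrite sE min.
Qed.

End Places.

(** * Residue fields of places *)

Section Residues.
Variables (k : closedFieldType) (F : fieldType) (iota : {rmorphism k -> F}).
Hypothesis ff : is_function_field iota.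
Implicit Types (P : place iota).

Definition constant (x : F) := exists c, x = iota c.

Lemma evk_eq0 (x : F) (h : {poly k}) : ~ constant x -> evk iota x h = 0 -> h = 0.
Proof.
move=> xc; have [r rE] := closed_field_poly_normal h.
rewrite {1}rE evkE map_polyZ hornerZ rmorph_prod horner_prod => /eqP.
rewrite mulf_eq0 fmorph_eq0 lead_coef_eq0 => /orP[/eqP //|].
rewrite prodf_seq_eq0 => /hasP[z _] /=.
by rewrite map_polyXsubC hornerXsubC subr_eq0 => /eqP xz; case: xc; exists z.
Qed.

(** The nonzero terms of the relation have orders i * P u, pairwise distinct if P u is not 0, and
    then they cannot cancel. *)
Lemma place_eq0_of_relation P x u (p : {poly {poly k}}) : ~ constant x ->
  (forall i, p`_i != 0 -> P (evk iota x p`_i) = 0) ->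
  p != 0 -> (map_poly (evk iota x) p).[u] = 0 -> P u = 0.
Proof.
move=> xc Ph p0.
have [->|u0] := eqVneq u 0; first by rewrite place0.
rewrite (horner_coef_wide _ (size_poly _ _)) => E.
apply/eqP; apply: contraT => Pu.
have [j pj] : exists j : 'I_(size p), p`_j != 0.
  have lt : ((size p).-1 < size p)%N by rewrite prednK // lt0n size_poly_eq0.
  by exists (Ordinal lt); rewrite /= -lead_coefE lead_coef_eq0.
have nz i : (evk iota x p`_i != 0) = (p`_i != 0).
  by congr negb; apply/eqP/eqP => [|->]; [exact: evk_eq0|rewrite rmorph0].
pose y (i : 'I_(size p)) := (map_poly (evk iota x) p)`_i * u ^+ i.
have dist i i' : y i != 0 -> y i' != 0 -> P (y i) = P (y i') -> i = i'.
  rewrite /y !coef_map /= !mulf_eq0 !negb_or => /andP[a b] /andP[c d].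
  rewrite !placeM // !placeX !Ph -?nz // !add0r -mulr_natr -[RHS]mulr_natr => /(mulfI Pu)/eqP.
  by rewrite eqr_nat => /eqP/val_inj.
have yj : y j != 0 by rewrite /y coef_map /= mulf_neq0 ?nz // expf_neq0.
by have [] := place_sum_distinct dist yj; rewrite E eqxx.
Qed.

(** Otherwise every x - c has order 0, hence so has every nonzero polynomial in x, k being
    algebraically closed. A uniformizer is algebraic over k(x), and a relation with coefficients of
    order 0 would force its order to be 0. *)
Lemma residue_exists P x : order_ge P 0 x -> exists c, order_ge P 1 (x - iota c).
Proof.
move=> x0; apply: contrapT => /forallNP nc.
have xc : ~ constant x by case=> c xc; apply: (nc c); rewrite xc subrr; left.
have Pc c : x - iota c != 0 /\ P (x - iota c) = 0.
  have nz : x - iota c != 0.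
    by apply/eqP => /eqP; rewrite subr_eq0 => /eqP e; apply: xc; exists c.
  split=> //; have : order_ge P 0 (x - iota c) by apply: order_geB => //; exact: order_geC.
  have := nc c; rewrite !order_geE //; lia.
have Ph h : h != 0 -> P (evk iota x h) = 0.
  have [r rE] := closed_field_poly_normal h.
  rewrite -lead_coef_eq0 rE evkE map_polyZ hornerZ rmorph_prod horner_prod -rE => h0.
  rewrite placeZ //; elim: r {rE} => [|z r IH]; first by rewrite big_nil place1.
  have [z0 Pz] := Pc z.
  have rE : \prod_(i <- r) (map_poly iota ('X - i%:P)).[x] != 0.
    rewrite prodf_seq_neq0; apply/allP => y _ /=.
    by rewrite map_polyXsubC hornerXsubC; case: (Pc y).
  by rewrite big_cons /= map_polyXsubC hornerXsubC placeM // Pz IH addr0.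
case: (placeP P) => _ _ _ [u u0 Pu].
have [p p0 pu] := algebraically_dependent x u ff.
by have := place_eq0_of_relation xc (fun i => Ph p`_i) p0 pu; rewrite Pu.
Qed.

End Residues.

(** * Divisors and their sections *)

Section Divisors.
Variables (k : fieldType) (F : fieldType) (iota : {rmorphism k -> F}).
Implicit Types (P : place iota) (D : {freeg (place iota)}) (U : set (place iota)).

(* [coeff] with its values in [int] proper, for the sake of [lia]. *)
Definition mult P D : int := coeff P D.

Lemma mult0 P : mult P 0 = 0. Proof. exact: coeff0. Qed.
Lemma multD P D D' : mult P (D + D') = mult P D + mult P D'. Proof. exact: coeffD. Qed.
Lemma multN P D : mult P (- D) = - mult P D. Proof. exact: coeffN. Qed.
Lemma multB P D D' : mult P (D - D') = mult P D - mult P D'. Proof. exact: coeffB. Qed.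
Lemma multMn P D n : mult P (D *+ n) = mult P D * n%:Z.
Proof. by rewrite /mult coeffMn -mulr_natr natz. Qed.
Lemma mult_point P Q : mult P << Q >> = (Q == P)%:Z.
Proof. by rewrite /mult coeffU mul1r; case: eqP. Qed.
Lemma mult_point_eq P : mult P << P >> = 1. Proof. by rewrite mult_point eqxx. Qed.
Lemma mult_point_neq P Q : Q != P -> mult P << Q >> = 0.
Proof. by rewrite mult_point => /negbTE ->. Qed.

Lemma mult_fgpos P D : mult P (fgpos D) = Num.max 0 (mult P D).
Proof. exact: coeff_fgposE. Qed.

Lemma mult_inj D D' : (forall P, mult P D = mult P D') -> D = D'.
Proof. by move=> DD'; apply/eqP/freeg_eqP. Qed.

Lemma mult_outdom P D : P \notin dom D -> mult P D = 0.
Proof. exact: coeff_outdom. Qed.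

Lemma mult_fgle D D' : (forall P, mult P D <= mult P D') -> fgle D D'.
Proof. by move=> DD'; apply/fgleP. Qed.

Lemma fgle_mult D D' P : fgle D D' -> mult P D <= mult P D'.
Proof. by move/fgleP. Qed.

Lemma mult_fgle0 D : (forall P, 0 <= mult P D) -> fgle 0 D.
Proof. by move=> D0; apply/fgposP. Qed.

Lemma fgle0_mult D P : fgle 0 D -> 0 <= mult P D.
Proof. by move/fgposP. Qed.

Lemma sectionsP D U f :
  sections D U f <-> forall P, U P -> order_ge P (- mult P D) f.
Proof.
split=> [[->|Uf] P UP|Uf]; first by left.
  by right; rewrite -subr_ge0 opprK; exact: Uf.
have [->|f0] := eqVneq f 0; [by left|right=> P UP].
by rewrite -[coeff P D]opprK subr_ge0 -order_geE //; exact: Uf.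
Qed.

Lemma sections_subspace D U : is_subspace iota (sections D U).
Proof.
split; first by left.
  by move=> x y /sectionsP Ux /sectionsP Uy; apply/sectionsP => P UP; apply: order_geD; auto.
by move=> c x /sectionsP Ux; apply/sectionsP => P UP; apply: order_geZ; auto.
Qed.

Lemma sections_le D D' U : (forall P, U P -> mult P D <= mult P D') ->
  sections D U `<=` sections D' U.
Proof.
move=> DD' f /sectionsP Uf; apply/sectionsP => P UP; apply: order_geW (Uf P UP).
by rewrite lerN2 DD'.
Qed.

Lemma sections_sub D U V : V `<=` U -> sections D U `<=` sections D V.
Proof. by move=> VU f /sectionsP Uf; apply/sectionsP => P /VU; exact: Uf. Qed.

Lemma sectionsM D D' U f g : sections D U f -> sections D' U g ->
  sections (D + D') U (f * g).
Proof.
move=> /sectionsP Uf /sectionsP Ug; apply/sectionsP => P UP.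
by rewrite multD opprD; apply: order_geM; auto.
Qed.

Lemma sections1 U : sections (0 : {freeg (place iota)}) U 1.
Proof. by apply/sectionsP => P _; rewrite mult0 oppr0; right; rewrite place1. Qed.

Lemma sectionsX D U f n : sections D U f -> sections (D *+ n) U (f ^+ n).
Proof.
move=> Uf; elim: n => [|n IH]; first exact: sections1.
by rewrite exprS mulrS; exact: sectionsM.
Qed.

Lemma effective_ind (Q : {freeg (place iota)} -> Prop) :
  Q 0 -> (forall D P, fgle 0 D -> Q D -> Q (D + << P >>)) ->
  forall D, fgle 0 D -> Q D.
Proof.
move=> Q0 QS D D0.
have [n dn] : exists n : nat, deg D = n%:Z.
  exists `|deg D|%N; rewrite gez0_abs // -(freeg_sumE D) raddf_sum sumr_ge0 // => P _.
  by rewrite /= degU; exact: (fgle0_mult P D0).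
elim: n D D0 dn => [|n IH] D D0 dn; first by rewrite (fgpos_eq0P D0 dn).
have [D00|] := eqVneq D 0; first by rewrite D00 deg0 in dn.
rewrite -dom_eq0; case E: (dom D) => [//|P s] _.
have DP : 1 <= mult P D.
  by rewrite -gtz0_ge1 lt_def -[mult P D != 0]mem_dom E inE eqxx fgle0_mult.
rewrite -(subrK << P >> D).
have DP0 : fgle 0 (D - << P >>).
  apply: mult_fgle0 => P'; rewrite multB mult_point.
  by case: eqP => [<-|_]; have := fgle0_mult P' D0; lia.
by apply: QS => //; apply: IH => //; rewrite degB degU dn; lia.
Qed.

Definition point_sum (s : seq (place iota)) : {freeg (place iota)} :=
  \sum_(P <- s) << P >>.

Lemma mult_point_sum s P : uniq s -> mult P (point_sum s) = (P \in s)%:Z.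
Proof.
rewrite /point_sum; elim: s => [|Q s IH]; first by rewrite big_nil mult0.
move=> /= /andP[Qs us]; rewrite big_cons multD IH // mult_point inE eq_sym.
by case: eqP => [->|_] /=; rewrite ?(negbTE Qs) ?addr0 ?add0r.
Qed.

Lemma deg_point_sum s : deg (point_sum s) = (size s)%:Z.
Proof.
rewrite /point_sum raddf_sum /= (eq_bigr (fun=> 1)) => [|P _]; last by rewrite degU.
by rewrite big_const_seq count_predT iter_addr_0 natz.
Qed.

End Divisors.

(** * Bounds for h^0 in genus 1 *)

Section GenusOne.
Variables (k : closedFieldType) (F : fieldType) (iota : {rmorphism k -> F}).
Hypotheses (ff : is_function_field iota) (genus1 : has_genus iota 1).
Implicit Types (P Q : place iota) (D Z : {freeg (place iota)}).

Local Notation sp := (spanned_by iota).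

(** If v has the largest pole allowed at P, the residue of f / v at P tells which multiple of v to
    subtract from f. *)
Lemma spanned_add_point D P n : sp (sections D setT) n ->
  sp (sections (D + << P >>) setT) n.+1.
Proof.
have [sub|] := pselect (sections (D + << P >>) setT `<=` sections D setT).
  apply: (@spanned_by_add _ _ _ _ _ _ 0) => f /sub Df.
  by exists 0; rewrite mulr0 subr0.
move/existsNP => [v /not_implyP[vDP vD]].
have v0 : v != 0 by apply: contra_not_neq vD => ->; left.
have cP : mult P (D + << P >>) = mult P D + 1.
  by rewrite multD mult_point_eq.
have cQ Q : Q != P -> mult Q (D + << P >>) = mult Q D.
  by move=> QP; rewrite multD mult_point_neq ?addr0 // eq_sym.
have Pv : P v = - mult P D - 1.
  apply/eqP; apply: contra_notT vD => Pv; apply/sectionsP => Q _.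
  have := (sectionsP _ _ _).1 vDP Q I.
  have [->|QP] := eqVneq Q P; last by rewrite cQ.
  by rewrite cP !order_geE //; lia.
apply: (@spanned_by_add _ _ _ _ _ _ v) => f fDP.
have [c fc] : exists c, order_ge P 1 (f / v - iota c).
  apply: (residue_exists ff).
  have := (sectionsP _ _ _).1 fDP P I; rewrite cP => fP.
  rewrite (_ : 0 = - (mult P D + 1) + (mult P D + 1)); last by lia.
  by apply: order_geM => //; right; rewrite placeV Pv; lia.
exists c; apply/sectionsP => Q _.
have [->|QP] := eqVneq Q P.
  have -> : f - iota c * v = (f / v - iota c) * v by rewrite mulrBl divfK.
  rewrite (_ : - mult P D = 1 + (- mult P D - 1)); last by lia.
  by apply: order_geM => //; right; rewrite Pv.
rewrite -(cQ _ QP); apply: order_geB; first exact: ((sectionsP _ _ _).1 fDP Q I).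
by apply: order_geZ; exact: ((sectionsP _ _ _).1 vDP Q I).
Qed.

Lemma spanned_add D Z n : fgle 0 Z -> sp (sections D setT) n ->
  exists2 m : nat, m%:Z = n%:Z + deg Z & sp (sections (D + Z) setT) m.
Proof.
move=> Z0 Dn; elim/effective_ind: Z / Z0 => [|Z P _ [m mE Zm]].
  by exists n; rewrite ?deg0 ?addr0.
exists m.+1; first by rewrite degD degU -addn1 PoszD mE; lia.
by rewrite addrA; exact: spanned_add_point.
Qed.

(** At a divisor [D0] that attains the genus, h^0 equals the degree, and every further point adds at
    most 1 to h^0. *)
Lemma sections_large : exists D0, forall D, fgle D0 D ->
  exists2 n : nat, n%:Z = deg D & sp (sections D setT) n.
Proof.
case: genus1 => _ [D0 [n0 [rk dE]]]; exists D0 => D D0D.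
have n0D : n0%:Z = deg D0 by lia.
have Z0 : fgle 0 (D - D0).
  by apply: mult_fgle0 => P; rewrite multB subr_ge0; exact: fgle_mult.
have s0 : sp (sections D0 setT) n0 by apply: has_rank_span => //; left.
have [m mE Dm] := spanned_add Z0 s0; rewrite addrC subrK in Dm.
by exists m => //; rewrite mE n0D degB; lia.
Qed.

Lemma fgle_add D Z : fgle 0 Z -> fgle D (D + Z).
Proof. by move=> Z0; apply: mult_fgle => P; rewrite multD lerDl; exact: fgle0_mult. Qed.

Lemma fgpos_ge D : fgle D (fgpos D).
Proof. by apply: mult_fgle => P; rewrite mult_fgpos le_max lexx orbT. Qed.

Lemma sections_spanned D : exists n, sp (sections D setT) n.
Proof.
have [D0 D0P] := sections_large.
have [n _ Dn] := D0P _ (fgle_add D0 (fgpos_le0 (D - D0))).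
exists n; apply: spanned_byS Dn; apply: sections_le => P _.
by rewrite multD -lerBlDl -multB; exact: (fgle_mult P (fgpos_ge _)).
Qed.

(** Riemann's inequality h^0(D) >= deg D, in the form used by dimension counts. *)
Lemma sections_independent D : exists n, deg D <= n%:Z /\
  exists x : 'I_n -> F, independent iota x /\ forall i, sections D setT (x i).
Proof.
have [N DN] := sections_spanned D.
have [n [rk ix]] := has_rank_exists (sections_subspace D setT) DN.
by exists n; split=> //; have := genus1.1 _ _ rk; lia.
Qed.

End GenusOne.

(** * Principal divisors and Riemann-Roch in positive degree *)

Section PrincipalDivisors.
Variables (k : closedFieldType) (F : fieldType) (iota : {rmorphism k -> F}).
Hypotheses (ff : is_function_field iota) (genus1 : has_genus iota 1).
Variable P0 : place iota.
Implicit Types (P Q : place iota) (D Z : {freeg (place iota)}).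

Lemma maximal_uniq_seq (T : eqType) (A : T -> Prop) N :
  (forall s : seq T, uniq s -> (forall x, x \in s -> A x) -> (size s <= N)%N) ->
  exists s : seq T, forall x, A x -> x \in s.
Proof.
move=> AN.
pose B n := `[< exists s : seq T, [/\ uniq s, forall x, x \in s -> A x & size s = n] >].
have B0 : exists n, B n by exists 0%N; apply/asboolP; exists [::].
have BN n : B n -> (n <= N)%N by move/asboolP => [s [us sA <-]]; exact: AN.
case: (ex_maxnP B0 BN) => n /asboolP[s [us sA sn]] nmax.
exists s => x Ax; apply: contraT => xs.
suff /nmax : B n.+1 by rewrite ltnn.
apply/asboolP; exists (x :: s); split; rewrite /= ?xs ?us ?sn // => y.
by rewrite inE => /orP[/eqP->|/sA].
Qed.

(** Let D0' and Z' be the positive parts of D0 and Z, and s a set of zeros of u. Multiplication by u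
    embeds H^0(D0' + s) in H^0(D0' + Z'); the degree bounds h^0 from below on the left and from
    above on the right, so s has at most deg Z' elements. The poles of u lie in the support of
    Z'. *)
Lemma finite_zeros Z u : u != 0 -> sections Z setT u ->
  exists s : seq (place iota), forall P, P u != 0 -> P \in s.
Proof.
move=> u0 Zu.
have Z0 := fgpos_le0 Z.
have ZuP P : - mult P (fgpos Z) <= P u.
  rewrite -order_geE //; apply: order_geW ((sectionsP _ _ _).1 Zu P I).
  by rewrite lerN2; exact: (fgle_mult P (fgpos_ge Z)).
have [D0 D0P] := sections_large ff genus1.
have [|s sP] := @maximal_uniq_seq _ (fun P : place iota => 0 < P u) `|deg (fgpos Z)|%N.
  move=> s us sA; pose D := fgpos D0 + point_sum s.
  have [n [Dn [x [ix xD]]]] := sections_independent ff genus1 D.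
  have [|m mE Dm] := D0P (fgpos D0 + fgpos Z).
    exact: fgle_trans (fgpos_ge _) (fgle_add _ _).
  have xu i : sections (fgpos D0 + fgpos Z) setT (u * x i).
    apply/sectionsP => P _; have := (sectionsP _ _ _).1 (xD i) P I.
    rewrite /D !multD mult_point_sum // => xP.
    have [->|xi] := eqVneq (x i) 0; first by left; rewrite mulr0.
    right; rewrite placeM //; move: xP; rewrite order_geE //.
    have := ZuP P; have := fgle0_mult P Z0; case: (boolP (P \in s)) => [/sA|_] /=; lia.
  have ixu : independent iota (fun i => u * x i).
    move=> c E i; apply: (ix c) => //; apply: (mulfI u0); rewrite mulr0 mulr_sumr -[RHS]E.
    by apply: eq_bigr => j _; rewrite mulrCA.
  have nm := independent_size ixu xu Dm.
  have : deg (point_sum s) <= deg (fgpos Z) by move: Dn mE nm; rewrite !degD; lia.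
  by rewrite deg_point_sum -lez_nat => /le_trans; apply; exact: lez_abs.
exists (s ++ dom (fgpos Z)) => P Pu; rewrite mem_cat.
have [/sP -> //|] := ltP 0 (P u); move=> Pu0; apply/orP; right.
apply: contraT => /mult_outdom ZP; have := ZuP P; rewrite ZP; lia.
Qed.

Lemma nonconstant_section D : 2 <= deg D -> exists2 g, ~ constant iota g & sections D setT g.
Proof.
move=> D2; have [[|[|n]] [Dn [x [ix xD]]]] := sections_independent ff genus1 D; try lia.
have [c0|] := pselect (constant iota (x ord0)); last by exists (x ord0).
have [c1|] := pselect (constant iota (x (fintype.lift ord0 ord0))); last by exists (x (fintype.lift ord0 ord0)).
case: c0 c1 => [a aE] [b bE].
pose c (i : 'I_n.+2) : k := if i == ord0 then b else if i == fintype.lift ord0 ord0 then - a else 0.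
have c0 : forall i, c i = 0.
  apply: ix; rewrite !big_ord_recl big1 => [|i _]; last by rewrite /c /= rmorph0 mul0r.
  by rewrite /c /= aE bE addr0 rmorphN; ring.
have a0 : a = 0 by have := c0 (fintype.lift ord0 ord0); rewrite /c /= => /eqP; rewrite oppr_eq0 => /eqP.
suff /(_ ord0)/eqP : forall i : 'I_n.+2, (i == ord0)%:R = 0 :> k by rewrite eqxx oner_eq0.
apply: ix; rewrite (bigD1 ord0) //= aE a0 rmorph0 mulr0 add0r big1 // => i /negbTE->.
by rewrite rmorph0 mul0r.
Qed.

(** Choose g nonconstant with poles bounded by 2 P0. In an algebraic relation of f over k[g] the
    nonzero coefficients have finitely many zeros and poles; at every other place they have order 0,
    and so has f. *)
Lemma finite_support f : f != 0 ->
  exists s : seq (place iota), forall P, P f != 0 -> P \in s.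
Proof.
move=> f0.
have [g gc gZ] : exists2 g, ~ constant iota g & sections (<< P0 >> *+ 2) setT g.
  by apply: nonconstant_section; rewrite degMn degU.
have [p p0 pf] := algebraically_dependent g f ff.
have hZ (h : {poly k}) : exists Z, sections Z setT (evk iota g h).
  exists (<< P0 >> *+ 2 *+ size h); rewrite (evk_sum iota g (leqnn (size h))).
  apply: subspace_sum => [|i]; first exact: sections_subspace.
  apply: sections_le (sectionsX i gZ) => P _.
  by rewrite !multMn mult_point; case: eqP; have := ltn_ord i; lia.
have /choice[S SP] : forall i : nat, exists s : seq (place iota),
    p`_i != 0 -> forall P, P (evk iota g p`_i) != 0 -> P \in s.
  move=> i; have [Z hi] := hZ p`_i; have [pi0|pi] := eqVneq p`_i 0; first by exists [::].
  have [|s sP] := finite_zeros _ hi; last by exists s.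
  by apply: contra_neq pi; exact: evk_eq0.
exists (flatten (mkseq S (size p))) => P.
apply: contraR => nP; apply/eqP.
apply: (place_eq0_of_relation gc _ p0 pf) => i pi.
apply/eqP; apply: contraR nP => /(SP i pi) PS.
apply/flattenP; exists (S i) => //; apply/mapP; exists i => //.
rewrite mem_iota add0n leq0n /= ltnNge; apply: contraNN pi => /(nth_default 0) ->.
exact: eqxx.
Qed.

Lemma divisor_exists f : exists D, f != 0 -> forall P, mult P D = P f.
Proof.
have [->|f0] := eqVneq f 0; first by exists 0 => /eqP.
have [s sP] := finite_support f0.
exists (\sum_(P <- undup s) << P f *g P >>) => _ P.
rewrite /mult raddf_sum /=; have [/eqP Pf|Pf] := boolP (P f == 0).
  rewrite Pf big1 // => Q _; rewrite coeffU.
  by case: eqP => [->|_]; rewrite ?Pf ?mul0r ?mulr0.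
rewrite (bigD1_seq P) ?undup_uniq ?mem_undup ?sP //= coeffU eqxx mulr1 big1 ?addr0 // => Q QP.
by rewrite coeffU (negbTE QP) mulr0.
Qed.

Definition divisor f := sval (cid (divisor_exists f)).

Lemma mult_divisor f P : f != 0 -> mult P (divisor f) = P f.
Proof. by rewrite /divisor; case: cid => D /= DP /DP. Qed.

Lemma sections_mul f D g : f != 0 ->
  sections D setT g -> sections (D - divisor f) setT (f * g).
Proof.
move=> f0 /sectionsP Dg; apply/sectionsP => P _.
rewrite multB mult_divisor // opprB; apply: order_geM; last exact: Dg.
by right.
Qed.

(** Multiplication by g maps H^0(D) into H^0(D - div g); for D large this gives deg D <= deg D - deg
    (div g). The same for 1 / g gives equality. *)
Lemma deg_divisor f : f != 0 -> deg (divisor f) = 0.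
Proof.
suff le0 g : g != 0 -> deg (divisor g) <= 0.
  move=> f0; have := le0 _ f0; have := le0 f^-1; rewrite invr_eq0 => /(_ f0).
  have -> : divisor f^-1 = - divisor f.
    apply: mult_inj => P; rewrite multN !mult_divisor ?invr_eq0 //.
    exact: placeV.
  by rewrite degN; lia.
move=> g0; have [D0 D0P] := sections_large ff genus1.
pose D := D0 + fgpos (divisor g).
have [n [Dn [x [ix xD]]]] := sections_independent ff genus1 D.
have [|m mE Dm] := D0P (D - divisor g).
  apply: mult_fgle => P; have := fgle_mult P (fgpos_ge (divisor g)).
  by rewrite /D !multB !multD; lia.
have ixu : independent iota (fun i => g * x i).
  move=> c E i; apply: (ix c) => //; apply: (mulfI g0); rewrite mulr0 mulr_sumr -[RHS]E.
  by apply: eq_bigr => j _; rewrite mulrCA.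
have := independent_size ixu (fun i => sections_mul g0 (xD i)) Dm.
by move: mE; rewrite degB; lia.
Qed.

Lemma sections_deg_lt0 D f : deg D < 0 -> sections D setT f -> f = 0.
Proof.
move=> D0 /sectionsP Df; apply/eqP; apply: contraT => f0.
have : fgle 0 (D + divisor f).
  apply: mult_fgle0 => P; rewrite multD mult_divisor //.
  by have := Df P I; rewrite order_geE //; lia.
move=> Df0; suff : 0 <= deg (D + divisor f) by rewrite degD deg_divisor //; lia.
rewrite -(freeg_sumE (_ + _)) raddf_sum sumr_ge0 // => P _.
by rewrite /= degU; exact: (fgle0_mult P Df0).
Qed.

Lemma sections_neq0 D : 0 < deg D -> exists2 f, f != 0 & sections D setT f.
Proof.
move=> D0; have [[|n] [Dn [x [ix xD]]]] := sections_independent ff genus1 D; first by lia.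
exists (x ord0) => //; apply/eqP => x0.
suff /(_ ord0)/eqP : forall i : 'I_n.+1, (i == ord0)%:R = 0 :> k by rewrite eqxx oner_eq0.
apply: ix; rewrite (bigD1 ord0) //= x0 mulr0 add0r big1 // => i /negbTE->.
by rewrite rmorph0 mul0r.
Qed.

Lemma independent_powers z n : ~ constant iota z ->
  independent iota (fun i : 'I_n => z ^+ i).
Proof.
move=> zc c E i.
have h0 : \poly_(j < n) (if insub j is Some j' then c j' else 0) = 0.
  apply: (evk_eq0 zc); rewrite (evk_sum _ _ (size_poly _ _)) -[RHS]E.
  by apply: eq_bigr => j _; rewrite coef_poly ltn_ord valK.
by have /polyP/(_ i) := h0; rewrite coef_poly ltn_ord valK coef0.
Qed.

(* A divisor of degree 1 with two independent sections would give a nonconstant z with powers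
   1, z, .., z^n in a space of sections of degree n, hence of dimension n for n large. *)
Lemma spanned_deg1 D : deg D = 1 -> spanned_by iota (sections D setT) 1.
Proof.
move=> D1; have [f1 f10 Df1] : exists2 f, f != 0 & sections D setT f.
  by apply: sections_neq0; rewrite D1.
exists (fun=> f1) => f Df.
apply: contrapT => nf.
pose z := f / f1.
have zc : ~ constant iota z.
  by case=> c zE; apply: nf; exists (fun=> c); rewrite big_ord1 -zE divfK.
pose Z := D + divisor f1.
have Z1 : deg Z = 1 by rewrite degD deg_divisor // D1.
have Zz : sections Z setT z.
  apply/sectionsP => P _; rewrite multD mult_divisor // opprD.
  by apply: order_geM; [exact: ((sectionsP _ _ _).1 Df P I)|right; rewrite placeV].
have Z_1 : sections Z setT 1.
  apply/sectionsP => P _; rewrite multD mult_divisor //.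
  by have := (sectionsP _ _ _).1 Df1 P I; rewrite !order_geE ?oner_neq0 // place1; lia.
have [D0 D0P] := sections_large ff genus1.
pose n := (`|deg D0|.+1)%N.
have [u u0 uZ] : exists2 u, u != 0 & sections (Z *+ n - D0) setT u.
  by apply: sections_neq0; rewrite degB degMn Z1 /n; lia.
have [|m mE Dm] := D0P (Z *+ n + divisor u).
  apply: mult_fgle => P; have := (sectionsP _ _ _).1 uZ P I.
  by rewrite order_geE // multB multD mult_divisor //; lia.
have ix := @independent_powers z n.+1 zc.
have ixu : independent iota (fun i : 'I_n.+1 => u^-1 * z ^+ i).
  move=> c E i; apply: (ix c); apply: (mulfI (_ : u^-1 != 0)); first by rewrite invr_eq0.
  rewrite mulr0 mulr_sumr -[RHS]E.
  by apply: eq_bigr => j _; rewrite mulrCA.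
have xD (i : 'I_n.+1) : sections (Z *+ n + divisor u) setT (u^-1 * z ^+ i).
  have -> : divisor u = - divisor u^-1.
    apply: mult_inj => P; rewrite multN !mult_divisor ?invr_eq0 //.
    by rewrite placeV opprK.
  apply: sections_mul; first by rewrite invr_eq0.
  have -> : Z *+ n = Z *+ i + Z *+ (n - i) by rewrite -mulrnDr subnKC // -ltnS.
  rewrite -[z ^+ i]mulr1 -(expr1n _ (n - i)).
  by apply: sectionsM; exact: sectionsX.
have := independent_size ixu xD Dm.
by move: mE; rewrite degD degMn Z1 deg_divisor // /n; lia.
Qed.

(** Starting from a divisor of degree 1, where h^0 is at most 1, each of the remaining deg D - 1
    points adds at most 1. *)
Lemma sections_rank D : 1 <= deg D -> spanned_by iota (sections D setT) `|deg D|%N.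
Proof.
move=> D1; pose m := (`|deg D|.-1)%N.
have E : D = (D - << P0 >> *+ m) + << P0 >> *+ m by rewrite subrK.
rewrite [X in sections X _]E.
have [||n nE Dn] := @spanned_add _ _ _ ff (D - << P0 >> *+ m) (<< P0 >> *+ m) 1.
- apply: mult_fgle0 => P; by rewrite multMn mult_point; case: eqP.
- by apply: spanned_deg1; rewrite degB degMn degU /m; lia.
suff -> : `|deg D|%N = n by [].
by move: nE; rewrite degMn degU /m; lia.
Qed.

(** Otherwise H^0(D) would lie in H^0(D - P), although h^0(D) >= deg D and h^0(D - P) <= deg D - 1,
    a bound that is available because deg (D - P) >= 1. Most functions needed below are obtained in
    this way. *)
Lemma section_exact_order D P : 2 <= deg D ->
  exists v, [/\ v != 0, sections D setT v & P v = - mult P D].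
Proof.
move=> D2; apply: contrapT => /forallNP nv.
have sub : sections D setT `<=` sections (D - << P >>) setT.
  move=> f Df; apply/sectionsP => Q _; have := (sectionsP _ _ _).1 Df Q I.
  have [->|f0] := eqVneq f 0; first by left.
  rewrite !order_geE // multB.
  have [<-|QP] := eqVneq P Q; last by rewrite mult_point_neq // subr0.
  rewrite mult_point_eq.
  have : P f != - mult P D by apply/eqP => e; apply: (nv f).
  by lia.
have [n [Dn [x [ix xD]]]] := sections_independent ff genus1 D.
have := independent_size ix xD (spanned_byS sub (sections_rank _)).
by rewrite degB degU; lia.
Qed.

End PrincipalDivisors.

(** * Coordinate rings of affine parts of the curve *)

Section FunctionsOnCurve.
Variables (k : closedFieldType) (F : fieldType) (iota : {rmorphism k -> F}).
Hypotheses (ff : is_function_field iota) (genus1 : has_genus iota 1).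
Variable P0 : place iota.
Implicit Types (P Q : place iota) (D Z : {freeg (place iota)}).

Lemma mult_le_deg Z P : fgle 0 Z -> mult P Z <= deg Z.
Proof.
move=> Z0; elim/effective_ind: Z / Z0 => [|Z Q _ IH]; first by rewrite mult0 deg0.
by rewrite multD degD degU mult_point; case: eqP; lia.
Qed.

Lemma deg_ge0 Z : fgle 0 Z -> 0 <= deg Z.
Proof.
move=> Z0; elim/effective_ind: Z / Z0 => [|Z Q _ IH]; first by rewrite deg0.
by rewrite degD degU; lia.
Qed.

(* An arbitrary pole at Q provides the degree needed for the other conditions. *)
Lemma section_pole_at D Q P : P != Q ->
  exists b, [/\ b != 0, sections D [set~ Q] b & P b = - mult P D].
Proof.
move=> PQ; have [|b [b0 Db Pb]] := section_exact_order ff genus1 P0 (D := D + << Q >> *+ (`|deg D|.+2)%N) P.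
  by rewrite degD degMn degU; lia.
exists b; split=> //.
  apply/sectionsP => P' P'Q; have := (sectionsP _ _ _).1 Db P' I.
  by rewrite multD multMn mult_point_neq ?mul0r ?addr0 // eq_sym; apply/eqP.
by rewrite Pb multD multMn mult_point_neq ?mul0r ?addr0 // eq_sym.
Qed.

(** This is the vanishing of H^1(D - Z). Points are added to Z one at a time: at P the error is
    improved by one order with a multiple of a section of D - Z of exact order at P, which does not
    disturb the approximation at the other points. *)
Lemma approximation D Z u : fgle 0 Z -> 0 < deg (D - Z) ->
  (forall P, 0 < mult P Z -> order_ge P (- mult P D) u) ->
  exists2 w, sections D setT w &
    forall P, 0 < mult P Z -> order_ge P (mult P Z - mult P D) (u - w).
Proof.
move=> Z0; elim/effective_ind: Z / Z0 => [|Z P Z0 IH] dDZ uZ.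
  by exists 0 => [|P]; [left|rewrite mult0 ltxx].
have [||w Dw wu] := IH.
- by move: dDZ; rewrite !degB degD degU; lia.
- by move=> Q ZQ; apply: uZ; rewrite multD mult_point; case: eqP; lia.
have [|v [v0 DZv Pv]] := section_exact_order ff genus1 P0 (D := D - Z) P.
  by move: dDZ; rewrite !degB degD degU; lia.
have DwP Q := (sectionsP _ _ _).1 Dw Q I.
have rP : order_ge P (mult P Z - mult P D) (u - w).
  have := fgle0_mult P Z0; rewrite le_eqVlt => /orP[/eqP <-|/wu //].
  rewrite add0r; apply: order_geB => //; apply: uZ.
  by rewrite multD mult_point_eq; have := fgle0_mult P Z0; lia.
have [c cP] : exists c, order_ge P 1 ((u - w) / v - iota c).
  apply: (residue_exists ff).
  rewrite (_ : 0 = (mult P Z - mult P D) + (- (mult P Z - mult P D))); last by lia.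
  by apply: order_geM => //; right; rewrite placeV Pv multB; lia.
have DZvQ Q := (sectionsP _ _ _).1 DZv Q I.
exists (w + iota c * v).
  apply/sectionsP => Q _; apply: order_geD => //; apply: order_geZ.
  by apply: order_geW (DZvQ Q); rewrite multB; have := fgle0_mult Q Z0; lia.
move=> Q; rewrite !multD opprD addrA.
have [<-|QP] := eqVneq P Q.
  move=> _; rewrite mult_point_eq.
  have -> : u - w - iota c * v = ((u - w) / v - iota c) * v by rewrite mulrBl divfK.
  rewrite (_ : _ - _ = 1 + (mult P Z - mult P D)); last by lia.
  by apply: order_geM => //; right; rewrite Pv multB; lia.
rewrite mult_point_neq // addr0 => ZQ; apply: order_geB; first exact: wu.
by apply: order_geZ; apply: order_geW (DZvQ Q); rewrite multB; lia.
Qed.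

Lemma sections_basis D : exists n (B : 'I_n -> F),
  (forall i, sections D setT (B i)) /\ forall f, sections D setT f -> in_span iota B f.
Proof.
have [N DN] := sections_spanned ff genus1 D.
have [n [[B [DB Bf]] _]] := has_rank_exists (sections_subspace D setT) DN.
by exists n, B; split=> // f /Bf[c [fc _]]; exists c.
Qed.

Lemma no_pole_constant y : (forall P, order_ge P 0 y) -> constant iota y.
Proof.
move=> y0; have [c yc] := residue_exists ff (y0 P0).
exists c; apply/eqP; rewrite -subr_eq0; apply/eqP.
apply: (@sections_deg_lt0 _ _ _ ff genus1 P0 (- << P0 >>)); first by rewrite degN degU.
apply/sectionsP => P _; rewrite multN opprK mult_point.
by case: eqP => [<-//|_]; apply: order_geB => //; exact: order_geC.
Qed.

(** For y not constant, the coordinate ring of the curve without the poles of y; it is the integral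
    closure of k[y]. *)
Definition regular_where y : set F :=
  [set b | forall P, order_ge P 0 y -> order_ge P 0 b].

Lemma regular_where_subring y : is_subring (regular_where y).
Proof.
split=> [P _|a b ay bY P Py|a b ay bY P Py].
- by right; rewrite place1.
- by apply: order_geB; auto.
- by rewrite -[0]addr0; apply: order_geM; auto.
Qed.

Lemma evk_order_ge P y h : order_ge P 0 y -> order_ge P 0 (evk iota y h).
Proof.
move=> y0; rewrite (evk_sum _ _ (leqnn _)); apply: order_ge_sum => i _.
by apply: order_geZ; have := order_geX i y0; rewrite mul0rn.
Qed.

(** With D the polar divisor of y, the ring is the union of the H^0(nD), and H^0(2D) generates it
    over k[y]: for n >= 2 a section u of (n + 1)D is y w plus a section of nD, where w approximates
    u / y along D. The bound n >= 2 makes nD - D of positive degree. *)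
Lemma regular_where_finite y : ~ constant iota y ->
  exists m (w : 'I_m -> F), (forall i, regular_where y (w i)) /\
  forall b, regular_where y b ->
    exists h : 'I_m -> {poly k}, b = \sum_(i < m) evk iota y (h i) * w i.
Proof.
move=> yc; have y0 : y != 0 by apply: contra_not_neq yc => ->; exists 0; rewrite rmorph0.
pose D := fgpos (- divisor ff genus1 P0 y).
have DE P : mult P D = Num.max 0 (- P y) by rewrite mult_fgpos multN mult_divisor.
have D0 : fgle 0 D := fgpos_le0 _.
have dD : 1 <= deg D.
  rewrite leNgt; apply/negP => dD; apply: yc; apply: no_pole_constant => P.
  by have := mult_le_deg P D0; rewrite DE order_geE //; lia.
(* A pole of b is a pole of y, and its order is at most the degree of the polar divisor Z of b. *)
have inD b : regular_where y b -> exists n, sections (D *+ n) setT b.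
  move=> yb; have [->|b0] := eqVneq b 0; first by exists 0%N; left.
  pose Z := fgpos (- divisor ff genus1 P0 b); exists `|deg Z|%N.
  apply/sectionsP => P _; rewrite multMn order_geE //.
  have [yP|yP] := leP 0 (P y).
    have : order_ge P 0 b by apply: yb; right.
    rewrite order_geE // => bP; have := fgle0_mult P D0; nia.
  have := mult_le_deg P (fgpos_le0 _ : fgle 0 Z); rewrite mult_fgpos multN mult_divisor //.
  by have := DE P; nia.
have step n u : (2 <= n)%N -> sections (D *+ n.+1) setT u ->
    exists2 w, sections (D *+ n) setT w & sections (D *+ n) setT (u - y * w).
  move=> n2 Du; have DuP P := (sectionsP _ _ _).1 Du P I.
  have [|P|w Dw uw] := @approximation (D *+ n) D (u / y) D0.
  - by rewrite degB degMn; nia.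
  - rewrite DE => Py; have := DuP P; rewrite multMn DE => uP.
    rewrite (_ : - _ = - (Num.max 0 (- P y) * n.+1%:Z) + - P y); last by rewrite multMn DE; lia.
    by apply: order_geM => //; right; rewrite placeV.
  exists w => //; apply/sectionsP => P _; have DwP := (sectionsP _ _ _).1 Dw P I.
  have [Py|Py] := leP 0 (P y).
    have DP : mult P D = 0 by rewrite DE; lia.
    move: DwP (DuP P); rewrite !multMn DP !mul0r oppr0 => wP uP.
    by apply: order_geB => //; rewrite -[0]addr0; apply: order_geM => //; right.
  have -> : u - y * w = y * (u / y - w) by rewrite mulrBr mulrCA mulfV // mulr1.
  rewrite (_ : - _ = P y + (mult P D - mult P (D *+ n))).
    by apply: order_geM; [right|apply: uw; rewrite DE; lia].
  by rewrite DE multMn; lia.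
have [m [w [Dw wf]]] := sections_basis (D *+ 2).
exists m, w; split=> [i P yP|b /inD[n Db]].
  have := (sectionsP _ _ _).1 (Dw i) P I; rewrite multMn DE.
  case: yP => [yE|yP]; first by rewrite yE eqxx in y0.
  by rewrite (_ : - _ = 0) //; lia.
elim: n b Db => [|n IH] b Db.
  have [|c ->] := wf b.
    by apply: sections_le Db => P _; rewrite !multMn; have := fgle0_mult P D0; lia.
  by exists (fun i => (c i)%:P); apply: eq_bigr => i _; rewrite evkC.
have [n2|n2] := leqP 2 n.
  have [u Du bu] := step n b n2 Db.
  have [h1 h1E] := IH _ Du; have [h2 h2E] := IH _ bu.
  exists (fun i => h2 i + 'X * h1 i).
  rewrite -[LHS](subrK (y * u)) h2E h1E mulr_sumr -big_split /=; apply: eq_bigr => i _.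
  by rewrite rmorphD rmorphM /= evkX mulrDl mulrA.
have [|c ->] := wf b.
  apply: sections_le Db => P _; rewrite !multMn; have := fgle0_mult P D0; nia.
by exists (fun i => (c i)%:P); apply: eq_bigr => i _; rewrite evkC.
Qed.

(** Cayley-Hamilton for multiplication by b on the generators [w]. *)
Lemma regular_where_integral y b : ~ constant iota y -> regular_where y b ->
  exists2 p : {poly {poly k}}, p \is monic & (map_poly (evk iota y) p).[b] = 0.
Proof.
move=> yc yb; have [m [w [yw wf]]] := regular_where_finite yc.
have /choice[A AE] : forall i, exists h : 'I_m -> {poly k}, b * w i = \sum_(j < m) evk iota y (h j) * w j.
  by move=> i; apply: wf; case: (regular_where_subring y) => _ _; apply.
(* Transposed, because eigenvectors are rows: the row of the [w i] is an eigenvector for b. It is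
   not 0, since 1 is a combination of the [w i]. *)
pose M : 'M[{poly k}]_m := \matrix_(i, j) A j i.
exists (char_poly M); first exact: char_poly_monic.
apply/rootP; rewrite map_char_poly -eigenvalue_root_char; apply/eigenvalueP.
exists (\row_i w i).
  apply/rowP => i; rewrite !mxE AE; apply: eq_bigr => j _.
  by rewrite !mxE mulrC.
have [h hE] : exists h : 'I_m -> {poly k}, 1 = \sum_(i < m) evk iota y (h i) * w i.
  by apply: wf; case: (regular_where_subring y).
apply/eqP => /rowP w0; have /eqP := hE; rewrite big1 ?oner_eq0 // => i _.
by have := w0 i; rewrite !mxE => ->; rewrite mulr0.
Qed.

End FunctionsOnCurve.

(** * Powers with exponent q = p^e *)

Section FrobeniusPower.
Variables (p e : nat).
Local Notation q := (p ^ e)%N.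

Lemma expr_frobD (R : comNzRingType) (x y : R) : p \in [pchar R] ->
  (x + y) ^+ q = x ^+ q + y ^+ q.
Proof.
by move=> pR; apply: exprDn_pchar; rewrite pnatX (pnatE _ (pcharf_prime pR)) pR.
Qed.

Lemma expr_frob_sum (R : comNzRingType) (I : Type) (r : seq I) (Q : pred I) (f : I -> R) :
  p \in [pchar R] -> (\sum_(i <- r | Q i) f i) ^+ q = \sum_(i <- r | Q i) f i ^+ q.
Proof.
move=> pR; have q0 : (0 < q)%N by rewrite expn_gt0 prime_gt0 // (pcharf_prime pR).
elim/big_rec2: _ => [|i y x _ <-]; first by rewrite expr0n gtn_eqF.
by rewrite expr_frobD.
Qed.

Lemma expr_frobN (R : comNzRingType) (x : R) : p \in [pchar R] -> (- x) ^+ q = - x ^+ q.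
Proof.
move=> pR; apply/eqP; rewrite -addr_eq0 -expr_frobD // addNr expr0n.
by rewrite gtn_eqF // expn_gt0 prime_gt0 // (pcharf_prime pR).
Qed.

Lemma expr_frobB (R : comNzRingType) (x y : R) : p \in [pchar R] ->
  (x - y) ^+ q = x ^+ q - y ^+ q.
Proof. by move=> pR; rewrite expr_frobD // expr_frobN. Qed.

Lemma frob_root (k : closedFieldType) (c : k) : (0 < p)%N -> exists c', c' ^+ q = c.
Proof.
move=> p0; have q0 : (0 < q)%N by rewrite expn_gt0 p0.
have [x] := @solve_monicpoly k q (fun i => if i == 0%N then c else 0) q0.
rewrite -(prednK q0) big_ord_recl /= expr0 mulr1 big1 ?addr0; last first.
  by move=> i _; rewrite mul0r.
by exists x.
Qed.

End FrobeniusPower.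

(** * F as a vector space over its q-th powers *)

Section FrobeniusBasis.
Variables (k : closedFieldType) (F : fieldType) (iota : {rmorphism k -> F}).
Hypotheses (ff : is_function_field iota) (genus1 : has_genus iota 1).
Variable P0 : place iota.
Variables (p e : nat).
Hypothesis pF : p \in [pchar F].
Local Notation q := (p ^ e)%N.
Implicit Types (P : place iota).

Let p_gt0 : (0 < p)%N. Proof. exact: prime_gt0 (pcharf_prime pF). Qed.
Let q_gt0 : (0 < q)%N. Proof. by rewrite expn_gt0 p_gt0. Qed.

(* [F : F^q] <= q: the dimension of the space of the sums a_j^q x_j with a_j in L(D)
   would otherwise be (q + 1) deg D, in a space of sections of degree q deg D + O(1). *)
Lemma frobenius_dependent (x : 'I_q.+1 -> F) :
  exists2 a : 'I_q.+1 -> F, exists i, a i != 0 & \sum_i a i ^+ q * x i = 0.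
Proof.
pose C := \sum_i fgpos (- divisor ff genus1 P0 (x i)).
have CP i P : order_ge P (- mult P C) (x i).
  have [->|xi] := eqVneq (x i) 0; first exact: order_ge0.
  have multC : mult P C = \sum_j mult P (fgpos (- divisor ff genus1 P0 (x j))).
    by rewrite /C; elim/big_rec2: _ => [|j a b _ <-]; rewrite ?mult0 ?multD.
  rewrite order_geE // multC (bigD1 i) //= mult_fgpos multN mult_divisor //.
  have : 0 <= \sum_(j < q.+1 | j != i) mult P (fgpos (- divisor ff genus1 P0 (x j))).
    by apply: sumr_ge0 => j _; apply: fgle0_mult; exact: fgpos_le0.
  by move: (\sum_(j < q.+1 | j != i) _) => s; lia.
pose N := (`|deg C|.+1)%N.
have [n [nN [v [iv vD]]]] := sections_independent ff genus1 (<< P0 >> *+ N).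
have {}nN : (N <= n)%N by move: nN; rewrite degMn degU; lia.
pose T := << P0 >> *+ (N * q) + C.
have C0 : 0 <= deg C.
  by apply: deg_ge0; apply: mult_fgle0 => P; rewrite /C; elim/big_rec: _ => [|i D _ D0]; rewrite ?mult0 // multD addr_ge0 //; apply: fgle0_mult; exact: fgpos_le0.
have degT : deg T = (N * q)%:Z + deg C by rewrite degD degMn degU; lia.
have [|y Ty] := sections_rank ff genus1 P0 (D := T); first by rewrite degT; nia.
have [|[i l]|c [[i0 l0] c0] E] := @dependent_of_span_fin _ _ iota ('I_q.+1 * 'I_n)%type
    'I_(`|deg T|) (fun il => v il.2 ^+ q * x il.1) y.
- by rewrite card_prod !card_ord degT; nia.
- apply: Ty; apply/sectionsP => P _; rewrite /T multD opprD; apply: order_geM => //=.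
  by rewrite mulrnA multMn -mulNr; have := order_geX q ((sectionsP _ _ _).1 (vD l) P I); rewrite -mulr_natr natz.
have /choice[c' c'E] : forall il, exists c', c' ^+ q = c il by move=> il; exact: frob_root.
exists (fun i => \sum_l iota (c' (i, l)) * v l).
  exists i0; apply/eqP => /iv/(_ l0) c'0.
  by move: c0; rewrite -c'E c'0 expr0n gtn_eqF // eqxx.
rewrite -[RHS]E [RHS](_ : _ = \sum_i \sum_l iota (c (i, l)) * (v l ^+ q * x i)); last first.
  by rewrite pair_bigA; apply: eq_bigr => -[].
apply: eq_bigr => i _; rewrite expr_frob_sum // mulr_suml; apply: eq_bigr => l _.
by rewrite exprMn -rmorphXn c'E mulrA.
Qed.

Variables (P : place iota) (v : 'I_q -> F).
Hypothesis v0 : forall m, v m != 0.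
Hypothesis v_distinct : forall m m' (z : int), P (v m) - P (v m') = z * q%:Z -> m = m'.

Let term_distinct (c : 'I_q -> F) m m' : c m ^+ q * v m != 0 -> c m' ^+ q * v m' != 0 ->
  P (c m ^+ q * v m) = P (c m' ^+ q * v m') -> m = m'.
Proof.
rewrite !mulf_eq0 !negb_or !expf_eq0 q_gt0 /= => /andP[cm _] /andP[cm' _].
rewrite !placeM ?expf_neq0 // !placeX => E.
apply: (@v_distinct _ _ (P (c m') - P (c m))).
by move: E; rewrite -mulr_natr -[in RHS]mulr_natr !natz; lia.
Qed.

(** Multiplication by a q-th power moves the order by a multiple of q, so the nonzero terms keep
    distinct orders. *)
Lemma frobenius_independent (c : 'I_q -> F) : \sum_m c m ^+ q * v m = 0 -> forall m, c m = 0.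
Proof.
move=> E m; apply/eqP; apply: contraT => cm.
have [] := place_sum_distinct (@term_distinct c) (j := m).
  by rewrite mulf_neq0 ?expf_neq0.
by rewrite E eqxx.
Qed.

(** As [F : F^q] <= q, there is a dependence among f and the [v m], and f occurs in it because the
    [v m] are independent. The terms have distinct orders, so none of them has a smaller order than
    f. *)
Lemma frobenius_coordinates f : exists2 c : 'I_q -> F, f = \sum_m c m ^+ q * v m &
  forall m, c m != 0 -> f != 0 /\ P f <= P (c m) * q%:Z + P (v m).
Proof.
have [a [i0 ai0] E] := frobenius_dependent (oapp_lift f v).
move: E; rewrite big_ord_recl oapp_lift0.
under eq_bigr => i _ do rewrite oapp_liftS.
have [a0|a0 E] := eqVneq (a ord0) 0.
  rewrite a0 expr0n gtn_eqF // mul0r add0r => /frobenius_independent aE.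
  move: ai0; case: (unliftP ord0 i0) => [j ->|->]; last by rewrite a0 eqxx.
  by rewrite aE eqxx.
pose c (m : 'I_q) := - a (fintype.lift ord0 m) / a ord0.
have fE : f = \sum_m c m ^+ q * v m.
  apply: (mulfI (expf_neq0 q a0)); rewrite mulr_sumr.
  under eq_bigr => m _ do rewrite mulrA -exprMn mulrCA mulfV // mulr1 expr_frobN // mulNr.
  by rewrite sumrN; apply/eqP; rewrite -addr_eq0 E.
exists c => // m cm.
have [|s0] := place_sum_distinct (@term_distinct c) (j := m); first by rewrite mulf_neq0 ?expf_neq0.
by rewrite -fE in s0 *; rewrite placeM ?expf_neq0 // placeX -mulr_natr natz.
Qed.

End FrobeniusBasis.

(** * Local rings, domination and centres *)

Section LocalRings.
Variable K : fieldType.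
Implicit Types (A B O V N : set K) (x y : K).

Section Subring.
Variables (A : set K) (sA : is_subring A).

Lemma subring1 : A 1. Proof. by case: sA. Qed.

Lemma subringB x y : A x -> A y -> A (x - y). Proof. by case: sA => _ + _; exact. Qed.

Lemma subringM x y : A x -> A y -> A (x * y). Proof. by case: sA => _ _; exact. Qed.

Lemma subring0 : A 0. Proof. by rewrite -(subrr 1); apply: subringB; exact: subring1. Qed.

Lemma subringN x : A x -> A (- x).
Proof. by rewrite -sub0r; apply: subringB; exact: subring0. Qed.

Lemma subringD x y : A x -> A y -> A (x + y).
Proof. by move=> Ax Ay; rewrite -[y]opprK; apply: subringB => //; exact: subringN. Qed.

Lemma subringX x n : A x -> A (x ^+ n).
Proof.
move=> Ax; elim: n => [|n IH]; first exact: subring1.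
by rewrite exprS; exact: subringM.
Qed.

Lemma subring_sum (I : Type) (r : seq I) (Q : pred I) (f : I -> K) :
  (forall i, Q i -> A (f i)) -> A (\sum_(i <- r | Q i) f i).
Proof. by move=> Af; elim/big_ind: _ => //; [exact: subring0|exact: subringD]. Qed.

Lemma subring_prod (I : Type) (r : seq I) (Q : pred I) (f : I -> K) :
  (forall i, Q i -> A (f i)) -> A (\prod_(i <- r | Q i) f i).
Proof. by move=> Af; elim/big_ind: _ => //; [exact: subring1|exact: subringM]. Qed.

End Subring.

Definition local_ring O :=
  is_subring O /\ forall x y, nonunits O x -> nonunits O y -> nonunits O (x + y).

Lemma nonunitP O x : O x -> ~ nonunits O x <-> x != 0 /\ O x^-1.
Proof.
move=> Ox; split=> [nx|[x0 Vx] nx].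
  split; first by apply/eqP => x0; apply: nx; split=> //; left.
  by apply: contrapT => Vx; apply: nx; split=> //; right.
by case: nx => _ [x00|//]; rewrite x00 eqxx in x0.
Qed.

Lemma nonunitsM O x y : is_subring O -> O x -> nonunits O y -> nonunits O (x * y).
Proof.
move=> sO Ox [Oy ny]; split; first exact: subringM.
have [->|x0] := eqVneq x 0; first by left; rewrite mul0r.
case: ny => [->|ny]; first by left; rewrite mulr0.
right=> Vxy; apply: ny; have -> : y^-1 = x * (x * y)^-1 by rewrite invfM mulrA mulfV ?mul1r.
exact: subringM.
Qed.

Lemma nonunit1 O : is_subring O -> ~ nonunits O 1.
Proof. by move=> sO; apply/nonunitP; rewrite ?invr1 ?oner_neq0; move: (subring1 sO). Qed.

Definition centre V A : set K := [set x | A x /\ nonunits V x].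

Lemma centre_prime V A : local_ring V -> is_subring A -> A `<=` V -> is_prime A (centre V A).
Proof.
move=> [sV lV] sA AV; split.
- by split=> [x []//|]; split; [exact: subring0|split; [exact: subring0|left]].
- by move=> x y [Ax nx] [Ay ny]; split; [exact: subringD|exact: lV].
- by move=> a x Aa [Ax nx]; split; [exact: subringM|apply: nonunitsM => //; exact: AV].
- by case=> _; exact: nonunit1.
move=> x y Ax Ay [_ nxy]; apply: contrapT => /not_orP[nx ny].
have ux : ~ nonunits V x by move=> Hx; apply: nx.
have uy : ~ nonunits V y by move=> Hy; apply: ny.
have [x0 Vx] := (nonunitP (AV _ Ax)).1 ux; have [y0 Vy] := (nonunitP (AV _ Ay)).1 uy.
apply: (nonunitP (AV _ (subringM sA Ax Ay))).2 nxy.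
by rewrite mulf_neq0 // invfM; split=> //; exact: subringM.
Qed.

Lemma dominates_inv V O x : dominates V O -> O x -> x != 0 -> V x^-1 -> O x^-1.
Proof.
move=> [_ nVO] Ox x0 Vx; apply: contrapT => nx.
by case: (nVO x) => [|_ [/eqP|//]]; [split=> //; right|exact/negP].
Qed.

Lemma spec_local A O : is_subring A -> spec A O -> local_ring O.
Proof.
move=> sA [P [[PA P0] PD PM P1 PP] ->].
have nu x : nonunits (localization A P) x <-> exists a b, [/\ P a, A b, ~ P b & x = a / b].
  split=> [[[a [b [Aa Ab Pb ->]] n]]|[a [b [Pa Ab Pb ->]]]].
    exists a, b; split=> //; apply: contrapT => Pa; case: n.
      have a0 : a != 0 by apply: contra_not_neq Pa => ->.
      have b0 : b != 0 by apply: contra_not_neq Pb => ->.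
      by move/eqP; rewrite mulf_eq0 invr_eq0 (negbTE a0) (negbTE b0).
    by apply; exists b, a; rewrite invf_div.
  split; first by exists a, b; split=> //; exact: PA.
  have [->|a0] := eqVneq a 0; [by left; rewrite mul0r|right].
  have b0 : b != 0 by apply: contra_not_neq Pb => ->.
  rewrite invf_div => -[c [d [Ac Ad Pd E]]].
  have d0 : d != 0 by apply: contra_not_neq Pd => ->.
  have /(PP _ _ Ab Ad)[//|//] : P (b * d).
  have -> : b * d = c * a by apply/eqP; rewrite -(eqr_div _ _ a0 d0) E.
  exact: PM.
have P'M b d : A b -> A d -> ~ P b -> ~ P d -> ~ P (b * d) by move=> Ab Ad Pb Pd /(PP _ _ Ab Ad)[].
split; first split.
- by exists 1, 1; rewrite divr1; split=> //; exact: subring1.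
- move=> x y [a [b [Aa Ab Pb ->]]] [c [d [Ac Ad Pd ->]]].
  exists (a * d - c * b), (b * d); split; try by [apply: P'M|apply: subringM].
    by apply: subringB => //; apply: subringM.
  have b0 : b != 0 by apply: contra_not_neq Pb => ->.
  have d0 : d != 0 by apply: contra_not_neq Pd => ->.
  by field; rewrite b0 d0.
- move=> x y [a [b [Aa Ab Pb ->]]] [c [d [Ac Ad Pd ->]]].
  exists (a * c), (b * d); split; try by [apply: P'M|apply: subringM].
  by rewrite mulf_div.
move=> x y /nu[a [b [Pa Ab Pb ->]]] /nu[c [d [Pc Ad Pd ->]]]; apply/nu.
exists (a * d + c * b), (b * d); split; [|exact: subringM|exact: P'M|].
  by apply: PD; rewrite mulrC; apply: PM.
have b0 : b != 0 by apply: contra_not_neq Pb => ->.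
have d0 : d != 0 by apply: contra_not_neq Pd => ->.
by rewrite addf_div.
Qed.

Lemma spec_sub A O : is_subring A -> spec A O -> A `<=` O.
Proof.
move=> sA [P [_ _ _ P1 _] ->] a Aa.
by exists a, 1; rewrite divr1; split=> //; exact: subring1.
Qed.

Lemma spec_fraction A O x : is_subring A -> spec A O -> O x ->
  exists a b, [/\ A a, A b, b != 0, O b^-1 & x = a / b].
Proof.
move=> sA [P [[_ P0] _ _ P1 _] ->] [a [b [Aa Ab Pb ->]]].
exists a, b; split=> //; first by apply: contra_not_neq Pb => ->.
by exists 1, b; rewrite div1r; split=> //; exact: subring1.
Qed.

Lemma specI A O : is_subring A -> local_ring O -> A `<=` O ->
  (forall x, O x -> exists a b, [/\ A a, A b, b != 0, O b^-1 & x = a / b]) -> spec A O.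
Proof.
move=> sA lO AO frac; exists (centre O A); first exact: centre_prime.
apply/seteqP; split=> [x /frac[a [b [Aa Ab b0 Vb ->]]]|x [a [b [Aa Ab Pb ->]]]].
  exists a, b; split=> // -[_]; apply/nonunitP => //; exact: AO.
apply: subringM; [exact: lO.1|exact: AO|].
by apply: ((nonunitP (AO _ Ab)).1 _).2 => nb; apply: Pb.
Qed.

Lemma spec_centre A V : is_subring A -> local_ring V -> A `<=` V ->
  exists2 O, spec A O & dominates V O.
Proof.
move=> sA lV AV; have Pp := centre_prime lV sA AV.
exists (localization A (centre V A)); first by exists (centre V A).
have uV b : A b -> ~ centre V A b -> b != 0 /\ V b^-1.
  by move=> Ab Pb; apply/nonunitP; [exact: AV|move=> nb; apply: Pb].
have OV : localization A (centre V A) `<=` V.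
  move=> x [a [b [Aa Ab Pb ->]]]; apply: subringM; [exact: lV.1|exact: AV|].
  by have [] := uV b Ab Pb.
split=> // x [Ox nx]; split; first exact: OV.
case: Ox nx => a [b [Aa Ab Pb ->]]; have [b0 Vb] := uV b Ab Pb.
case=> [->|nx]; [by left|right=> Vx].
have a0 : a != 0.
  apply: contra_not_neq nx => ->; rewrite mul0r invr0.
  exists 0, 1; split=> //; [exact: subring0|exact: subring1|by case: Pp|by rewrite mul0r].
apply: nx; rewrite invf_div; exists b, a; split=> // -[_]; apply/nonunitP; first exact: AV.
split=> //; rewrite -(mulKf b0 a^-1); apply: subringM => //; first exact: lV.1.
by rewrite -invf_div.
Qed.

(** The denominators of elements of [O2] are units in V, hence units in [O1], which V dominates. *)
Lemma spec_dominated_le B V O1 O2 : is_subring B -> is_subring O1 ->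
  spec B O2 -> B `<=` O1 -> dominates V O1 -> O2 `<=` V -> O2 `<=` O1.
Proof.
move=> sB sO1 BO2 BO1 VO1 O2V x /(spec_fraction sB BO2)[a [b [Ba Bb b0 Ob ->]]].
apply: subringM => //; first exact: BO1.
by apply: dominates_inv VO1 _ b0 _; [exact: BO1|exact: O2V].
Qed.

Lemma dominates_trans O O' V : dominates V O' -> dominates O' O -> dominates V O.
Proof.
by move=> [a b] [c d]; split; [exact: subset_trans a|exact: subset_trans b].
Qed.

Lemma valuation_ring_local V : is_valuation_ring V -> local_ring V.
Proof.
move=> [sV vV]; split=> //.
have main x y : nonunits V x -> nonunits V y -> V (x / y) -> nonunits V (x + y).
  move=> nx [Vy ny] Vxy; have [y0|y0] := eqVneq y 0; first by rewrite y0 addr0.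
  rewrite -[x](divfK y0) -[in X in _ + X](mul1r y) -mulrDl.
  by apply: nonunitsM => //; apply: subringD => //; exact: subring1.
move=> x y nx ny; case: (vV (x / y)); first exact: main.
by rewrite invf_div addrC; exact: main.
Qed.

(** If 1 / x lies in V, an integral equation divided by the power of x one below its degree
    expresses x as a polynomial in 1 / x over V. *)
Lemma valuation_ring_integral V : is_valuation_ring V -> integral_closure V `<=` V.
Proof.
move=> [sV vV] x [p [pm Vp px]]; case: (vV x) => // Vx.
have [->|x0] := eqVneq x 0; first exact: subring0.
have [s1|] := leqP (size p) 1.
  move: px; rewrite (size1_polyC s1) /root hornerC => /eqP p0.
  by move: pm; rewrite (size1_polyC s1) p0 monicE lead_coefC eq_sym oner_eq0.
case E: (size p) => [|[|n]] // _.
have lc : p`_n.+1 = 1 by have /monicP := pm; rewrite lead_coefE E.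
move: px; rewrite /root horner_coef E big_ord_recr /= lc mul1r addrC addr_eq0 => /eqP px.
have -> : x = - \sum_(i < n.+1) p`_i * x^-1 ^+ (n - i).
  apply: (mulIf (expf_neq0 n x0)); rewrite -exprS px mulNr mulr_suml; congr (- _).
  apply: eq_bigr => i _; rewrite -mulrA; congr (_ * _).
  have -> : x ^+ n = x ^+ (n - i) * x ^+ i by rewrite -exprD subnK // leq_ord.
  by rewrite mulrA exprVn mulVf ?mul1r // expf_neq0.
by apply: subringN => //; apply: subring_sum => // i _; apply: subringM => //; exact: subringX.
Qed.

Lemma integral_closure_sub A : is_subring A -> A `<=` integral_closure A.
Proof.
move=> sA x Ax; exists ('X - x%:P); split; rewrite ?monicXsubC ?root_XsubC // => i.
rewrite coefB coefX coefC; apply: subringB => //.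
  by case: eqP => _; [exact: subring1|exact: subring0].
by case: eqP => _ //; exact: subring0.
Qed.

Lemma integral_closureS A B : A `<=` B -> integral_closure A `<=` integral_closure B.
Proof. by move=> AB x [p [pm Ap px]]; exists p; split=> // i; exact: AB. Qed.

Lemma spec_common_denominator A O n (x : nat -> K) : is_subring A -> spec A O ->
  (forall i, O (x i)) ->
  exists s, [/\ A s, s != 0, O s^-1 & forall i, (i < n)%N -> A (s * x i)].
Proof.
move=> sA AO Ox; have [sO _] := spec_local sA AO.
elim: n => [|n [s [As s0 Os sx]]].
  by exists 1; rewrite oner_neq0 invr1; split=> //; exact: subring1.
have [a [b [Aa Ab b0 Ob xE]]] := spec_fraction sA AO (Ox n).
exists (s * b); rewrite mulf_neq0 // invfM; split=> //; try exact: subringM.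
move=> i; rewrite ltnS leq_eqVlt => /orP[/eqP ->|/sx si].
  by rewrite xE (mulrC a) mulrA mulfK //; exact: subringM.
by rewrite mulrAC; exact: subringM.
Qed.

(** If s clears the denominators in an equation of x of degree n, multiplying its i-th coefficient
    by s^(n - i) gives an equation of s x over A. *)
Lemma integral_over_localization A O x : is_subring A -> spec A O -> integral_closure O x ->
  exists s, [/\ A s, s != 0, O s^-1 & integral_closure A (s * x)].
Proof.
move=> sA AO [p [pm Op px]].
have [s [As s0 Os sp]] := spec_common_denominator (size p) sA AO Op.
exists s; split=> //.
pose n := (size p).-1; have np : size p = n.+1.
  by rewrite /n prednK // lt0n size_poly_eq0 monic_neq0.
have lc : p`_n = 1 by have /monicP := pm; rewrite lead_coefE.
exists (\poly_(i < n.+1) (s ^+ (n - i) * p`_i)); split.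
- by rewrite monicE lead_coef_poly ?subnn ?expr0 ?mul1r ?lc ?oner_neq0.
- move=> i; rewrite coef_poly; case: ltnP => [|_]; last exact: subring0.
  rewrite ltnS leq_eqVlt => /orP[/eqP ->|lt]; first by rewrite subnn mul1r lc; exact: subring1.
  rewrite -(subnSK lt) exprSr -mulrA; apply: subringM => //; first exact: subringX.
  by apply: sp; rewrite np ltnW.
rewrite /root (horner_coef_wide _ (size_poly _ _)).
under eq_bigr => i _ do rewrite coef_poly ltn_ord exprMn mulrACA -exprD subnK ?leq_ord //.
rewrite -mulr_sumr -np -horner_coef.
by move/rootP: px => ->; rewrite mulr0.
Qed.

End LocalRings.

(** * The integral closure is a subring *)

Section IntegralClosure.
Variables (K : fieldType) (A : set K) (sA : is_subring A).

Definition mem_subring : {pred K} := fun x => `[< A x >].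

Fact mem_subring_closed : subring_closed mem_subring.
Proof.
split; first by apply/asboolP; exact: subring1.
  by move=> x y /asboolP Ax /asboolP Ay; apply/asboolP; exact: subringB.
by move=> x y /asboolP Ax /asboolP Ay; apply/asboolP; exact: subringM.
Qed.

HB.instance Definition _ := GRing.isSubringClosed.Build K mem_subring mem_subring_closed.

(** A as a ring type, which makes the closure properties of [integralOver] applicable. *)
Record subring_type := SubringType { subring_val : K; _ : subring_val \in mem_subring }.
HB.instance Definition _ := [isSub for subring_val].
HB.instance Definition _ := [Choice of subring_type by <:].
HB.instance Definition _ := [SubChoice_isSubComNzRing of subring_type by <:].

Lemma integral_closureE x : integral_closure A x <-> integralOver (val : subring_type -> K) x.
Proof.
split=> [[p [pm Ap px]]|[p pm px]].
  pose r : {poly subring_type} := \poly_(i < size p) insubd (0 : subring_type) p`_i.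
  have rp : map_poly val r = p.
    apply/polyP => i; rewrite coef_map coef_poly; case: ltnP => [_|/(nth_default 0)->//].
    by apply: insubdK; exact/asboolP.
  exists r; last by rewrite rp.
  by rewrite -rp in pm; move: pm; rewrite !monicE !lead_coefE size_map_inj_poly ?rmorph0 //; [rewrite coef_map -(rmorph1 (val : subring_type -> K)) (inj_eq val_inj)|exact: val_inj].
exists (map_poly val p); split=> // [|i].
  rewrite monicE lead_coefE size_map_inj_poly ?rmorph0 //; [|exact: val_inj].
  by rewrite coef_map -lead_coefE (monicP pm); apply/eqP; exact: rmorph1.
by rewrite coef_map; case: (p`_i) => a /= /asboolP.
Qed.

Lemma integral_closure_subring : is_subring (integral_closure A).
Proof.
split.
- exact: integral_closure_sub (subring1 sA).
- by move=> x y /integral_closureE Ix /integral_closureE Iy; apply/integral_closureE/integral_sub.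
- by move=> x y /integral_closureE Ix /integral_closureE Iy; apply/integral_closureE/integral_mul.
Qed.

End IntegralClosure.

(** * Chevalley's theorem: valuation rings dominating a local ring *)

Section Chevalley.
Variable K : fieldType.
Implicit Types (A B J N V : set K) (x : K).

(** Induction on the sum of the sizes. If r is not longer than p, of degree n, then r.[x^-1] = 1
    expresses (1 - r_0) x^n by lower powers of x. Multiplying p.[x] = 1 by 1 - r_0 and adding r_0
    therefore gives a relation without the leading term of p. *)
Lemma eliminate_inverse J x (p r : {poly K}) : J 0 ->
  (forall a b, J a -> J b -> J (a + b)) -> (forall a b, J a -> J b -> J (a - b)) ->
  (forall a b, J a -> J b -> J (a * b)) -> x != 0 ->
  (forall i, J p`_i) -> (forall i, J r`_i) -> p.[x] = 1 -> r.[x^-1] = 1 -> J 1.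
Proof.
move=> J0 JD JB JM; move: {2}(size p + size r)%N (leqnn (size p + size r)) => N.
elim: N x p r => [|N IH] x p r.
  rewrite leqn0 addn_eq0 size_poly_eq0 => /andP[/eqP -> _] _ _ _ /eqP.
  by rewrite horner0 eq_sym oner_eq0.
move=> sN x0 Jp Jr px rx.
wlog le : x p r x0 Jp Jr px rx sN / (size r <= size p)%N.
  move=> W; have [le|/ltnW le] := leqP (size r) (size p); first exact: (W x p r).
  by apply: (W x^-1 r p); rewrite ?invr_eq0 ?invrK // addnC.
case E: (size p) => [|n].
  by move/eqP: E px; rewrite size_poly_eq0 => /eqP ->; rewrite horner0 => /eqP; rewrite eq_sym oner_eq0.
have [n0|n0] := posnP n.
  have : (size p <= 1)%N by rewrite E n0.
  by move=> /size1_polyC pC; move: px; rewrite pC hornerC => <-.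
pose p2 := \poly_(i < n) ((if i == 0%N then r`_0 else 0) + (p`_i - r`_0 * p`_i) + p`_n * r`_(n - i)).
apply: (IH x p2 r) => //.
- by apply: leq_trans (leq_add (size_poly _ _) (leqnn _)) _; move: sN; rewrite E addSn ltnS.
- move=> i; rewrite coef_poly; case: ifP => // _.
  by apply: (JD); [apply: (JD); [case: ifP|apply: (JB) => //; exact: JM]|exact: JM].
rewrite (horner_coef_wide _ (size_poly _ _)).
under eq_bigr => i _ do rewrite coef_poly ltn_ord !mulrDl mulNr -!mulrA.
rewrite !big_split /= sumrN -!mulr_sumr.
have -> : \sum_(i < n) (if i == 0 :> nat then r`_0 else 0) * x ^+ i = r`_0.
  rewrite -(prednK n0) big_ord_recl /= expr0 mulr1 big1 ?addr0 // => i _.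
  by rewrite mul0r.
have px' : \sum_(i < n) p`_i * x ^+ i = 1 - p`_n * x ^+ n.
  by rewrite -px horner_coef E big_ord_recr /= addrK.
have rx' : \sum_(i < n) r`_(n - i) * x ^+ i = (1 - r`_0) * x ^+ n.
  have rn : (size r <= n.+1)%N by rewrite -E.
  rewrite -rx (horner_coef_wide _ rn) big_ord_recl expr0 mulr1 addrC addKr.
  rewrite mulr_suml (reindex_inj rev_ord_inj) /=; apply: eq_bigr => i _.
  rewrite -mulrA /bump /= add1n; have lt := ltn_ord i.
  rewrite (_ : n - (n - i.+1) = i.+1)%N; last by lia.
  have -> : x ^+ n = x ^+ i.+1 * x ^+ (n - i.+1) by rewrite -exprD subnKC.
  by rewrite exprVn mulKf // expf_neq0.
by rewrite px' rx'; ring.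
Qed.

Definition ideal_in B J :=
  [/\ J 0, forall a b, J a -> J b -> J (a + b) & forall a b, B a -> J b -> J (a * b)].

Definition ideal_span B N : set K :=
  [set x | forall J, ideal_in B J -> N `<=` J -> J x].

Lemma ideal_span_ideal B N : ideal_in B (ideal_span B N).
Proof.
split=> [J [] //|a b Ja Jb J iJ NJ|a b Ba Jb J iJ NJ].
  by case: (iJ) => _ + _; apply; [exact: Ja|exact: Jb].
by case: (iJ) => _ _; apply=> //; exact: Jb.
Qed.

Lemma ideal_span_sub B N : N `<=` ideal_span B N.
Proof. by move=> x Nx J _; apply. Qed.

Lemma ideal_spanS B C N : B `<=` C -> ideal_span B N `<=` ideal_span C N.
Proof.
move=> BC x Bx J [J0 JD JM]; apply: Bx; split=> // a b Ba; apply: JM; exact: BC.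
Qed.

(** Zorn's lemma for the subrings above A in which the maximal ideal of A does not generate the unit
    ideal. If a maximal one, V, contained neither x nor 1 / x, that ideal would become the unit
    ideal in V[x] and in V[1 / x]; eliminating x from the two relations shows that it already is in
    V. *)
Lemma chevalley A : local_ring A -> exists2 V, is_valuation_ring V & dominates V A.
Proof.
move=> [sA lA]; set N := nonunits A.
pose good B := [/\ is_subring B, A `<=` B & ~ ideal_span B N 1].
have goodA : good A.
  split=> // /(_ N) nA; apply: (nonunit1 sA); apply: nA => //.
  split=> //; first by split; [exact: subring0|left].
  by move=> a b Aa; exact: nonunitsM.
have [G GP total|V [VP Vmax]] := @Zorn_bigcup K [set B | B = set0 \/ good B].
  have [G0|] := pselect (\bigcup_(X in G) X = set0); [by left|move=> G0; right].
  pose H := [set X | G X /\ X <> set0].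
  have Hgood X : H X -> good X by move=> [GX nX]; case: (GP _ GX).
  have HE : \bigcup_(X in G) X = \bigcup_(X in H) X.
    apply/seteqP; split=> x [X GX Xx]; exists X => //; last by case: GX.
    by split=> // X0; rewrite X0 in Xx.
  have [X0 HX0] : exists X, H X.
    apply: contrapT => /forallNP nH; apply: G0; rewrite HE.
    by apply/seteqP; split=> x // [X /nH].
  have join X Y : H X -> H Y -> exists Z, [/\ H Z, X `<=` Z & Y `<=` Z].
    move=> HX HY; case: (total _ _ HX.1 HY.1) => le; [exists Y|exists X]; split=> //.
  suff : good (\bigcup_(X in H) X) by rewrite -HE.
  split.
  - split.
    + by exists X0 => //; case: (Hgood _ HX0) => sX _ _; exact: subring1.
    + move=> x y [X1 HX X1x] [Y1 HY Y1y]; have [Z [HZ XZ YZ]] := join _ _ HX HY.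
      by exists Z => //; case: (Hgood _ HZ) => sZ _ _; apply: subringB; [|exact: XZ|exact: YZ].
    + move=> x y [X1 HX X1x] [Y1 HY Y1y]; have [Z [HZ XZ YZ]] := join _ _ HX HY.
      by exists Z => //; case: (Hgood _ HZ) => sZ _ _; apply: subringM; [|exact: XZ|exact: YZ].
  - by move=> x Ax; exists X0 => //; case: (Hgood _ HX0) => _ + _; apply.
  - move=> /(_ (\bigcup_(X in H) ideal_span X N)) [].
    + split.
      * by exists X0 => //; case: (ideal_span_ideal X0 N).
      * move=> x y [X1 HX X1x] [Y1 HY Y1y]; have [Z [HZ XZ YZ]] := join _ _ HX HY.
        exists Z => //; case: (ideal_span_ideal Z N) => _ ZD _.
        by apply: ZD; [apply: ideal_spanS X1x|apply: ideal_spanS Y1y].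
      * move=> x y [X1 HX X1x] [Y1 HY Y1y]; have [Z [HZ XZ YZ]] := join _ _ HX HY.
        exists Z => //; case: (ideal_span_ideal Z N) => _ _ ZM.
        by apply: ZM; [exact: XZ|apply: ideal_spanS Y1y].
    + by move=> x Nx; exists X0 => //; exact: ideal_span_sub.
    + by move=> X /Hgood[].
have {}VP : good V.
  case: VP => // V0; case: (Vmax A) => /=; [|by right].
  by rewrite V0; split=> [x //|/(_ 1 (subring1 sA))].
have [sV AV V1] := VP.
pose J := ideal_span V N.
have [J0 JD JM] : ideal_in V J := ideal_span_ideal V N.
have JV : J `<=` V.
  move=> x; apply; first by split; [exact: subring0|exact: subringD|exact: subringM].
  by move=> a [Aa _]; exact: AV.
have JN a : J a -> J (- a) by move=> Ja; rewrite -mulN1r; apply: JM => //; apply: subringN => //; exact: subring1.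
have adjoin x : ~ V x -> exists2 p : {poly K}, forall i, J p`_i & p.[x] = 1.
  move=> Vx; pose W := [set z | exists2 p : {poly K}, forall i, V p`_i & p.[x] = z].
  have VW : V `<=` W.
    move=> v Vv; exists v%:P; rewrite ?hornerC // => i.
    by rewrite coefC; case: eqP => // _; exact: subring0.
  have Wx : W x.
    exists 'X; rewrite ?hornerX // => i; rewrite coefX.
    by case: eqP => _; [exact: subring1|exact: subring0].
  have sW : is_subring W.
    split.
    - exact: VW (subring1 sV).
    - move=> _ _ [p Vp <-] [r Vr <-]; exists (p - r); rewrite ?hornerD ?hornerN // => i.
      by rewrite coefB; exact: subringB.
    - move=> _ _ [p Vp <-] [r Vr <-]; exists (p * r); rewrite ?hornerM // => i.
      by rewrite coefM; apply: subring_sum => // j _; exact: subringM.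
  apply: contrapT => np; apply: (Vmax W).
    by split=> // /(_ _ Wx).
  right; split=> //; first exact: subset_trans VW.
  move=> /(_ [set z | exists2 p : {poly K}, forall i, J p`_i & p.[x] = z]) [].
  + split.
    * by exists 0 => [i|]; rewrite ?coef0 ?horner0.
    * move=> _ _ [p Vp <-] [r Vr <-]; exists (p + r); rewrite ?hornerD // => i.
      by rewrite coefD; exact: JD.
    * move=> _ _ [p Vp <-] [r Vr <-]; exists (p * r); rewrite ?hornerM // => i.
      by rewrite coefM; elim/big_ind: _ => // j _; apply: JM.
  + move=> a Na; exists a%:P; rewrite ?hornerC // => i.
    by rewrite coefC; case: eqP => // _; exact: ideal_span_sub.
  + by move=> p Jp px; apply: np; exists p.
exists V.
  split=> // x; apply: contrapT => /not_orP[/adjoin[p Jp px] Vx].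
  have [r Jr rx] := adjoin _ Vx.
  have x0 : x != 0 by apply: contra_not_neq Vx => ->; rewrite invr0; exact: subring0.
  apply: V1; apply: (eliminate_inverse J0 JD _ _ x0 Jp Jr px rx) => a b Ja Jb.
    by apply: JD => //; exact: JN.
  by apply: JM => //; exact: JV.
split=> // a Na; have [Aa _] := Na; split; first exact: AV.
have [->|a0] := eqVneq a 0; [by left|right=> Va].
by apply: V1; rewrite -/J -(mulVf a0); apply: JM => //; exact: ideal_span_sub.
Qed.

End Chevalley.

(** * Valuation rings of F that contain k *)

Section ValuationRingsOfCurve.
Variables (k : closedFieldType) (F : fieldType) (iota : {rmorphism k -> F}).
Hypotheses (ff : is_function_field iota) (genus1 : has_genus iota 1).
Variable P0 : place iota.
Implicit Types (P Q R : place iota) (D Z : {freeg (place iota)}) (W : set F).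

Lemma exists_notin (s : seq k) : exists c, c \notin s.
Proof.
(* The additional root 0 keeps the product nonconstant when s is empty. *)
pose p := \prod_(x <- 0 :: s) ('X - x%:P) + 1.
have sp : size p != 1%N.
  have sz : size (\prod_(x <- 0 :: s) ('X - x%:P)) = (size s).+2 by rewrite size_prod_XsubC.
  by rewrite /p size_polyDl sz // size_poly1.
have /closed_rootP[c pc] := sp; exists c; apply/negP => cs.
move: pc; rewrite /root hornerD hornerC horner_prod (big_rem c) /=; last by rewrite inE cs orbT.
by rewrite hornerXsubC subrr mul0r add0r oner_eq0.
Qed.

Lemma exact_order P n x : order_ge P n x -> ~ order_ge P (n + 1) x -> x != 0 /\ P x = n.
Proof.
have [->|x0] := eqVneq x 0; first by move=> _ []; left.
by rewrite !order_geE //; split=> //; lia.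
Qed.

Lemma exact_order_combination P n x y : order_ge P n x -> order_ge P n y ->
  ~ order_ge P (n + 1) x \/ ~ order_ge P (n + 1) y ->
  exists b, forall c, c != b -> ~ order_ge P (n + 1) (x + iota c * y).
Proof.
move=> xn yn xy; have [[b bad]|/forallNP nb] := pselect (exists b, order_ge P (n + 1) (x + iota b * y)).
  exists b => c cb bad'.
  have yn1 : order_ge P (n + 1) y.
    have := order_geZ (c - b)^-1 (order_geB bad' bad).
    rewrite opprD addrACA subrr add0r -mulrBl -rmorphB mulrA -rmorphM mulVf ?subr_eq0 //.
    by rewrite rmorph1 mul1r.
  case: xy => // nx; apply: nx; rewrite -[x](addrK (iota b * y)).
  by apply: order_geB => //; exact: order_geZ.
by exists 0 => c _; exact: nb.
Qed.

(** A section of exact order at one more place is added with a coefficient avoiding finitely many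
    bad values, one for each place; k is infinite. *)
Lemma generic_section D (s : seq (place iota)) : 2 <= deg D ->
  exists f, [/\ f != 0, sections D setT f & forall P, P \in s -> P f = - mult P D].
Proof.
(* [P0] is included so that f is nonzero even when s is empty. *)
move=> D2; suff [f Df fs] : exists2 f, sections D setT f &
    forall P, P \in P0 :: s -> ~ order_ge P (- mult P D + 1) f.
  have fE P : P \in P0 :: s -> f != 0 /\ P f = - mult P D.
    by move=> Ps; apply: exact_order (fs P Ps); exact: (sectionsP _ _ _).1 Df P I.
  exists f; split=> //; first by case: (fE P0); rewrite ?inE ?eqxx.
  by move=> P Ps; case: (fE P); rewrite ?inE ?Ps ?orbT.
elim: (P0 :: s) => [|P r [f Df fr]]; first by exists 0; [left|].
have [v [v0 Dv Pv]] := section_exact_order ff genus1 P0 P D2.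
have DfP Q := (sectionsP _ _ _).1 Df Q I; have DvP Q := (sectionsP _ _ _).1 Dv Q I.
have nvP : ~ order_ge P (- mult P D + 1) v by rewrite order_geE // Pv; lia.
have /choice[b bP] : forall Q, exists b, Q \in P :: r -> forall c, c != b ->
    ~ order_ge Q (- mult Q D + 1) (f + iota c * v).
  move=> Q; have [Qr|_] := boolP (Q \in P :: r); last by exists 0.
  have [|b bQ] := exact_order_combination (DfP Q) (DvP Q); last by exists b.
  by move: Qr; rewrite inE => /orP[/eqP ->|/fr]; [right|left].
have [c cb] := exists_notin (map b (P :: r)).
exists (f + iota c * v).
  by apply/sectionsP => Q _; apply: order_geD => //; exact: order_geZ.
move=> Q Qr; apply: bP => //; apply: contraNneq cb => ->; exact: map_f.
Qed.

Lemma nonconstant_zero y : ~ constant iota y -> exists P, 0 < P y.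
Proof.
move=> yc; apply: contrapT => /forallNP nP.
have y0 : y != 0 by apply: contra_not_neq yc => ->; exists 0; rewrite rmorph0.
have [c yE] : constant iota y^-1.
  by apply: (no_pole_constant ff genus1 P0) => P; right; rewrite placeV; have := nP P; lia.
by apply: yc; exists c^-1; rewrite fmorphV -yE invrK.
Qed.

(** A function with double poles at all places of a nonempty list is not constant, so it has a zero,
    which is not in the list. *)
Lemma exists_place_notin (s : seq (place iota)) : exists P, P \notin s.
Proof.
pose r := undup (P0 :: s).
have P0r : P0 \in r by rewrite mem_undup inE eqxx.
have [|y [y0 _ ys]] := @generic_section (point_sum r *+ 2) r.
  by rewrite degMn deg_point_sum; case: r P0r => //= a r' _; lia.
have yP P : P \in r -> P y = - 2%:Z.
  by move=> Pr; rewrite ys // multMn mult_point_sum ?undup_uniq // Pr.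
have [|P Py] := @nonconstant_zero y.
  by case=> c yE; have := yP _ P0r; rewrite yE placeC.
exists P; apply/negP => Ps; have := yP P; rewrite mem_undup inE Ps orbT => /(_ isT).
by lia.
Qed.

Lemma subring_evk W y h : is_subring W -> (forall c, W (iota c)) -> W y -> W (evk iota y h).
Proof.
move=> sW Wk Wy; rewrite (evk_sum _ _ (leqnn _)); apply: subring_sum => // i _.
by apply: subringM => //; exact: subringX.
Qed.

Section ValuationRing.
Variable W : set F.
Hypotheses (vW : is_valuation_ring W) (Wk : forall c, W (iota c)).

(** A polynomial h(z) cancels the poles of b at the places where z is regular; then h(z) b is
    integral over k[z] and lies in W. As b has no pole at a zero of z, h can be taken with h(0)
    nonzero, and h(z), congruent to h(0) modulo the nonunit z, is a unit of W. *)
Lemma valuation_semilocal z b : W z -> ~ W z^-1 ->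
  (forall P, 0 < P z -> order_ge P 0 b) -> W b.
Proof.
move=> Wz Wz' zb; have lW := valuation_ring_local vW; have sW := lW.1.
have zc : ~ constant iota z by case=> c zE; apply: Wz'; rewrite zE -fmorphV.
have [->|b0] := eqVneq b 0; first exact: subring0.
have [s sP] := finite_support ff genus1 P0 b0.
have /choice[c cP] : forall P, exists c, order_ge P 0 z -> order_ge P 1 (z - iota c).
  move=> P; have [/(residue_exists ff)[c cP]|n] := pselect (order_ge P 0 z); first by exists c.
  by exists 0.
have z0 : z != 0 by apply: contra_not_neq zc => ->; exists 0; rewrite rmorph0.
pose s' := [seq P : place iota <- s | (P b < 0) && (0 <= P z)].
pose h := \prod_(P <- s') ('X - (c P)%:P) ^+ `|P b|%N.
have h0 : h.[0] != 0.
  rewrite horner_prod prodf_seq_neq0; apply/allP => P; rewrite mem_filter => /andP[/andP[Pb Pz] _] /=.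
  rewrite horner_exp hornerXsubC sub0r expf_neq0 // oppr_eq0; apply/eqP => cP0.
  have := cP P (or_intror Pz); rewrite cP0 rmorph0 subr0 order_geE // => Pz1.
  by have := zb P; rewrite order_geE //; lia.
have hb : regular_where iota z (evk iota z h * b).
  move=> P zP; have [Pb|Pb] := leP 0 (P b).
    by rewrite -[0]addr0; apply: order_geM; [exact: evk_order_ge|right].
  have Ps : P \in s'.
    rewrite mem_filter Pb sP ?andbT; last by lia.
    by move: zP; rewrite order_geE.
  rewrite /h (big_rem P Ps) rmorphM rmorphXn rmorphB /= evkX evkC mulrAC.
  rewrite (_ : 0 = `|P b|%:Z + P b + 0); last by lia.
  apply: order_geM; last exact: evk_order_ge.
  apply: order_geM; last by right.
  by have := order_geX `|P b|%N (cP P zP); rewrite -mulr_natr mul1r natz.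
have Wh := @subring_evk W z h sW Wk Wz.
have Wu : W (evk iota z h * b).
  apply: valuation_ring_integral => //.
  have [p pm pb] := regular_where_integral ff genus1 P0 zc hb.
  exists (map_poly (evk iota z) p); split; first exact: monic_map.
    by move=> i; rewrite coef_map; exact: subring_evk.
  exact/rootP.
have nz : nonunits W z by split=> //; right.
have [u0 Wu'] : evk iota z h != 0 /\ W (evk iota z h)^-1.
  apply/nonunitP => // nh.
  have [g gE] : exists g, h - h.[0]%:P = g * ('X - 0%:P).
    by apply/factor_theorem; rewrite /root hornerD hornerN hornerC subrr.
  have : nonunits W (iota h.[0]).
    have -> : iota h.[0] = evk iota z h + - evk iota z g * z.
      rewrite -[h in evk iota z h](subrK h.[0]%:P) gE rmorphD rmorphM rmorphB /= !evkC evkX.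
      by rewrite rmorph0 subr0 mulNr addrAC subrr add0r.
    apply: lW.2 => //; apply: nonunitsM => //; apply: subringN => //; exact: subring_evk.
  by apply/nonunitP; rewrite // -fmorphV fmorph_eq0.
by rewrite -(mulKf u0 b); apply: subringM.
Qed.

(** Suppose that W, different from F, contains the local ring of no place, and let z be a nonzero
    nonunit of W. A function a with no pole outside P lies in W: otherwise 1 / a is a nonunit with
    no zero outside P, and [valuation_semilocal] puts the local ring of P into W. Such functions,
    one for each zero of z, then produce 1 / z in W. *)
Lemma valuation_contains_place : exists P, [set b | order_ge P 0 b] `<=` W.
Proof.
have lW := valuation_ring_local vW; have sW := lW.1.
have [WT|] := pselect (forall x, W x); first by exists P0 => x _; exact: WT.
move=> /existsNP[x Wx]; apply: contrapT => /forallNP nP.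
have Wz : W x^-1 by case: vW => _ /(_ x)[].
set z := x^-1 in Wz; have Wz' : ~ W z^-1 by rewrite invrK.
have z0 : z != 0 by apply: contra_not_neq Wz' => ->; rewrite invr0; exact: subring0.
have [s sP] := finite_support ff genus1 P0 z0.
pose r := undup [seq P : place iota <- s | 0 < P z].
have rP P : P \in r = (0 < P z).
  by rewrite mem_undup mem_filter andb_idr // => Pz; apply: sP; lia.
have AW P a : (forall Q, Q != P -> order_ge Q 0 a) -> W a.
  move=> aP; apply: contrapT => Wa; apply: (nP P) => b Pb.
  have Wa' : W a^-1 by case: vW => _ /(_ a)[].
  apply: (valuation_semilocal Wa'); first by rewrite invrK.
  move=> Q; rewrite placeV => Qa; have [-> //|QP] := eqVneq Q P.
  by have := aP _ QP => -[a0|]; [rewrite a0 place0 in Qa|]; lia.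
(* The factor 2 gives the divisor a degree of at least 2, as [generic_section] requires. *)
have /choice[a aP] : forall P, exists a, 0 < P z -> [/\ a != 0,
    forall Q, Q != P -> order_ge Q 0 a & forall Q, 0 < Q z -> Q a = if Q == P then - (2 * P z) else 0].
  move=> P; have [Pz|] := ltP 0 (P z); last by exists 0; lia.
  have [|f [f0 Df fr]] := @generic_section (<< P >> *+ (2 * `|P z|)%N) r.
    by rewrite degMn degU; lia.
  exists f => _; split=> // Q; first by move=> QP; have := (sectionsP _ _ _).1 Df Q I; rewrite multMn mult_point_neq ?mul0r // eq_sym.
  move=> Qz; rewrite fr ?rP // multMn mult_point eq_sym.
  by case: eqP => _; lia.
(* c has order 0 at every zero of z, so 1 / c lies in W, and 1 / z is the product of z, 1 / c and
   the [a P]. *)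
pose c := z ^+ 2 * \prod_(P <- r) a P.
have c0 : c != 0.
  rewrite mulf_neq0 ?expf_neq0 // prodf_seq_neq0; apply/allP => P; rewrite rP => /aP[] //.
have Pprod Q (l : seq (place iota)) : uniq l -> (forall P, P \in l -> 0 < P z) -> 0 < Q z ->
    \prod_(P <- l) a P != 0 /\ Q (\prod_(P <- l) a P) = if Q \in l then - (2 * Q z) else 0.
  move=> + + Qz; elim: l => [|P l IH]; first by rewrite big_nil oner_neq0 place1.
  move=> /andP[Pl ul] lz; rewrite big_cons.
  have [|p0 pE] := IH ul; first by move=> R Rl; apply: lz; rewrite inE Rl orbT.
  have [a0 _ aQ] := aP P (lz P (mem_head _ _)).
  rewrite mulf_neq0 // placeM // pE aQ // inE; split=> //.
  by have [->|_] /= := eqVneq Q P; rewrite ?(negbTE Pl) ?addr0 ?add0r.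
have cz Q : 0 < Q z -> Q c = 0.
  move=> Qz; have [|p0 pE] := Pprod Q r (undup_uniq _) _ Qz; first by move=> P; rewrite rP.
  by rewrite /c placeM ?expf_neq0 // placeX pE rP Qz -mulr_natr natz; lia.
apply: (Wz'); have -> : z^-1 = z * (c^-1 * \prod_(P <- r) a P).
  move: c0; rewrite /c mulf_eq0 negb_or => /andP[_ y0].
  by rewrite [in RHS]invfM -mulrA mulVf // mulr1 expr2 invfM mulrA mulfV ?mul1r.
apply: subringM => //; apply: subringM => //.
  by apply: (valuation_semilocal Wz Wz') => Q /cz Qc; right; rewrite placeV Qc.
rewrite big_seq; apply: subring_prod => // P; rewrite rP => /aP[_ aP' _].
exact: AW aP'.
Qed.

(** Write x = (x b) / b, where b has a zero at P that compensates a pole of x there, and a pole at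
    Q. *)
Lemma valuation_place_unique P Q x : [set b | order_ge P 0 b] `<=` W ->
  [set b | order_ge Q 0 b] `<=` W -> P != Q -> W x.
Proof.
move=> PW QW PQ; have [sW _] := vW.
have [->|x0] := eqVneq x 0; first exact: subring0.
pose n := `|P x|%N.
(* The pole at Q has order n + 2 so that the divisor has degree 2. *)
have [|b [b0 Db bs]] := @generic_section (<< Q >> *+ n.+2 - << P >> *+ n) [:: P; Q].
  by rewrite degB !degMn !degU; lia.
have bP : P b = n by rewrite bs ?inE ?eqxx // multB !multMn mult_point_eq mult_point_neq 1?eq_sym //; lia.
have bQ : Q b = - n.+2%:Z by rewrite bs ?inE ?eqxx ?orbT // multB !multMn mult_point_eq mult_point_neq //; lia.
rewrite -(mulfK b0 x); apply: subringM => //.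
  by apply: PW; right; rewrite placeM // bP; lia.
by apply: QW; right; rewrite placeV bQ; lia.
Qed.

End ValuationRing.
End ValuationRingsOfCurve.

(** * Elements of a fraction field as quotients *)

Section Fractions.
Local Open Scope quotient_scope.

Lemma fraction_exists (R : idomainType) (x : {fraction R}) :
  exists a b, b != 0 /\ x = FracField.tofrac a / FracField.tofrac b.
Proof.
elim/quotW: x => x; exists \n_x, \d_x; split; first exact: denom_ratioP.
apply: (mulIf (x := (FracField.tofrac \d_x))); first by rewrite tofrac_eq0 denom_ratioP.
rewrite divfK ?tofrac_eq0 ?denom_ratioP //.
rewrite [X in X = _]/(_ * _) /= !piE /FracField.mulf; apply/eqmodP => /=.
by rewrite FracField.equivfE !numden_Ratio ?mulr1 ?oner_neq0 ?denom_ratioP // mulrC.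
Qed.

End Fractions.

(** * The graded ring of sections and the minimal resolution *)

Lemma fraction_expand (K : fieldType) (s u a b : K) : s != 0 -> u != 0 ->
  a / b = u * (s * a) / (s * (u * b)).
Proof. by move=> s0 u0; rewrite [u * _]mulrCA -mulf_div divff // mul1r -mulf_div divff // mul1r. Qed.

(* The field [K] stands for F(t) = [Kt F], and [tf] for the inclusion of F[t]. *)
Section SectionRings.
Variables (k : closedFieldType) (F : fieldType) (iota : {rmorphism k -> F}).
Variables (K : fieldType) (tf : {rmorphism {poly F} -> K}).
Hypothesis tf_inj : injective tf.
Hypothesis tf_fraction : forall x : K, exists a b, b != 0 /\ x = tf a / tf b.
Variable L : {freeg (place iota)}.
Implicit Types (P Q : place iota) (U : set (place iota)) (f g : F) (q r : {poly F}).
Implicit Types (O V : set K) (x z : K).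

Lemma tf_eq0 q : (tf q == 0) = (q == 0).
Proof. by rewrite -(inj_eq tf_inj) rmorph0. Qed.

Lemma reduced_fraction_exists x : exists a b, [/\ b != 0, coprimep a b & x = tf a / tf b].
Proof.
have [a [b [b0 ->]]] := tf_fraction x; pose g := gcdp a b.
have g0 : g != 0 by rewrite gcdp_eq0 negb_and b0 orbT.
have aE : a = a %/ g * g by rewrite divpK // dvdp_gcdl.
have bE : b = b %/ g * g by rewrite divpK // dvdp_gcdr.
have b'0 : b %/ g != 0 by apply: contraNneq b0 => b'0; rewrite bE b'0 mul0r.
exists (a %/ g), (b %/ g); split=> //; first by apply: coprimep_div_gcd; rewrite b0 orbT.
by rewrite {1}aE {1}bE !rmorphM -mulf_div divff ?mulr1 // tf_eq0.
Qed.

(** [section_ring], with F(t) replaced by the abstract field K. *)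
Definition ring_of_sections U : set K :=
  [set z | exists2 q : {poly F}, forall n, sections (L *+ n) U q`_n & z = tf q].

Lemma ring_of_sectionsP U q : ring_of_sections U (tf q) <-> forall n, sections (L *+ n) U q`_n.
Proof.
split=> [[r Ur /eqP]|Uq]; last by exists q.
by rewrite (inj_eq tf_inj) => /eqP ->.
Qed.

Lemma ring_of_sections_subring U : is_subring (ring_of_sections U).
Proof.
split.
- rewrite -(rmorph1 tf); apply/ring_of_sectionsP => n; rewrite coef1; case: n => [|n]; last by left.
  exact: sections1.
- move=> _ _ [q Uq ->] [r Ur ->]; rewrite -(rmorphB tf); apply/ring_of_sectionsP => n; rewrite coefB.
  by apply/sectionsP => P UP; apply: order_geB; apply: (sectionsP _ _ _).1 UP.
- move=> _ _ [q Uq ->] [r Ur ->]; rewrite -(rmorphM tf); apply/ring_of_sectionsP => n; rewrite coefM.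
  have [U0 UD _] := sections_subspace (L *+ n) U.
  elim/big_ind: _ => // i _; rewrite -[in L *+ n](subnKC (leq_ord i)) mulrnDr.
  exact: sectionsM.
Qed.

Lemma ring_of_sectionsS U (V : set (place iota)) : V `<=` U -> ring_of_sections U `<=` ring_of_sections V.
Proof. by move=> VU _ [q Uq ->]; apply/ring_of_sectionsP => n; exact: sections_sub (Uq n). Qed.

Definition term f n : K := tf (f *: 'X^n).

Lemma ring_of_sections_term U f n : ring_of_sections U (term f n) <-> sections (L *+ n) U f.
Proof.
split=> [/ring_of_sectionsP/(_ n)|Uf]; first by rewrite coefZ coefXn eqxx mulr1.
apply/ring_of_sectionsP => m; rewrite coefZ coefXn; case: eqP => [->|_]; first by rewrite mulr1.
by rewrite mulr0; left.
Qed.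

Lemma termM f g n m : term f n * term g m = term (f * g) (n + m)%N.
Proof. by rewrite /term -(rmorphM tf) -scalerAl -scalerAr scalerA exprD. Qed.

Lemma termD f g n : term (f + g) n = term f n + term g n.
Proof. by rewrite /term -(rmorphD tf) -scalerDl. Qed.

Lemma term_eq0 f n : (term f n == 0) = (f == 0).
Proof. by rewrite tf_eq0 scaler_eq0 -size_poly_eq0 size_polyXn orbF. Qed.

Lemma term10 : term 1 0 = 1. Proof. by rewrite /term scale1r rmorph1. Qed.

Lemma term0 n : term 0 n = 0. Proof. by rewrite /term scale0r rmorph0. Qed.

Lemma termV f : term f^-1 0 = (term f 0)^-1.
Proof.
have [->|f0] := eqVneq f 0; first by rewrite invr0 term0 invr0.
by apply: (mulIf (_ : term f 0 != 0)); rewrite ?term_eq0 // mulVf ?term_eq0 // termM mulVf // term10.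
Qed.

Lemma termN f n : term (- f) n = - term f n.
Proof. by rewrite /term scaleNr rmorphN. Qed.

Lemma tf_sum_terms q : tf q = \sum_(i < size q) term q`_i i.
Proof. by rewrite -[in LHS](coefK q) poly_def rmorph_sum. Qed.

Lemma sections0E U f : sections (0 : {freeg (place iota)}) U f <-> forall P, U P -> order_ge P 0 f.
Proof. by rewrite sectionsP; split=> H P /H; rewrite mult0 oppr0. Qed.

Lemma ring_of_sections_function U f : ring_of_sections U (term f 0) <-> forall P, U P -> order_ge P 0 f.
Proof. by rewrite ring_of_sections_term mulr0n sections0E. Qed.

Lemma ring_of_sectionsC U c : ring_of_sections U (term (iota c) 0).
Proof. by apply/ring_of_sections_function => P _; exact: order_geC. Qed.

Section Gauss.
Variable P : place iota.

(** The Gauss valuation on F[t] that extends P and gives t the order [mult P L]; the ring of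
    sections at P is the part of F[t] where it is nonnegative. *)
Definition gauss_ge (n : int) q := forall i, order_ge P (n - mult P L * i%:Z) q`_i.

Lemma ring_of_sections_gauss q : ring_of_sections [set P] (tf q) <-> gauss_ge 0 q.
Proof.
rewrite ring_of_sectionsP; split=> H i.
  by have := (sectionsP _ _ _).1 (H i) P erefl; rewrite multMn sub0r.
by apply/sectionsP => _ ->; have := H i; rewrite multMn sub0r.
Qed.

Lemma gauss_geW n m q : n <= m -> gauss_ge m q -> gauss_ge n q.
Proof. by move=> nm mq i; apply: order_geW (mq i); lia. Qed.

Lemma gauss_geN n q : gauss_ge n q -> gauss_ge n (- q).
Proof. by move=> nq i; rewrite coefN; exact: order_geN. Qed.

Lemma gauss_geM n m q r : gauss_ge n q -> gauss_ge m r -> gauss_ge (n + m) (q * r).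
Proof.
move=> nq mr i; rewrite coefM; apply: order_ge_sum => j _.
have -> : n + m - mult P L * i%:Z = n - mult P L * j%:Z + (m - mult P L * (i - j)%N%:Z).
  have -> : i%:Z = j%:Z + (i - j)%N%:Z by have := leq_ord j; lia.
  by rewrite mulrDr; lia.
exact: order_geM.
Qed.

Lemma gauss_geX n q m : gauss_ge n q -> gauss_ge (n * m%:Z) (q ^+ m).
Proof.
move=> nq; elim: m => [|m IH].
  by rewrite mulr0 expr0 => i; rewrite coef1; case: i => [|i]; [right; rewrite place1; lia|left].
by rewrite exprS (_ : n * _ = n + n * m%:Z); [exact: gauss_geM|lia].
Qed.

Definition gauss_eq n q := gauss_ge n q /\ ~ gauss_ge (n + 1) q.

Lemma gauss_eq_exists q : q != 0 -> exists n, gauss_eq n q.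
Proof.
move=> q0; pose w (i : 'I_(size q)) := P q`_i + mult P L * i%:Z.
have lt : ((size q).-1 < size q)%N by rewrite prednK // lt0n size_poly_eq0.
have qj : q`_(Ordinal lt) != 0 by rewrite /= -lead_coefE lead_coef_eq0.
case: (@Order.TotalTheory.arg_minP _ _ _ (Ordinal lt) (fun i : 'I_(size q) => q`_i != 0) w qj) => i qi min.
exists (w i); split=> [j|/(_ i)]; last by rewrite order_geE // /w; lia.
have [->|qj'] := eqVneq q`_j 0; first exact: order_ge0.
have js : (j < size q)%N by rewrite ltnNge; apply: contraNN qj' => /(nth_default 0) ->.
by rewrite order_geE //; have := min (Ordinal js) qj'; rewrite /w /=; lia.
Qed.

Lemma gauss_eq_index n q : gauss_eq n q ->
  exists i, ~ order_ge P (n + 1 - mult P L * i%:Z) q`_i /\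
    forall j, (j < i)%N -> order_ge P (n + 1 - mult P L * j%:Z) q`_j.
Proof.
move=> [_ /existsNP ex].
have ex' : exists i, `[< ~ order_ge P (n + 1 - mult P L * i%:Z) q`_i >].
  by case: ex => i Hi; exists i; exact/asboolP.
case: (ex_minnP ex') => i /asboolP Hi min; exists i; split=> // j ji.
by apply: contrapT => nj; have := min j (introT (asboolP _) nj); rewrite leqNgt ji.
Qed.

(** Gauss's lemma: at the sum of the first indices where the two minima are attained, exactly one
    product has the minimal order. *)
Lemma gauss_eqM n m q r : gauss_eq n q -> gauss_eq m r -> gauss_eq (n + m) (q * r).
Proof.
move=> nq mr; split; first exact: gauss_geM nq.1 mr.1.
have [i [ni li]] := gauss_eq_index nq; have [j [nj lj]] := gauss_eq_index mr.
have [qi qiE] : q`_i != 0 /\ P q`_i = n - mult P L * i%:Z.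
  by apply: exact_order; [exact: nq.1|rewrite addrAC].
have [rj rjE] : r`_j != 0 /\ P r`_j = m - mult P L * j%:Z.
  by apply: exact_order; [exact: mr.1|rewrite addrAC].
move/(_ (i + j)%N); have lt : (i < (i + j).+1)%N by rewrite ltnS leq_addr.
rewrite coefM (bigD1 (Ordinal lt)) //= addKn => H.
have rest : order_ge P (n + m + 1 - mult P L * (i + j)%N%:Z)
    (\sum_(a < (i + j).+1 | a != Ordinal lt) q`_a * r`_(i + j - a)).
  apply: order_ge_sum => a ai; have aij := leq_ord a.
  have ija : (i + j)%N%:Z = a%:Z + (i + j - a)%N%:Z by lia.
  have [ai'|] := ltnP a i.
    have -> : n + m + 1 - mult P L * (i + j)%N%:Z =
      (n + 1 - mult P L * a%:Z) + (m - mult P L * (i + j - a)%N%:Z).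
      by rewrite ija mulrDr; lia.
    by apply: order_geM; [exact: li|exact: mr.1].
  rewrite leq_eqVlt => /orP[/eqP ia|ia]; first by case/eqP: ai; exact: val_inj.
  have -> : n + m + 1 - mult P L * (i + j)%N%:Z =
    (n - mult P L * a%:Z) + (m + 1 - mult P L * (i + j - a)%N%:Z).
    by rewrite ija mulrDr; lia.
  by apply: order_geM; [exact: nq.1|apply: lj; lia].
have := order_geB H rest; rewrite addrK order_geE ?mulf_neq0 // placeM // qiE rjE.
by rewrite PoszD mulrDr; lia.
Qed.

Lemma gauss_eqX n q m : gauss_eq n q -> gauss_eq (n * m%:Z) (q ^+ m).
Proof.
move=> nq; elim: m => [|m IH]; last by rewrite exprS (_ : n * _ = n + n * m%:Z); [exact: gauss_eqM|lia].
rewrite mulr0 expr0; split=> [i|/(_ 0)].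
  by rewrite coef1; case: i => [|i]; [right; rewrite place1; lia|left].
by rewrite coef1 order_geE ?oner_neq0 // place1; lia.
Qed.

(** F[t] is integrally closed, so x is a polynomial. If its Gauss valuation m were negative, x^n
    would have valuation n m, while the other terms of an equation of degree n have valuation at
    least (n - 1) m. *)
Lemma ring_of_sections_normal :
  integral_closure (ring_of_sections [set P]) `<=` ring_of_sections [set P].
Proof.
move=> x [p [pm Bp px]].
have /choice[b bP] : forall i, exists q, gauss_ge 0 q /\ p`_i = tf q.
  by move=> i; have [q Bq pE] := Bp i; exists q; split=> //; apply/ring_of_sections_gauss; rewrite -pE.
have [u [v [v0 uv xE]]] := reduced_fraction_exists x.
case E: (size p) => [|n].
  by have := monic_neq0 pm; rewrite -size_poly_eq0 E.
have lc : p`_n = 1 by have /monicP := pm; rewrite lead_coefE E.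
have xn : x ^+ n = - \sum_(i < n) tf (b i) * x ^+ i.
  apply/eqP; rewrite -addr_eq0 addrC; move: px; rewrite /root horner_coef E big_ord_recr /= lc mul1r.
  by under eq_bigr => i _ do rewrite (bP i).2.
(* By the equation v divides u^n; being coprime to u, it is a constant. *)
have [y yE] : exists y, x = tf y.
  have vu : v %| u ^+ n.
    case: n E lc xn => [|n] E lc xn.
      by move: xn; rewrite big_ord0 expr0 oppr0 => /eqP; rewrite oner_eq0.
    apply/dvdpP; exists (- \sum_(i < n.+1) b i * (u ^+ i * v ^+ (n - i))).
    apply/eqP; rewrite -(inj_eq tf_inj); apply/eqP.
    have v1 : tf v ^+ n.+1 != 0 by rewrite expf_neq0 // tf_eq0.
    have -> : tf (u ^+ n.+1) = x ^+ n.+1 * tf v ^+ n.+1.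
      by rewrite xE expr_div_n divfK // rmorphXn.
    rewrite xn !rmorphM rmorphN !mulNr; congr (- _); rewrite rmorph_sum !mulr_suml.
    apply: eq_bigr => i _; rewrite /= !rmorphM !rmorphXn -!mulrA; congr (_ * _).
    have vi : tf v ^+ i != 0 by rewrite expf_neq0 // tf_eq0.
    have -> : tf v ^+ n.+1 = tf v ^+ i * (tf v ^+ (n - i) * tf v).
      by rewrite mulrA -exprD subnKC ?leq_ord // -exprSr.
    by rewrite xE expr_div_n -!mulrA mulKf.
  have : coprimep v v by apply: coprimep_dvdl vu _; rewrite coprimep_sym coprimep_expl.
  rewrite coprimepp => /size_poly1P[c c0 vE].
  exists (c^-1 *: u); rewrite xE vE -mul_polyC rmorphM mulrC; congr (_ * _).
  apply: (mulIf (_ : tf c%:P != 0)); rewrite ?tf_eq0 ?polyC_eq0 // mulVf ?tf_eq0 ?polyC_eq0 //.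
  by rewrite -(rmorphM tf) -polyCM mulVf // rmorph1.
rewrite yE; apply/ring_of_sections_gauss.
have [->|y0] := eqVneq y 0; first by move=> i; rewrite coef0; left.
have [m my] := gauss_eq_exists y0.
have [m0|m0] := leP 0 m; first exact: gauss_geW my.1.
have [_] := gauss_eqX n my; case; have -> : y ^+ n = - \sum_(i < n) b i * y ^+ i.
  apply/eqP; rewrite -(inj_eq tf_inj) rmorphXn -yE xn rmorphN rmorph_sum; apply/eqP; congr (- _).
  by apply: eq_bigr => i _; rewrite /= rmorphM rmorphXn yE.
apply: gauss_geN => j; rewrite coef_sum; apply: order_ge_sum => i _.
suff : gauss_ge (0 + m * i%:Z) (b i * y ^+ i).
  by move/(@gauss_geW (m * n%:Z + 1)); apply; have := ltn_ord i; nia.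
by apply: gauss_geM; [exact: (bP i).1|exact: gauss_geX my.1].
Qed.

End Gauss.
Hypotheses (ff : is_function_field iota) (genus1 : has_genus iota 1).
Variable P0 : place iota.
Local Notation local P := (ring_of_sections [set P]).

Lemma ring_of_sections_gaussP U q :
  ring_of_sections U (tf q) <-> forall P, U P -> gauss_ge P 0 q.
Proof.
rewrite ring_of_sectionsP; split=> [H P UP i|H n].
  by have := (sectionsP _ _ _).1 (H i) P UP; rewrite multMn sub0r.
by apply/sectionsP => P /H/(_ n); rewrite multMn sub0r.
Qed.

Lemma gauss_ge_term P m f n :
  order_ge P m f -> gauss_ge P (m + mult P L * n%:Z) (f *: 'X^n).
Proof.
move=> mf i; rewrite coefZ coefXn; case: eqP => [->|_]; last by rewrite mulr0; left.
by rewrite mulr1; apply: order_geW mf; lia.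
Qed.

Lemma gauss_poles q : exists Z, [/\ fgle 0 Z, forall P, gauss_ge P (- mult P Z) q &
  forall P, gauss_ge P 0 q -> mult P Z = 0].
Proof.
pose Z i := if q`_i == 0 then 0 else fgpos (- divisor ff genus1 P0 q`_i - L *+ i).
have Z0 i P : 0 <= mult P (Z i).
  by rewrite /Z; case: eqP => _; [rewrite mult0|apply: fgle0_mult; exact: fgpos_le0].
have ZE P : mult P (\sum_(i < size q) Z i) = \sum_(i < size q) mult P (Z i).
  by elim/big_rec2: _ => [|i a b _ <-]; rewrite ?mult0 ?multD.
exists (\sum_(i < size q) Z i); split.
- by apply: mult_fgle0 => P; rewrite ZE; apply: sumr_ge0 => i _.
- move=> P i; have [qi|qi] := eqVneq q`_i 0; first by rewrite qi; left.
  have lt : (i < size q)%N by rewrite ltnNge; apply: contraNN qi => /(nth_default 0) ->.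
  rewrite ZE (bigD1 (Ordinal lt)) //= {1}/Z (negbTE qi) mult_fgpos multB multN mult_divisor // multMn.
  have aux (s a b : int) : 0 <= s -> - (Num.max 0 (- a - b) + s) - b <= a by lia.
  by rewrite order_geE //; apply: aux; apply: sumr_ge0 => j _.
- move=> P Pq; rewrite ZE big1 // => i _; rewrite /Z; have [_|qi] := eqVneq q`_i 0; first by rewrite mult0.
  by rewrite mult_fgpos multB multN mult_divisor // multMn; have := Pq i; rewrite order_geE //; lia.
Qed.

(** s vanishes at the poles of z in U to a sufficient order. Since s may have any pole at Q, outside
    U, it can still be a unit at P. *)
Lemma ring_of_sections_fraction U P Q z : U P -> ~ U Q -> local P z ->
  exists s, [/\ s != 0, P s = 0, forall R, U R -> order_ge R 0 s &
    ring_of_sections U (term s 0 * z)].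
Proof.
move=> UP UQ [q]; have [Z [Z0 qZ qZ0]] := gauss_poles q.
move=> Bq zE; have {Bq} Pq : gauss_ge P 0 q.
  by apply/ring_of_sections_gauss; exists q.
have PQ : P != Q by apply: contra_not_neq UQ => <-.
have [s [s0 Zs Ps]] := section_pole_at ff genus1 P0 (- Z) PQ.
have sR R : U R -> order_ge R (mult R Z) s.
  move=> UR; have := (sectionsP _ _ _).1 Zs R; rewrite multN opprK; apply.
  by move=> RQ; rewrite RQ in UR.
exists s; split=> //; first by rewrite Ps multN qZ0 ?oppr0.
  by move=> R /sR; apply: order_geW; exact: fgle0_mult.
rewrite zE -(rmorphM tf); apply/ring_of_sections_gaussP => R UR.
rewrite (_ : 0 = mult R Z + mult R L * 0%:Z + (- mult R Z)); last by lia.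
by apply: gauss_geM => //; apply: gauss_ge_term; exact: sR.
Qed.

Lemma local_function P f : order_ge P 0 f -> local P (term f 0).
Proof. by move=> Pf; apply/ring_of_sections_function => _ ->. Qed.

Lemma local_unit P f : f != 0 -> P f = 0 -> local P (term f 0)^-1.
Proof. by move=> f0 Pf; rewrite -termV; apply: local_function; right; rewrite placeV Pf. Qed.

Lemma spec_local_ring_of_sections U P Q O : U P -> ~ U Q ->
  spec (local P) O -> spec (ring_of_sections U) O.
Proof.
move=> UP UQ PO; have sP := ring_of_sections_subring [set P].
have lO := spec_local sP PO; have PsubO := spec_sub sP PO.
have sO := lO.1; apply: specI => //; first exact: ring_of_sections_subring.
  by apply: subset_trans PsubO; apply: ring_of_sectionsS => _ ->.
move=> x /(spec_fraction sP PO)[a [b [Pa Pb b0 Ob ->]]].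
have [s [s0 Ps Us Usa]] := ring_of_sections_fraction UP UQ Pa.
have [u [u0 Pu Uu Uub]] := ring_of_sections_fraction UP UQ Pb.
have sU := ring_of_sections_subring U.
have t0 : term s 0 != 0 by rewrite term_eq0.
have t1 : term u 0 != 0 by rewrite term_eq0.
exists (term u 0 * (term s 0 * a)), (term s 0 * (term u 0 * b)); split.
- by apply: subringM => //; exact/ring_of_sections_function.
- by apply: subringM => //; exact/ring_of_sections_function.
- by apply: mulf_neq0 t0 _; apply: mulf_neq0 t1 _.
- rewrite !invfM; apply: subringM => //; first by apply: PsubO; exact: local_unit.
  by apply: subringM => //; apply: PsubO; exact: local_unit.
exact: fraction_expand.
Qed.

Section Valuation.
Variable V : set (K).
Hypothesis vV : is_valuation_ring V.

Definition functions_of : set F := [set f | V (term f 0)].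

Lemma functions_of_valuation_ring : is_valuation_ring functions_of.
Proof.
have [sV VV] := vV; split.
  split.
  - by rewrite /functions_of /= term10; exact: subring1.
  - move=> x y Vx Vy; rewrite /functions_of /= termD termN; exact: subringB.
  - by move=> x y Vx Vy; rewrite /functions_of /= -[0%N]/(0 + 0)%N -termM; exact: subringM.
by move=> x; case: (VV (term x 0)); [left|right]; rewrite /functions_of /= ?termV.
Qed.

End Valuation.

Lemma affine_openP U : affine_open U ->
  exists Q (s : seq (place iota)), ~ U Q /\ forall P, P \notin s -> U P.
Proof.
move=> [S [/finite_seqP[s ->] [Q SQ]] ->]; exists Q, s; split; first by move=> /(_ SQ).
by move=> P Ps SP; move: Ps; rewrite [P \in s]SP.
Qed.

Definition resolution : set (set K) :=
  [set O | exists2 U, affine_open U & spec (ring_of_sections U) O].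

(** Given O over U, a valuation ring V dominating O restricts to F, where it contains the local ring
    of a place P. Elements of [local P] are fractions over U whose denominators, units at P, are
    units in V and therefore in O. P can be taken in U: if it is not, functions with a pole at P
    alone show that V contains F, and then any place of U will do. *)
Lemma resolutionP O : resolution O <-> exists P, spec (local P) O.
Proof.
split=> [[U Uaff UO]|[P PO]]; last first.
  have [Q QP] := exists_place_notin ff genus1 P0 [:: P].
  have UP : (~` [set Q]) P by move=> PQ; move: QP; rewrite inE PQ eqxx.
  exists (~` [set Q]); last by apply: spec_local_ring_of_sections PO => //; apply.
  by exists [set Q] => //; split; [exact: finite_set1|exists Q].
have [Q [s [UQ sU]]] := affine_openP Uaff.
have sUr := ring_of_sections_subring U.
have lO := spec_local sUr UO; have UsubO := spec_sub sUr UO.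
have [V vV VO] := chevalley lO.
have UV : ring_of_sections U `<=` V by apply: subset_trans UsubO VO.1.
have Vk c : V (term (iota c) 0) by apply: UV; exact: ring_of_sectionsC.
have vW := functions_of_valuation_ring vV.
have [sW _] := vW.
have [P [UP PW]] : exists P, U P /\ [set b | order_ge P 0 b] `<=` functions_of V.
  have [P PW] := valuation_contains_place ff genus1 P0 vW Vk.
  have [WT|/existsNP[x Wx]] := pselect (forall f, functions_of V f).
    by have [P' /sU UP'] := exists_place_notin ff genus1 P0 s; exists P'; split=> // b _.
  exists P; split=> //; apply: contrapT => UP; apply: Wx.
  have [|b [b0 Db Pb]] := section_exact_order ff genus1 P0 (D := << P >> *+ (`|P x|).+2) P.
    by rewrite degMn degU; lia.
  rewrite multMn mult_point_eq in Pb.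
  rewrite -(divfK b0 x) mulrC; apply: subringM => //.
    apply: UV; apply/ring_of_sections_function => R UR.
    have := (sectionsP _ _ _).1 Db R I; rewrite multMn mult_point_neq ?mul0r //.
    by apply: contra_not_neq UP => ->.
  have [->|x0] := eqVneq x 0; first by rewrite mul0r; exact: subring0.
  by apply: PW; right; rewrite place_div // Pb; lia.
exists P; apply: specI => //; first exact: ring_of_sections_subring.
  move=> z Pz; have [u [u0 Pu Uu Uuz]] := ring_of_sections_fraction UP UQ Pz.
  have t0 : term u 0 != 0 by rewrite term_eq0.
  rewrite -(mulKf t0 z); apply: subringM; [exact: lO.1| |exact: UsubO].
  apply: (dominates_inv VO) => //; first by apply: UsubO; exact/ring_of_sections_function.
  by rewrite -termV; apply: PW; right; rewrite placeV Pu.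
move=> x /(spec_fraction sUr UO)[a [b [Ua Ub b0 Ob ->]]].
exists a, b; split=> //; [move: a Ua {Ub}|move: b Ub {b0 Ob}]; by apply: ring_of_sectionsS => _ ->.
Qed.

Lemma spec_local_normal P O : spec (local P) O -> integral_closure O `<=` O.
Proof.
move=> PO x xO; have sP := ring_of_sections_subring [set P].
have [sO _] := spec_local sP PO.
have [s [_ s0 Os sx]] := integral_over_localization sP PO xO.
rewrite -(mulKf s0 x); apply: subringM => //; apply: (spec_sub sP PO).
exact: ring_of_sections_normal.
Qed.

Hypothesis degL : 2 <= deg L.

Lemma termX f n m : term f n ^+ m = term (f ^+ m) (n * m)%N.
Proof.
elim: m => [|m IH]; first by rewrite muln0 !expr0 term10.
by rewrite !exprS IH termM mulnS.
Qed.

(** A section f of L that generates it at P, which exists because deg L >= 2, turns q_i t^i into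
    (q_i / f^i) (f t)^i, a function regular at P times an element of R. *)
Lemma local_sub P V : is_subring V -> ring_of_sections setT `<=` V ->
  [set b | order_ge P 0 b] `<=` functions_of V -> local P `<=` V.
Proof.
move=> sV RV PV _ [q Pq ->].
have [f [f0 Lf Pf]] := section_exact_order ff genus1 P0 P degL.
rewrite tf_sum_terms; apply: subring_sum => // i _.
have -> : term q`_i i = term (q`_i / f ^+ i) 0 * term f 1 ^+ i.
  by rewrite termX mul1n termM divfK // expf_neq0.
apply: subringM => //; last by apply: subringX => //; apply: RV; apply/ring_of_sections_term; rewrite mulr1n.
apply: PV => /=; have := (sectionsP _ _ _).1 (Pq i) P erefl; rewrite multMn => qi.
rewrite -(addNr (mult P L * i%:Z)).
by apply: order_geM => //; right; rewrite placeV placeX Pf -mulr_natr natz mulNr opprK.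
Qed.

Lemma base_sub P : ring_of_sections setT `<=` local P.
Proof. exact: ring_of_sectionsS. Qed.

(** Existence comes from [valuation_contains_place] for the restriction of V to F. If two centres
    lie over different places, V contains F; each function or its inverse is in [O1], so by
    domination [O1] contains F, hence [O2], and conversely. *)
Lemma resolution_valuative V : is_valuation_ring V -> ring_of_sections setT `<=` V ->
  exists! O, resolution O /\ dominates V O.
Proof.
move=> vV RV; have lV := valuation_ring_local vV; have [sV _] := lV.
have Vk c : V (term (iota c) 0) by apply: RV; exact: ring_of_sectionsC.
have vW := functions_of_valuation_ring vV.
have [P PW] := valuation_contains_place ff genus1 P0 vW Vk.
have sB Q := ring_of_sections_subring [set Q].
have [O PO VO] := spec_centre (sB P) lV (local_sub sV RV PW).
exists O; split; first by split=> //; apply/resolutionP; exists P.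
have le P1 P2 O1 O2 : spec (local P1) O1 -> spec (local P2) O2 ->
    dominates V O1 -> dominates V O2 -> O2 `<=` O1.
  move=> PO1 PO2 VO1 VO2; have [sO1 _] := spec_local (sB _) PO1.
  apply: (spec_dominated_le (sB P2) sO1 PO2 _ VO1 VO2.1).
  have [<-|P12] := eqVneq P1 P2; first exact: spec_sub PO1.
  have PV P' O' : spec (local P') O' -> dominates V O' -> [set b | order_ge P' 0 b] `<=` functions_of V.
    move=> PO' [VO' _] b Pb; apply: VO'; apply: (spec_sub (sB _) PO'); exact: local_function.
  have WT f : functions_of V f.
    exact: (valuation_place_unique ff genus1 P0 vW f (PV _ _ PO1 VO1) (PV _ _ PO2 VO2) P12).
  apply: local_sub => //; first by apply: subset_trans (spec_sub (sB _) PO1); exact: base_sub.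
  move=> f _; have O1f g : order_ge P1 0 g -> O1 (term g 0).
    by move=> g0; apply: (spec_sub (sB _) PO1); exact: local_function.
  have [->|f0] := eqVneq f 0; first by apply: O1f; left.
  have [fP|fP] := leP 0 (P1 f); first by apply: O1f; right.
  rewrite /functions_of /= -[f]invrK termV; apply: (dominates_inv VO1).
  - by apply: O1f; right; rewrite placeV; lia.
  - by rewrite term_eq0 invr_eq0.
  - by rewrite -termV invrK; exact: WT.
move=> O' [/resolutionP[P' PO'] VO'].
by apply/seteqP; split; [exact: le PO' PO VO' VO|exact: le PO PO' VO VO'].
Qed.

(** This lets two charts cover the resolution. The zeros of f lie in the finite list [s ++ dom L],
    where g is made not to vanish. *)
Lemma two_sections : exists f g, [/\ f != 0, g != 0, sections L setT f, sections L setT g &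
  forall P, P f = - mult P L \/ P g = - mult P L].
Proof.
have [f [f0 Lf _]] := generic_section ff genus1 P0 [::] degL.
have [s sP] := finite_support ff genus1 P0 f0.
have [g [g0 Lg gs]] := generic_section ff genus1 P0 (s ++ dom L) degL.
exists f, g; split=> // P; have [Ps|] := boolP (P \in s ++ dom L); first by right; exact: gs.
rewrite mem_cat negb_or => /andP[Ps PL]; left.
by rewrite (mult_outdom PL) oppr0; apply/eqP; apply: contraNT Ps; exact: sP.
Qed.

Definition nonvanishing f : set (place iota) := [set P : place iota | P f = - mult P L].

Lemma nonvanishing_affine f : f != 0 -> sections L setT f -> affine_open (nonvanishing f).
Proof.
move=> f0 Lf; exists (~` nonvanishing f); last by rewrite setCK.
split.
  have [s sP] := finite_support ff genus1 P0 f0.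
  apply: (@sub_finite_set _ _ [set` (s ++ dom L)]); last exact: finite_seq.
  move=> P nP /=; rewrite mem_cat; apply: contrapT => /negP; rewrite negb_or => /andP[Ps PL].
  apply: nP; rewrite /nonvanishing /= (mult_outdom PL) oppr0.
  by apply/eqP; apply: contraNT Ps; exact: sP.
(* If f vanished nowhere, its divisor would be -L, which has nonzero degree. *)
apply: contrapT => /forallNP nP.
have := deg_divisor ff genus1 P0 f0; suff -> : divisor ff genus1 P0 f = - L by rewrite degN; lia.
apply: mult_inj => P; rewrite multN mult_divisor //; apply: contrapT; exact: nP.
Qed.

(** U is the locus where g / f is regular, so its functions are finite over k[g / f]; and over U the
    element f t of R generates the part of degree 1. *)
Lemma nonvanishing_finitely_generated f g : f != 0 -> g != 0 ->
  sections L setT f -> sections L setT g ->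
  (forall P, P f = - mult P L \/ P g = - mult P L) ->
  finitely_generated_over (ring_of_sections setT) (ring_of_sections (nonvanishing f)).
Proof.
move=> f0 g0 Lf Lg fg; set U := nonvanishing f.
have gP P : - mult P L <= P g by rewrite -order_geE //; exact: (sectionsP _ _ _).1 Lg P I.
have fP P : - mult P L <= P f by rewrite -order_geE //; exact: (sectionsP _ _ _).1 Lf P I.
have y0 : g / f != 0 by rewrite mulf_neq0 ?invr_eq0.
have Uy P : U P <-> order_ge P 0 (g / f).
  rewrite order_geE // place_div // /U /nonvanishing /=.
  by case: (fg P) (gP P) (fP P) => ->; lia.
have yc : ~ constant iota (g / f).
  case=> c yE; have [Q [_ [UQ _]]] := affine_openP (nonvanishing_affine f0 Lf).
  by apply: UQ; apply/Uy; rewrite yE; exact: order_geC.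
have [m [w [yw wf]]] := regular_where_finite ff genus1 P0 yc.
split; first exact: ring_of_sections_subring.
  exact: ring_of_sectionsS.
exists (term (g / f) 0 :: [seq term (w i) 0 | i <- enum 'I_m]).
  move=> x; rewrite inE => /orP[/eqP ->|/mapP[i _ ->]].
    by apply/ring_of_sections_function => P /Uy.
  by apply/ring_of_sections_function => P /Uy; exact: yw.
move=> B sB RB sG _ [q Uq ->].
have Bk c : B (term (iota c) 0) by apply: RB; exact: ring_of_sectionsC.
have B0 a b : B (term a 0) -> B (term b 0) -> B (term (a * b) 0).
  by move=> Ba Bb; rewrite -[0%N]/(0 + 0)%N -termM; exact: subringM.
have Bsum n (a : 'I_n -> F) : (forall i, B (term (a i) 0)) -> B (term (\sum_(i < n) a i) 0).
  move=> Ba; elim/big_ind: _ => // [|a' b'].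
    by rewrite -(rmorph0 iota); exact: Bk.
  by rewrite termD; exact: subringD.
have BX a n : B (term a 0) -> B (term (a ^+ n) 0).
  move=> Ba; elim: n => [|n IH]; first by rewrite expr0 -(rmorph1 iota); exact: Bk.
  by rewrite exprS; exact: B0.
rewrite tf_sum_terms; apply: subring_sum => // i _.
have -> : term q`_i i = term (q`_i / f ^+ i) 0 * term f 1 ^+ i.
  by rewrite termX mul1n termM divfK // expf_neq0.
apply: subringM => //; last by apply: subringX => //; apply: RB; apply/ring_of_sections_term; rewrite mulr1n.
have [P /Uy UP|h ->] := wf (q`_i / f ^+ i).
  have := (sectionsP _ _ _).1 (Uq i) P UP; rewrite multMn => qi.
  rewrite -(addNr (mult P L * i%:Z)).
  by apply: order_geM => //; right; rewrite placeV placeX UP -mulr_natr natz mulNr opprK.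
apply: (Bsum) => j; apply: (B0); last first.
  by apply: sG; rewrite inE; apply/orP; right; apply/mapP; exists j; rewrite ?mem_enum.
rewrite (evk_sum _ _ (leqnn _)); apply: (Bsum) => l; apply: (B0) => //; apply: (BX).
by apply: sG; rewrite inE eqxx.
Qed.

Lemma resolution_modification : is_modification (ring_of_sections setT) resolution.
Proof.
split; last exact: resolution_valuative.
have [f [g [f0 g0 Lf Lg fg]]] := two_sections.
exists 2%N, (fun i : 'I_2 => ring_of_sections (nonvanishing (if i == ord0 then f else g))); split.
  move=> i; case: eqP => _; first exact: nonvanishing_finitely_generated fg.
  by apply: nonvanishing_finitely_generated Lg Lf _ => // P; case: (fg P); [right|left].
apply/seteqP; split=> [O /resolutionP[P PO]|O [i iO]]; last first.
  exists (nonvanishing (if i == ord0 then f else g)) => //.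
  by case: eqP => _; exact: nonvanishing_affine.
have main (i : 'I_2) : nonvanishing (if i == ord0 then f else g) P ->
    exists i : 'I_2, spec (ring_of_sections (nonvanishing (if i == ord0 then f else g))) O.
  move=> iP; exists i.
  have Uaff : affine_open (nonvanishing (if i == ord0 then f else g)).
    by case: eqP => _; exact: nonvanishing_affine.
  have [Q [_ [UQ _]]] := affine_openP Uaff.
  exact: spec_local_ring_of_sections UQ PO.
by case: (fg P) => H; [apply: (main ord0)|apply: (main (fintype.lift ord0 ord0))].
Qed.

(** A polynomial q is brought into R by a factor h t^n, where h is a section of n L that vanishes
    along the poles of q. *)
Lemma base_fractions x : exists a b,
  [/\ ring_of_sections setT a, ring_of_sections setT b, b != 0 & x = a / b].
Proof.
have main q : exists u, [/\ ring_of_sections setT u, u != 0 & ring_of_sections setT (u * tf q)].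
  have [Z [Z0 qZ _]] := gauss_poles q.
  have [|h h0 Dh] := sections_neq0 ff genus1 (D := L *+ (`|deg Z|).+1 - Z).
    by rewrite degB degMn; move: (deg L) (deg Z) degL => a b a2; nia.
  set n := (`|deg Z|).+1 in Dh.
  have hP P : order_ge P (mult P Z - mult P L * n%:Z) h.
    by have := (sectionsP _ _ _).1 Dh P I; rewrite multB multMn opprB.
  exists (term h n); split; last 1 first.
  - rewrite -(rmorphM tf); apply/ring_of_sections_gaussP => P _.
    rewrite (_ : 0 = mult P Z - mult P L * n%:Z + mult P L * n%:Z + (- mult P Z)); last by lia.
    by apply: gauss_geM => //; exact: gauss_ge_term.
  - apply/ring_of_sections_gaussP => P _.
    apply: (gauss_geW (m := mult P Z - mult P L * n%:Z + mult P L * n%:Z)); last exact: gauss_ge_term.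
    by have := fgle0_mult P Z0; lia.
  - by rewrite term_eq0.
have [q [r [r0 ->]]] := tf_fraction x.
have [u [Ru u0 Ruq]] := main q; have [v [Rv v0 Rvr]] := main r.
have sR := ring_of_sections_subring setT.
have r0' : tf r != 0 by rewrite tf_eq0.
exists (v * (u * tf q)), (u * (v * tf r)); split.
- exact: subringM.
- exact: subringM.
- by rewrite !mulf_neq0.
by field; rewrite u0 v0 r0'.
Qed.



End SectionRings.

(** * Quotients of abelian groups *)

Section QuotientGroup.
Variables (G : zmodType) (m : set G).
Hypotheses (m0 : m 0) (mB : forall x y, m x -> m y -> m (x - y)).

Definition mem_kernel : {pred G} := fun x => `[< m x >].

Fact mem_kernel_closed : zmod_closed mem_kernel.
Proof.
split; first exact/asboolP.
by move=> x y /asboolP mx /asboolP my; apply/asboolP; exact: mB.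
Qed.

HB.instance Definition _ := GRing.isZmodClosed.Build G mem_kernel mem_kernel_closed.

Lemma quotient_group_exists : exists (Q : zmodType) (pi : G -> Q) (rep : Q -> G),
  [/\ forall x y, pi (x + y) = pi x + pi y, cancel rep pi & forall x, pi x = 0 <-> m x].
Proof.
pose Q := Quotient.quot mem_kernel.
exists Q, (\pi_Q)%qT, (@repr _ Q); split=> [x y||x].
- by rewrite !piE.
- exact: reprK.
have -> : (0 : Q) = (\pi_Q 0)%qT by rewrite !piE.
split=> [/eqP|mx].
  by rewrite -Quotient.idealrBE subr0 => /asboolP.
by apply/eqP; rewrite -Quotient.idealrBE subr0; exact/asboolP.
Qed.

End QuotientGroup.

(** * Free modules are flat; coordinates in a flat module *)

Section Flatness.
Variables (K : fieldType).
Implicit Types (A : set K) (M N U : moddata K).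

Lemma module_sum A M (I : Type) (r : seq I) (Q : pred I) (u : I -> M) : is_module A M ->
  (forall i, Q i -> mcar (u i)) -> mcar (\sum_(i <- r | Q i) u i).
Proof.
move=> [[M0 MB] _ _ _ _] Mu; elim/big_ind: _ => // x y Mx My.
by rewrite -[y]opprK; apply: (MB) => //; rewrite -sub0r; exact: MB.
Qed.

Lemma linear_map0 A M N (f : M -> N) : is_module A M -> is_linear A f -> f 0 = 0.
Proof.
move=> [[M0 _] _ _ _ _] [_ fD _]; have /eqP := fD 0 0 M0 M0.
by rewrite addr0 -subr_eq0 opprD addNKr oppr_eq0 => /eqP.
Qed.

Lemma linear_map_sum A M N (f : M -> N) (I : Type) (r : seq I) (u : I -> M) :
  is_module A M -> is_linear A f -> (forall i, mcar (u i)) ->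
  f (\sum_(i <- r) u i) = \sum_(i <- r) f (u i).
Proof.
move=> mM lf Mu; elim: r => [|i r IH]; first by rewrite !big_nil (linear_map0 mM).
by rewrite !big_cons -IH; case: lf => _ + _; apply=> //; exact: module_sum mM _.
Qed.

(** For each j, sending (x, u) to the j-th coordinate of u times x is bilinear. Hence a tensor that
    dies over N' has coordinates in N that f kills, and they are zero by injectivity. *)
Lemma flat_of_basis A M (I : finType) (e : I -> M) : is_subring A -> is_module A M ->
  (forall j, mcar (e j)) ->
  (forall u, mcar u -> exists2 c : I -> K, forall j, A (c j) & u = \sum_j mact (c j) (e j)) ->
  (forall c : I -> K, (forall j, A (c j)) -> \sum_j mact (c j) (e j) = 0 -> forall j, c j = 0) ->
  flat A M.
Proof.
move=> sA mM Me gen free N N' f mN mN' lf injf n x y Nx My fxy.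
have [_ MA MD MDM _] := mM.
have /choice[co coP] : forall u : M, exists c : I -> K, mcar u ->
    (forall j, A (c j)) /\ u = \sum_j mact (c j) (e j).
  by move=> u; have [/gen[c Ac uE]|nu] := pselect (mcar u); [exists c|exists (fun=> 0)].
have co_uniq u c : mcar u -> (forall j, A (c j)) -> u = \sum_j mact (c j) (e j) -> co u =1 c.
  move=> Mu Ac uE j; have [Aco coE] := coP u Mu.
  apply/eqP; rewrite -subr_eq0; apply/eqP; apply: (free (fun j => co u j - c j)) => {j}.
    by move=> j; exact: subringB.
  have : \sum_j mact (co u j - c j) (e j) + \sum_j mact (c j) (e j) = \sum_j mact (co u j) (e j).
    rewrite -big_split /=; apply: eq_bigr => j _.
    have [|<- _] := MDM (co u j - c j) (c j) (e j) _ (Ac j) (Me j); first exact: subringB.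
    by rewrite subrK.
  by rewrite -coE -uE => /eqP; rewrite -subr_eq0 addrK => /eqP.
have coD u w : mcar u -> mcar w -> co (u + w) =1 fun j => co u j + co w j.
  move=> Mu Mw; have [Au uE] := coP u Mu; have [Aw wE] := coP w Mw.
  apply: co_uniq => [|j|].
  - have := @module_sum A M bool [:: true; false] xpredT (fun b => if b then u else w) mM.
    by rewrite !big_cons big_nil addr0; apply; case.
  - exact: subringD.
  - rewrite {1}uE {1}wE -big_split; apply: eq_bigr => j _ /=.
    by have [-> _] := MDM (co u j) (co w j) (e j) (Au j) (Aw j) (Me j).
have mactD a (s : I -> M) : A a -> (forall j, mcar (s j)) ->
    mact a (\sum_j s j) = \sum_j mact a (s j).
  move=> Aa Ms; apply: (@linear_map_sum A M M (mact a)) => //; split.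
  - by move=> u Mu; exact: MA.
  - by move=> u w Mu Mw; exact: MD.
  - move=> b u Ab Mu; have [_ <-] := MDM a b u Aa Ab Mu; have [_ <-] := MDM b a u Ab Aa Mu.
    by rewrite mulrC.
have coM a u : A a -> mcar u -> co (mact a u) =1 fun j => a * co u j.
  move=> Aa Mu; have [Au uE] := coP u Mu; apply: co_uniq => [|j|]; [exact: MA|exact: subringM|].
  rewrite {1}uE mactD // => [|j]; last exact: MA.
  by apply: eq_bigr => j _; have [_ ->] := MDM a (co u j) (e j) Aa (Au j) (Me j).
have [[N'0 N'B] N'A N'D N'DM _] := mN'; have [_ NA ND NDM _] := mN.
have xy0 j : \sum_(i < n) mact (co (y i) j) (x i) = 0.
  have Nxi i : mcar (mact (co (y i) j) (x i)) by apply: (NA) => //; case: (coP _ (My i)).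
  apply: injf; [exact: module_sum mN _|by case: mN => -[]|].
  rewrite (linear_map_sum _ mN lf) // (linear_map0 mN lf).
  have [Nf _ fA] := lf.
  rewrite -[RHS](fxy N' (fun x u => mact (co u j) x)) //.
    by apply: eq_bigr => i _; rewrite /= fA //; case: (coP _ (My i)).
  split=> [z Nz|u Mu]; split=> /=.
  - by move=> u Mu; apply: (N'A) => //; case: (coP _ Mu).
  - move=> u w Mu Mw; rewrite coD //.
    by have [-> _] := N'DM (co u j) (co w j) z ((coP _ Mu).1 j) ((coP _ Mw).1 j) Nz.
  - move=> a u Aa Mu; rewrite coM //.
    by have [_ ->] := N'DM a (co u j) z Aa ((coP _ Mu).1 j) Nz.
  - by move=> z Nz; apply: (N'A) => //; case: (coP _ Mu).
  - by move=> z w Nz Nw; apply: (N'D) => //; case: (coP _ Mu).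
  - move=> a z Aa Nz; have Ac := (coP _ Mu).1 j.
    have [_ <-] := N'DM a (co u j) z Aa Ac Nz; have [_ <-] := N'DM (co u j) a z Ac Aa Nz.
    by rewrite mulrC.
move=> U b mU [bl br].
transitivity (\sum_(i < n) \sum_j b (mact (co (y i) j) (x i)) (e j)).
  apply: eq_bigr => i _; have [Ac yE] := coP _ (My i).
  rewrite {1}yE (linear_map_sum _ mM (bl _ (Nx i))) => [|j]; last exact: MA.
  apply: eq_bigr => j _; have [_ _ blA] := bl _ (Nx i); have [_ _ brA] := br _ (Me j).
  by rewrite blA // brA.
rewrite exchange_big big1 //= => j _.
rewrite -(linear_map_sum _ mN (br _ (Me j))) => [|i]; last by apply: (NA) => //; case: (coP _ (My i)).
by rewrite xy0 (linear_map0 mN (br _ (Me j))).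
Qed.

Section Coordinates.
Variables (O O' : set K) (M : moddata K) (n : nat).
Variables (lam : 'I_n -> M -> K) (e : 'I_n -> M) (w : M) (a0 : K).
Hypotheses (lO : local_ring O) (lO' : local_ring O') (O'O : dominates O' O).
Hypotheses (mM : is_module O M) (flatM : flat O M).
Hypothesis lam_in : forall j u, mcar u -> O' (lam j u).
Hypothesis lamD : forall j u v, mcar u -> mcar v -> lam j (u + v) = lam j u + lam j v.
Hypothesis lamM : forall j a u, O a -> mcar u -> lam j (mact a u) = a * lam j u.
Hypotheses (Me : forall j, mcar (e j)) (lam_e : forall i j, lam i (e j) = (i == j)%:R).
Hypotheses (Mw : mcar w) (Oa0 : O a0) (a00 : a0 != 0).
Hypothesis Oa0lam : forall j, O (a0 * lam j w).
Hypothesis wE : mact a0 w = \sum_j mact (a0 * lam j w) (e j).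

Let sO : is_subring O := lO.1.
Let sO' : is_subring O' := lO'.1.

(** The generator 1 is always present, so that a minimal J is empty exactly when all coordinates of
    w lie in O. *)
Let combination (J : {set 'I_n}) : set K :=
  [set x | exists c0 (c : 'I_n -> K), [/\ O c0, forall l, O (c l) &
     x = c0 + \sum_(l in J) c l * lam l w]].

Let combinationD J x y : combination J x -> combination J y -> combination J (x + y).
Proof.
move=> [c0 [c [Oc0 Oc ->]]] [d0 [d [Od0 Od ->]]]; exists (c0 + d0), (fun l => c l + d l).
split=> [|l|]; [exact: subringD|exact: subringD|].
by rewrite addrACA -big_split; congr (_ + _); apply: eq_bigr => l _; rewrite mulrDl.
Qed.

Let combinationM J a x : O a -> combination J x -> combination J (a * x).
Proof.
move=> Oa [c0 [c [Oc0 Oc ->]]]; exists (a * c0), (fun l => a * c l).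
split=> [|l|]; [exact: subringM|exact: subringM|].
by rewrite mulrDr mulr_sumr; congr (_ + _); apply: eq_bigr => l _; rewrite mulrA.
Qed.

Let combinationC J a : O a -> combination J a.
Proof.
move=> Oa; exists a, (fun=> 0); split=> // [_|]; first exact: subring0.
by rewrite big1 ?addr0 // => l _; rewrite mul0r.
Qed.

Let combination_gen (J : {set 'I_n}) l : l \in J -> combination J (lam l w).
Proof.
move=> lJ; exists 0, (fun i => (i == l)%:R); split=> [|i|]; first exact: subring0.
  by case: eqP => _; [exact: subring1|exact: subring0].
rewrite add0r (bigD1 l) //= eqxx mul1r big1 ?addr0 // => i /andP[_ /negbTE ->].
by rewrite mul0r.
Qed.

Let combination_sum (J : {set 'I_n}) (Q : pred 'I_n) c y : (forall l, O (c l)) ->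
  (forall l, Q l -> combination J (y l)) -> combination J (\sum_(l | Q l) c l * y l).
Proof.
move=> Oc Jy; elim/big_ind: _ => [|x z|l Ql]; [exact: combinationC (subring0 sO)|exact: combinationD|].
by apply: combinationM => //; exact: Jy.
Qed.

(* If [J] is a minimal set of indices such that 1 and the [lam l w], l in J, generate the
   O-module spanned by 1 and all coordinates of w, and j is in J, then the coefficient of
   [lam j w] is well defined modulo the maximal ideal.  By flatness, the relation
   1 (x) w = \sum_l lam l w (x) e l holds in the tensor product of this module with M;
   applying to it (coefficient of [lam j w]) * [lam j] gives 0 = 1 in the residue field of O'. *)
Lemma flat_coordinates j : O (lam j w).
Proof.
have [J gJ Jmin] : exists2 J : {set 'I_n}, forall j, combination J (lam j w) &
    forall J' : {set 'I_n}, (forall j, combination J' (lam j w)) -> (#|J| <= #|J'|)%N.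
  pose Q m := `[< exists2 J : {set 'I_n}, forall j, combination J (lam j w) & #|J| = m >].
  have Qex : exists m, Q m.
    by exists #|[set: 'I_n]%SET|; apply/asboolP; exists [set: 'I_n]%SET => // l; apply: combination_gen; rewrite inE.
  case: (ex_minnP Qex) => m /asboolP[J gJ <-] min; exists J => // J' gJ'.
  by apply: min; apply/asboolP; exists J'.
have [J0|[j0 j0J]] := set_0Vmem J.
  by have [c0 [c [Oc0 _ ->]]] := gJ j; rewrite J0 big_set0 addr0.
exfalso.
have unit_absurd c0 c : O c0 -> (forall l, O (c l)) -> c0 + \sum_(l in J) c l * lam l w = 0 ->
    nonunits O (c j0).
  move=> Oc0 Oc E; apply: contrapT => /(nonunitP (Oc j0))[cj Ocj].
  have J'j0 : combination (J :\ j0) (lam j0 w).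
    exists (- (c j0)^-1 * c0), (fun l => - (c j0)^-1 * c l); split=> [|l|].
    - by apply: subringM => //; exact: subringN.
    - by apply: subringM => //; exact: subringN.
    apply: (mulfI cj); move: E; rewrite (bigD1 j0) //= addrCA => /eqP; rewrite addr_eq0 => /eqP ->.
    rewrite mulrDr mulr_sumr opprD -sumrN mulrA mulrN mulfV // mulN1r; congr (_ + _).
    rewrite [RHS](eq_bigl (fun i => (i \in J) && (i != j0))) => [|l]; last by rewrite !inE andbC.
    by apply: eq_bigr => l _; rewrite !mulrA mulrN mulfV // mulN1r mulNr.
  suff /Jmin : forall l, combination (J :\ j0) (lam l w).
    by rewrite [#|J|](cardsD1 j0) j0J add1n ltnn.
  move=> l; have [d0 [d [Od0 Od ->]]] := gJ l; apply: combinationD; first exact: combinationC.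
  apply: combination_sum => // i iJ; have [->//|ij0] := eqVneq i j0.
  by apply: combination_gen; rewrite !inE ij0.
have /choice[phi phiP] : forall x, exists c1, combination J x -> O c1 /\
    exists c0 (c : 'I_n -> K), [/\ O c0, forall l, O (c l), c j0 = c1 &
      x = c0 + \sum_(l in J) c l * lam l w].
  move=> x; have [[c0 [c [Oc0 Oc xE]]]|nx] := pselect (combination J x); last by exists 0.
  by exists (c j0) => _; split=> //; exists c0, c.
have phi_uniq x c0 (c : 'I_n -> K) : O c0 -> (forall l, O (c l)) ->
    x = c0 + \sum_(l in J) c l * lam l w -> nonunits O (phi x - c j0).
  move=> Oc0 Oc xE; have [|Op [d0 [d [Od0 Od <- xE']]]] := phiP x; first by exists c0, c.
  apply: (unit_absurd (d0 - c0) (fun l => d l - c l)); first exact: subringB.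
    by move=> l; exact: subringB.
  apply: (addIr x); rewrite {1}xE add0r xE' addrACA subrK -big_split; congr (_ + _).
  by apply: eq_bigr => l _ /=; rewrite mulrBl subrK.
have phiD x y : combination J x -> combination J y -> nonunits O (phi (x + y) - (phi x + phi y)).
  move=> Jx Jy; have [_ [c0 [c [Oc0 Oc <- xE]]]] := phiP x Jx.
  have [_ [d0 [d [Od0 Od <- yE]]]] := phiP y Jy.
  apply: (phi_uniq _ (c0 + d0) (fun l => c l + d l)); first exact: subringD.
    by move=> l; exact: subringD.
  rewrite xE yE addrACA -big_split; congr (_ + _).
  by apply: eq_bigr => l _; rewrite mulrDl.
have phiM a x : O a -> combination J x -> nonunits O (phi (a * x) - a * phi x).
  move=> Oa Jx; have [_ [c0 [c [Oc0 Oc <- xE]]]] := phiP x Jx.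
  apply: (phi_uniq _ (a * c0) (fun l => a * c l)); first exact: subringM.
    by move=> l; exact: subringM.
  rewrite xE mulrDr mulr_sumr; congr (_ + _).
  by apply: eq_bigr => l _; rewrite mulrA.
have O'sub : O `<=` O' by case: O'O.
have mO' : nonunits O `<=` nonunits O' by case: O'O.
have m0 : nonunits O' 0 by split; [exact: subring0|left].
have mN x : nonunits O' x -> nonunits O' (- x).
  by move=> mx; rewrite -mulN1r; apply: nonunitsM => //; apply: subringN => //; exact: subring1.
have mB x y : nonunits O' x -> nonunits O' y -> nonunits O' (x - y).
  by move=> mx my; apply: lO'.2 => //; exact: mN.
have [Q [pi [rep [piD repK pi0]]]] := quotient_group_exists m0 mB.
have piB x y : pi (x - y) = pi x - pi y.
  by apply/eqP; rewrite -(inj_eq (addIr (pi y))) -piD !subrK.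
have pi_eq x y : nonunits O' (x - y) -> pi x = pi y.
  by move/pi0; rewrite piB => /eqP; rewrite subr_eq0 => /eqP.
have rep_pi x : nonunits O' (rep (pi x) - x).
  by apply/pi0; rewrite piB repK subrr.
have O'rep x : O' x -> O' (rep (pi x)).
  move=> O'x; rewrite -(subrK x (rep _)); apply: subringD => //.
  by case: (rep_pi x).
(* The residue field of O' as an O-module: Q is K modulo the maximal ideal of O', O acts through
   representatives, and the carrier keeps the classes of elements of O'. *)
pose U := @ModData K Q [set z | O' (rep z)] (fun a z => pi (a * rep z)).
have actE a x : O' a -> pi (a * rep (pi x)) = pi (a * x).
  by move=> O'a; apply: pi_eq; rewrite -mulrBr; exact: nonunitsM.
have mU : is_module O U.
  split=> /=.
  - split=> [|u v Uu Uv]; first by rewrite -(pi0 0).2 //; apply: O'rep; exact: subring0.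
    by rewrite -[u]repK -[v]repK -piB; apply: O'rep; exact: subringB.
  - by move=> a u Oa Uu; apply: O'rep; apply: subringM => //; exact: O'sub.
  - move=> a u v Oa Uu Uv; rewrite -[u]repK -[v]repK -piD !actE; try exact: O'sub.
    by rewrite mulrDr piD.
  - move=> a b u Oa Ob Uu; split; first by rewrite mulrDl piD.
    by rewrite actE ?mulrA //; exact: O'sub.
  - by move=> u Uu; rewrite mul1r repK.
pose N := @ModData K K (combination J) *%R.
have mN' : is_module O N.
  split=> /=.
  - split=> [|x y Jx Jy]; first exact: combinationC (subring0 sO).
    apply: combinationD => //; rewrite -mulN1r; apply: combinationM => //.
    by apply: subringN => //; exact: subring1.
  - by move=> a x; exact: combinationM.
  - by move=> a x y _ _ _; rewrite mulrDr.
  - by move=> a b x _ _ _; rewrite mulrDl mulrA.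
  - by move=> x _; rewrite mul1r.
have mT : is_module O (regular (setT : set K)).
  split=> //=.
  - by move=> a x y _ _ _; rewrite mulrDr.
  - by move=> a b x _ _ _; rewrite mulrDl mulrA.
  - by move=> x _; rewrite mul1r.
pose xs := oapp_lift 1 (fun l => - lam l w).
pose ys := oapp_lift w e.
have J1 : combination J 1 by apply: combinationC; exact: subring1.
have Jlam l : combination J (- lam l w).
  by rewrite -mulN1r; apply: combinationM => //; apply: subringN => //; exact: subring1.
have bil : is_bilinear O (fun (x : N) (u : M) => (pi (phi x * lam j0 u) : U)).
  split=> [x Jx|u Mu]; split=> /=.
  - move=> u Mu; apply: O'rep; apply: subringM => //; last exact: lam_in.
    by apply: O'sub; case: (phiP x Jx).
  - by move=> u v Mu Mv; rewrite lamD // mulrDr piD.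
  - move=> a u Oa Mu; rewrite lamM // mulrCA actE //; exact: O'sub.
  - move=> x Jx; apply: O'rep; apply: subringM => //; last exact: lam_in.
    by apply: O'sub; case: (phiP x Jx).
  - move=> x y Jx Jy; rewrite -piD -mulrDl; apply: pi_eq; rewrite -mulrBl mulrC.
    by apply: nonunitsM => //; [exact: lam_in|apply: mO'; exact: phiD].
  - move=> a x Oa Jx; rewrite actE; last exact: O'sub.
    apply: pi_eq; rewrite mulrA -mulrBl mulrC.
    by apply: nonunitsM => //; [exact: lam_in|apply: mO'; exact: phiM].
have lid : is_linear O (fun x : N => (x : regular (setT : set K))) by [].
have lid_inj (x y : N) : mcar x -> mcar y -> (x : regular (setT : set K)) = y -> x = y by [].
(* Flatness is applied to the inclusion of N in K. Over K the relation holds because 1 (x) w = a0^-1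
   (x) a0 w there, and [wE] expands a0 w. *)
have : @tensor_zero K O N M n.+1 xs ys.
  apply: (flatM mN' mT lid lid_inj).
  - by move=> i; case: (unliftP ord0 i) => [l ->|->]; rewrite /xs; [rewrite oapp_liftS; exact: Jlam|rewrite oapp_lift0; exact: J1].
  - by move=> i; case: (unliftP ord0 i) => [l ->|->]; rewrite /ys; [rewrite oapp_liftS; exact: Me|rewrite oapp_lift0; exact: Mw].
  - move=> U' b mU' [bl br]; rewrite big_ord_recl /= /xs /ys !oapp_lift0.
    under eq_bigr => l _ do rewrite !oapp_liftS.
    have [_ _ MMD MDM _] := mM.
    suff -> : b 1 w = \sum_l b (lam l w) (e l).
      rewrite -big_split big1 //= => l _; have [_ bD _] := br _ (Me l).
      by rewrite -bD // addrN (linear_map0 mT (br _ (Me l))).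
    have [_ _ brw] := br _ Mw; have [_ _ bla] := bl (a0^-1) I.
    rewrite -(mulfV a00) brw // -bla // wE.
    have Mact l : mcar (mact (a0 * lam l w) (e l)) by case: mM => _ MA _ _ _; exact: MA.
    rewrite (linear_map_sum _ mM (bl _ I)) //; apply: eq_bigr => l _.
    have [_ _ brl] := br _ (Me l).
    by rewrite bla // -brl //= mulrAC mulfV // mul1r.
move/(_ U _ mU bil).
rewrite big_ord_recl /= /xs /ys !oapp_lift0.
under eq_bigr => l _ do rewrite !oapp_liftS lam_e.
have m1 : nonunits O' (phi 1).
  apply: mO'; rewrite -[phi 1]subr0; apply: (phi_uniq 1 1 (fun=> 0)) => [||]; first exact: subring1.
    by move=> _; exact: subring0.
  by rewrite big1 ?addr0 // => l _; rewrite mul0r.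
rewrite (pi0 (phi 1 * lam j0 w)).2; last by rewrite mulrC; apply: nonunitsM => //; exact: lam_in.
rewrite add0r (bigD1 j0) //= eqxx mulr1 big1 ?addr0; last first.
  by move=> l /negbTE lj0; rewrite eq_sym lj0 mulr0; exact/pi0.
move/pi0 => mphi.
have m1' : nonunits O (phi (- lam j0 w) - (- 1)).
  have := phi_uniq (- lam j0 w) 0 (fun l => - (l == j0)%:R).
  rewrite eqxx; apply; first exact: subring0.
    by move=> l; apply: subringN => //; case: eqP => _; [exact: subring1|exact: subring0].
  rewrite add0r (bigD1 j0) //= eqxx mulN1r big1 ?addr0 // => l /andP[_ /negbTE ->].
  by rewrite oppr0 mul0r.
apply: (nonunit1 sO'); have := mB _ _ (mO' _ m1') mphi.
by rewrite opprK addrC addKr.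
Qed.

End Coordinates.

End Flatness.

(** * The pullback of F^e_* R to the local rings of the resolution *)

Section FrobeniusPullback.
Variables (k : closedFieldType) (F : fieldType) (iota : {rmorphism k -> F}).
Variables (K : fieldType) (tf : {rmorphism {poly F} -> K}).
Hypothesis tf_inj : injective tf.
Hypothesis tf_fraction : forall x : K, exists a b, b != 0 /\ x = tf a / tf b.
Variable L : {freeg (place iota)}.
Hypotheses (ff : is_function_field iota) (genus1 : has_genus iota 1).
Variable P0 : place iota.
Hypothesis degL : 2 <= deg L.
Variables (p e : nat).
Hypothesis pk : p \in [pchar k].
Hypothesis e_gt0 : (0 < e)%N.
Hypothesis degL_not_power : forall m : nat, deg L <> (p ^ m)%N%:Z.
Local Notation q := (p ^ e)%N.
Local Notation term := (term tf).
Local Notation local P := (ring_of_sections tf L [set P]).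
Local Notation base := (ring_of_sections tf L setT).
Implicit Types (f g w : F) (x y z : K).

Let pF : p \in [pchar F]. Proof. exact: (@rmorph_pchar k F iota p pk). Qed.
Let pK : p \in [pchar K]. Proof. exact: (@rmorph_pchar {poly F} K tf p (@rmorph_pchar F {poly F} polyC p pF)). Qed.
Let p_gt1 : (1 < p)%N. Proof. exact: prime_gt1 (pcharf_prime pk). Qed.
Let q_gt0 : (0 < q)%N. Proof. by rewrite expn_gt0 ltnW. Qed.
Let q_gt1 : (1 < q)%N. Proof. by rewrite -(expn0 p) ltn_exp2l. Qed.

Section AtPlace.
Variable P : place iota.
Local Notation J := ('I_q * 'I_q)%type.

Definition basis_degree (eps : J -> bool) (j : J) := (j.1 + q * eps j)%N.

(* The basis element with index j = (i, m) is to have degree i mod q in t and order m at P,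
   relative to a local generator of the line bundle; [eps j] tells that H^0(i L) has no section
   of order m, in which case one is taken from H^0((i + q) L). *)
Lemma basis_sections_exist : exists (eps : J -> bool) (v : J -> F), forall j,
  [/\ v j != 0, sections (L *+ basis_degree eps j) setT (v j),
      P (v j) = j.2%:Z - mult P L * (basis_degree eps j)%:Z &
      eps j -> forall f, f != 0 -> sections (L *+ j.1) setT f -> P f <> j.2%:Z - mult P L * j.1%:Z].
Proof.
have /choice[bv bvP] : forall j : J, exists bv : bool * F,
  [/\ bv.2 != 0, sections (L *+ (j.1 + q * bv.1)) setT bv.2,
      P bv.2 = j.2%:Z - mult P L * (j.1 + q * bv.1)%N%:Z &
      bv.1 -> forall f, f != 0 -> sections (L *+ j.1) setT f -> P f <> j.2%:Z - mult P L * j.1%:Z].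
  move=> j; have [[f [f0 Lf Pf]]|nf] := pselect (exists f, [/\ f != 0, sections (L *+ j.1) setT f &
      P f = j.2%:Z - mult P L * j.1%:Z]).
    by exists (false, f); rewrite /= muln0 addn0.
  (* Subtracting m P from (i + q) L forces the order m; the degree left is at least 2 q - (q - 1) =
     q + 1. *)
  have [|f [f0 Df Pf]] := section_exact_order ff genus1 P0 (D := L *+ (j.1 + q) - << P >> *+ j.2) P.
    rewrite degB !degMn degU; have := ltn_ord j.2; have := q_gt1.
    by move: (deg L) degL (j.1 : nat) (j.2 : nat) => d d2 a b; nia.
  exists (true, f); rewrite /= muln1; split=> //.
  - apply/sectionsP => Q _; apply: order_geW ((sectionsP _ _ _).1 Df Q I).
    by rewrite multB lerN2 lerBlDr lerDl multMn mult_point; case: eqP; lia.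
  - by rewrite Pf multB !multMn mult_point_eq; lia.
  - by move=> _ g g0 Lg Pg; apply: nf; exists g.
by exists (fun j => (bv j).1), (fun j => (bv j).2).
Qed.

Variables (eps : J -> bool) (v : J -> F).
Local Notation dg := (basis_degree eps).
Hypothesis vP : forall j,
  [/\ v j != 0, sections (L *+ dg j) setT (v j),
      P (v j) = j.2%:Z - mult P L * (dg j)%:Z &
      eps j -> forall f, f != 0 -> sections (L *+ j.1) setT f -> P f <> j.2%:Z - mult P L * j.1%:Z].

Definition basis_element (j : J) : K := term (v j) (dg j).

Let v0 i m : v (i, m) != 0. Proof. by case: (vP (i, m)). Qed.

Let v_order i m : P (v (i, m)) = m%:Z - mult P L * (i + q * eps (i, m))%N%:Z.
Proof. by case: (vP (i, m)). Qed.

(** Modulo q the order of [v (i, m)] is m - i * mult P L, whatever the value of [eps]. *)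
Let v_distinct i m m' (z : int) : P (v (i, m)) - P (v (i, m')) = z * q%:Z -> m = m'.
Proof.
rewrite !v_order => E; apply: val_inj => /=.
have lm := ltn_ord m; have lm' := ltn_ord m'.
have {}E : m%:Z - m'%:Z = (z + mult P L * ((eps (i, m))%:Z - (eps (i, m'))%:Z)) * q%:Z.
  have aux (a b c d s n : nat) (l : int) :
      a%:Z - l * (s + n * c)%N%:Z - (b%:Z - l * (s + n * d)%N%:Z) = z * n%:Z ->
      a%:Z - b%:Z = (z + l * (c%:Z - d%:Z)) * n%:Z by nia.
  exact: aux E.
have aux (a b n : nat) (t : int) : (a < n)%N -> (b < n)%N -> a%:Z - b%:Z = t * n%:Z -> a = b.
  move=> an bn; have [t1|[t1|->]] : (1 <= t) \/ (t <= -1) \/ t = 0 by lia.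
  - by nia.
  - by nia.
  - by lia.
exact: aux E.
Qed.

Lemma basis_element_base j : base (basis_element j).
Proof. by apply/ring_of_sections_term => //; case: (vP j). Qed.

(** The divisor of w as a section of i L is effective of degree i deg L. *)
Lemma section_order_bounds (i : nat) w : w != 0 -> sections (L *+ i) setT w ->
  0 <= P w + mult P L * i%:Z <= i%:Z * deg L.
Proof.
move=> w0 Lw.
have wP Q : - (mult Q L * i%:Z) <= Q w.
  by rewrite -order_geE // -multMn; exact: (sectionsP _ _ _).1 Lw Q I.
have Z0 : fgle 0 (divisor ff genus1 P0 w + L *+ i).
  by apply: mult_fgle0 => Q; rewrite multD mult_divisor // multMn -lerBlDr sub0r.
have := mult_le_deg P Z0; rewrite degD deg_divisor // degMn multD mult_divisor // multMn.
by rewrite add0r -mulr_natr natz [deg L * _]mulrC => ->; rewrite -lerBlDr sub0r wP.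
Qed.

(** Relative to L, sections of i L have order less than q at P, and for each order m that occurs
    [v (i, m)] is itself a section of i L. Subtracting a multiple of it raises the order of w, and N
    bounds the room that is left. *)
Lemma sections_span_basis (i : 'I_q) w : i%:Z * deg L < q%:Z -> sections (L *+ i) setT w ->
  exists2 a : 'I_q -> k, w = \sum_m iota (a m) * v (i, m) & forall m, eps (i, m) -> a m = 0.
Proof.
move=> iq Lw; have main N : forall w, sections (L *+ i) setT w ->
    (w != 0 -> i%:Z * deg L - (P w + mult P L * i%:Z) < N%:Z) ->
    exists2 a : 'I_q -> k, w = \sum_m iota (a m) * v (i, m) & forall m, eps (i, m) -> a m = 0.
  2: by apply: (main (absz (i%:Z * deg L - (P w + mult P L * i%:Z))%R).+1 w Lw) => _; rewrite -addn1 PoszD; lia.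
elim: N => [|N IH] {Lw}w Lw wN; have [->|w0] := eqVneq w 0.
- by exists (fun=> 0) => //; rewrite big1 // => m _; rewrite rmorph0 mul0r.
- by have := wN w0; have /andP[_ up] := section_order_bounds w0 Lw; rewrite ltNge subr_ge0 up.
- by exists (fun=> 0) => //; rewrite big1 // => m _; rewrite rmorph0 mul0r.
have /andP[m_ge0 up] := section_order_bounds w0 Lw.
have m_lt : (absz (P w + mult P L * i%:Z)%R < q)%N by rewrite -ltz_nat gez0_abs //; exact: le_lt_trans iq.
pose m0 := Ordinal m_lt.
have wE : P w = m0%:Z - mult P L * i%:Z by rewrite /= gez0_abs // addrK.
have eps0 : eps (i, m0) = false.
  by apply/negP => em; have [_ _ _ /(_ em w w0 Lw)] := vP (i, m0); rewrite wE.
have vE : P (v (i, m0)) = P w by rewrite v_order eps0 muln0 addn0 wE.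
have Lv : sections (L *+ i) setT (v (i, m0)).
  by have [_ + _ _] := vP (i, m0); rewrite /basis_degree eps0 muln0 addn0.
have [c cP] : exists c, order_ge P 1 (w / v (i, m0) - iota c).
  by apply: (residue_exists ff); right; rewrite place_div // vE; lia.
have w'P : order_ge P (P w + 1) (w - iota c * v (i, m0)).
  have -> : w - iota c * v (i, m0) = (w / v (i, m0) - iota c) * v (i, m0) by rewrite mulrBl divfK.
  by rewrite addrC; apply: order_geM => //; right; rewrite vE.
have [|w'0|a aE a0] := IH (w - iota c * v (i, m0)).
- by apply/sectionsP => Q _; apply: order_geB; [exact: (sectionsP _ _ _).1 Lw Q I|apply: order_geZ; exact: (sectionsP _ _ _).1 Lv Q I].
- by move: w'P; rewrite order_geE //; have := wN w0; lia.
exists (fun m => a m + (if m == m0 then c else 0)).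
  rewrite -[LHS](subrK (iota c * v (i, m0))) aE.
  under [RHS]eq_bigr => m _ do rewrite rmorphD mulrDl.
  rewrite big_split; congr (_ + _); rewrite (bigD1 m0) //= eqxx big1 ?addr0 // => m /negbTE ->.
  by rewrite rmorph0 mul0r.
move=> m em; rewrite a0 // add0r; case: eqP => // mE.
by rewrite mE eps0 in em.
Qed.

(** i L - m P has degree at least (q + 1) - (q - 1) = 2, so a section of i L of order m exists. *)
Lemma basis_degree_small (i m : 'I_q) : q%:Z < i%:Z * deg L -> eps (i, m) = false.
Proof.
move=> qi; apply/negP => em; have [_ _ _ /(_ em) H] := vP (i, m).
have [|f [f0 Df Pf]] := section_exact_order ff genus1 P0 (D := L *+ i - << P >> *+ m) P.
  rewrite degB !degMn degU -[deg L *+ i]mulr_natr natz; have := ltn_ord m; move: qi => /=.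
  by rewrite mulrC; lia.
apply: (H f f0).
  apply/sectionsP => Q _; apply: order_geW ((sectionsP _ _ _).1 Df Q I).
  by rewrite multB lerN2 lerBlDr lerDl multMn mult_point; case: eqP; lia.
by rewrite Pf multB !multMn mult_point_eq /=; lia.
Qed.

(** A divisor of p^e is a power of p. *)
Lemma degree_neq_frobenius (i : nat) : i%:Z * deg L <> q%:Z.
Proof.
have [d dE] : exists d : nat, deg L = d%:Z by exists `|deg L|%N; rewrite gez0_abs //; lia.
rewrite dE -PoszM => -[E]; have /(dvdn_pfactor _ _ (pcharf_prime pk))[m _ dm] : (d %| p ^ e)%N.
  by rewrite -E dvdn_mull.
by apply: (degL_not_power (m := m)); rewrite dE dm.
Qed.

Lemma term_sum (T : Type) (r : seq T) (Q : pred T) (f : T -> F) n :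
  term (\sum_(i <- r | Q i) f i) n = \sum_(i <- r | Q i) term (f i) n.
Proof.
elim/big_rec2: _ => [|i x y _ <-]; first by rewrite term0.
by rewrite termD.
Qed.

Lemma term_coordinates (i : 'I_q) s f (c : 'I_q -> F) :
  f = \sum_m c m ^+ q * v (i, m) -> (forall m, c m != 0 -> (eps (i, m) <= s)%N) ->
  term f (i + q * s) = \sum_m term (c m) (s - eps (i, m)) ^+ q * basis_element (i, m).
Proof.
move=> -> c_eps; rewrite term_sum; apply: eq_bigr => m _.
have [->|cm] := eqVneq (c m) 0.
  by rewrite term0 !expr0n !gtn_eqF // !mul0r term0.
rewrite termX termM; congr term; rewrite /basis_degree /=; have := c_eps m cm.
by move: (eps _ : nat) => a; nia.
Qed.

(** The coordinate [c m] is accompanied by t^(s - eps), so it has to vanish when s = 0 and eps = 1.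
    This can occur for i deg L < q only, where w is a k-combination of the [v (i, m)] with eps = 0,
    and elements of k are q-th powers. Integrality at P is the order bound of
    [frobenius_coordinates]. *)
Lemma global_term_coordinates (i : 'I_q) s w : sections (L *+ (i + q * s)) setT w ->
  exists2 g : 'I_q -> K, forall m, local P (g m) &
    term w (i + q * s) = \sum_m g m ^+ q * basis_element (i, m).
Proof.
move=> Lw; have [c wE cP] := frobenius_coordinates ff genus1 P0 pF (v0 i) (@v_distinct i) w.
have c_eps m : c m != 0 -> (eps (i, m) <= s)%N.
  case: s Lw => [|s] Lw; last by case: (eps _).
  rewrite leqn0 eqb0; apply: contraNN => em; rewrite muln0 addn0 in Lw.
  have [iq|qi] := ltP (i%:Z * deg L) q%:Z; last first.
    suff /(basis_degree_small m) : q%:Z < i%:Z * deg L by rewrite em.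
    by rewrite lt_neqAle qi andbT; apply/eqP => qE; apply: (@degree_neq_frobenius i).
  have [a aE a0] := sections_span_basis iq Lw.
  have /choice[a' a'E] : forall m, exists a', a' ^+ q = a m by move=> m'; apply: frob_root; exact: ltnW.
  have : \sum_m (c m - iota (a' m)) ^+ q * v (i, m) = 0.
    under eq_bigr => m' _ do rewrite expr_frobB // mulrBl -rmorphXn a'E.
    by rewrite sumrB -wE -aE subrr.
  move/(frobenius_independent pF (v0 i) (@v_distinct i))/(_ m)/eqP.
  rewrite subr_eq0 => /eqP ->; have := a'E m; rewrite a0 // => /eqP.
  by rewrite expf_eq0 => /andP[_ /eqP ->]; rewrite rmorph0.
exists (fun m => term (c m) (s - eps (i, m))); last exact: term_coordinates.
move=> m; apply/ring_of_sections_term => //; apply/sectionsP => _ ->.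
rewrite multMn; have [->|cm] := eqVneq (c m) 0; first by left.
have [w0 le] := cP m cm; rewrite order_geE //.
have := (sectionsP _ _ _).1 Lw P I; rewrite order_geE // multMn => lw.
have {le lw} := le_trans lw le; rewrite v_order.
have := c_eps m cm; have := ltn_ord m.
(* As m' < n, an integer y with y n + m' >= 0 is nonnegative: the orders m < q do not spoil the
   division by q. *)
have aux (l x : int) (n a b i' m' : nat) : (m' < n)%N -> (a <= b)%N ->
    - (l * (i' + n * b)%N%:Z) <= x * n%:Z + (m'%:Z - l * (i' + n * a)%N%:Z) ->
    - (l * (b - a)%N%:Z) <= x.
  move=> mn ab H; rewrite -subzn //.
  have {}H : 0 <= (x + l * (b%:Z - a%:Z)) * n%:Z + m'%:Z by nia.
  have : 0 <= x + l * (b%:Z - a%:Z) by nia.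
  by lia.
exact: aux.
Qed.

Lemma sum_pair (V : zmodType) (G : J -> V) : \sum_j G j = \sum_i \sum_m G (i, m).
Proof. by rewrite pair_bigA; apply: eq_bigr => -[]. Qed.

Lemma base_coordinates r : base r ->
  exists2 g : J -> K, forall j, local P (g j) & r = \sum_j g j ^+ q * basis_element j.
Proof.
have sP := ring_of_sections_subring tf_inj L [set P].
pose D z := exists2 g : J -> K, forall j, local P (g j) & z = \sum_j g j ^+ q * basis_element j.
have D0 : D 0.
  exists (fun=> 0) => [j|]; first exact: subring0.
  by rewrite big1 // => j _; rewrite expr0n gtn_eqF // mul0r.
have DD x y : D x -> D y -> D (x + y).
  move=> [g gP ->] [h hP ->]; exists (fun j => g j + h j) => [j|]; first exact: subringD.
  by rewrite -big_split; apply: eq_bigr => j _; rewrite expr_frobD // mulrDl.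
move=> [h Lh ->]; rewrite tf_sum_terms; apply: (big_ind D) => // n _.
have lt : (n %% q < q)%N by rewrite ltn_mod.
have nE : (Ordinal lt + q * (n %/ q))%N = n by rewrite /= addnC mulnC -divn_eq.
have Ln : sections (L *+ (Ordinal lt + q * (n %/ q))) setT h`_n by rewrite nE.
have [g gP] := global_term_coordinates Ln; rewrite nE => ->.
exists (fun j => if j.1 == Ordinal lt then g j.2 else 0) => [j|].
  by case: eqP => _ //; exact: subring0.
rewrite sum_pair /=.
rewrite [RHS](bigD1 (Ordinal lt)) //= eqxx [X in _ + X]big1 ?addr0 // => i /negbTE ->.
by rewrite big1 // => m _; rewrite expr0n gtn_eqF // mul0r.
Qed.

Lemma tf_common_denominator (T : finType) (c : T -> K) :
  exists b (h : T -> {poly F}), b != 0 /\ forall j, c j * tf b = tf (h j).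
Proof.
have /choice[ab abP] : forall j, exists ab : {poly F} * {poly F}, ab.2 != 0 /\ c j = tf ab.1 / tf ab.2.
  by move=> j; have [a [b H]] := tf_fraction (c j); exists (a, b).
exists (\prod_j (ab j).2), (fun j => (ab j).1 * \prod_(l | l != j) (ab l).2); split.
  by rewrite prodf_seq_neq0; apply/allP => j _ /=; case: (abP j).
move=> j; have [b0 ->] := abP j.
by rewrite (bigD1 j) //= !rmorphM /= mulrA divfK // tf_eq0.
Qed.

Lemma coef_expr_frob (h : {poly F}) n : (h ^+ q)`_n = if (q %| n)%N then h`_(n %/ q) ^+ q else 0.
Proof.
have pFX : p \in [pchar {poly F}] by exact: (@rmorph_pchar F {poly F} polyC p pF).
have -> : h ^+ q = \poly_(i < size h) (h`_i ^+ q) \Po 'X^q.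
  rewrite -[in LHS](coefK h) !poly_def expr_frob_sum // raddf_sum; apply: eq_bigr => i _ /=.
  by rewrite exprZn -exprM mulnC exprM comp_polyZ comp_Xn_poly.
rewrite coef_comp_poly_Xn //; case: ifP => // _; rewrite coef_poly; case: ltnP => // /(nth_default 0) ->.
by rewrite expr0n gtn_eqF.
Qed.

(** After clearing denominators, degrees in t modulo q separate the indices i; for fixed i,
    [frobenius_independent] separates the m. *)
Lemma basis_independent (c : J -> K) :
  \sum_j c j ^+ q * basis_element j = 0 -> forall j, c j = 0.
Proof.
have [b [h [b0 hE]]] := tf_common_denominator c.
move=> E; suff h0 j : h j = 0.
  move=> j; have /eqP := hE j; rewrite h0 rmorph0 mulf_eq0 tf_eq0 // (negbTE b0) orbF => /eqP //.
have {}E : \sum_j h j ^+ q * (v j *: 'X^(dg j)) = 0.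
  apply: tf_inj; rewrite rmorph0 rmorph_sum.
  transitivity (tf b ^+ q * \sum_j c j ^+ q * basis_element j); last by rewrite E mulr0.
  rewrite mulr_sumr; apply: eq_bigr => l _.
  by rewrite /= rmorphM rmorphXn -hE exprMn mulrCA mulrA.
case: j => i m; apply/polyP => s; rewrite coef0.
(* The coefficient of t^(i + q S) involves the s-th coefficient of [h (i, m)], and that of index S -
   eps of every other [h (i, m')]. *)
pose S := (s + eps (i, m))%N.
pose c' m' := if (eps (i, m') <= S)%N then (h (i, m'))`_(S - eps (i, m')) else 0.
suff c'0 : \sum_m' c' m' ^+ q * v (i, m') = 0.
  have := frobenius_independent pF (v0 i) (@v_distinct i) c'0 m.
  by rewrite /c' /S leq_addl addnK.
have /polyP/(_ (i + q * S)%N) := E; rewrite coef0 coef_sum => {}E.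
rewrite -[RHS]E sum_pair.
rewrite [RHS](bigD1 i) //= [X in _ = _ + X]big1 ?addr0.
  apply: eq_bigr => m' _; rewrite -scalerAr coefZ coefMXn coef_expr_frob /basis_degree /=.
  rewrite ltn_add2l ltn_pmul2l // subnDl -mulnBr dvdn_mulr // mulKn // /c' ltnNge.
  by case: leqP => _ /=; rewrite ?expr0n ?gtn_eqF // ?mul0r ?mulr0 // mulrC.
move=> i' i'i; rewrite big1 // => m' _; rewrite -scalerAr coefZ coefMXn coef_expr_frob /basis_degree /=.
case: ltnP => [_|le]; first by rewrite mulr0.
case: ifP => [dv|]; last by rewrite mulr0.
case/eqP: i'i; apply: val_inj => /=; apply/esym.
have /eqP : (i + q * S == i' + q * eps (i', m') %[mod q])%N by rewrite eqn_mod_dvd.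
by rewrite !(mulnC q) ![(_ + _ * q)%N]addnC !modnMDl !modn_small.
Qed.

Local Notation pullback O := (torsion_free_pullback O (frobenius_pushforward p e base)).

Lemma pullback_module (O : set K) : is_subring O -> is_module O (pullback O).
Proof.
move=> sO; have sR := ring_of_sections_subring tf_inj L setT; split=> /=.
- split.
    exists 0%N, (fun=> 0), (fun=> 0); split=> [i|i|]; [exact: subring0|exact: subring0|].
    by rewrite big_ord0.
  move=> _ _ [n [a [r [Oa Rr ->]]]] [n' [a' [r' [Oa' Rr' ->]]]].
  exists (n + n')%N, (fun i => match fintype.split i with inl i => a i | inr i => a' i end),
    (fun i => match fintype.split i with inl i => r i | inr i => - r' i end); split=> [i|i|].
  + by case: (fintype.split i).
  + by case: (fintype.split i) => i' //; exact: subringN.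
  rewrite big_split_ord /=; congr (_ + _).
    by apply: eq_bigr => i _; rewrite (unsplitK (inl i)).
  by rewrite -sumrN; apply: eq_bigr => i _; rewrite (unsplitK (inr i)) mulrN.
- move=> b _ Ob [n [a [r [Oa Rr ->]]]]; exists n, (fun i => b * a i), r; split=> // [i|].
    exact: subringM.
  by rewrite mulr_sumr; apply: eq_bigr => i _; rewrite exprMn mulrA.
- by move=> a x y _ _ _; rewrite mulrDr.
- by move=> a b x _ _ _; rewrite expr_frobD // mulrDl exprMn mulrA.
- by move=> x _; rewrite expr1n mul1r.
Qed.

Lemma pullback_base (O : set K) r : is_subring O -> base r -> mcar (r : pullback O).
Proof.
move=> sO Rr; exists 1%N, (fun=> 1), (fun=> r); split=> [i|i|] //; first exact: subring1.
by rewrite big_ord1 /= expr1n mul1r.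
Qed.

(** Scalars act through q-th powers, so they are absorbed in the coordinates: a^q (g^q b) = (a g)^q
    b, and a sum of q-th powers is a q-th power. *)
Lemma pullback_coordinates O x : spec (local P) O -> mcar (x : pullback O) ->
  exists2 c : J -> K, forall j, O (c j) & x = \sum_j c j ^+ q * basis_element j.
Proof.
move=> PO [n [a [r [Oa Rr ->]]]]; have sP := ring_of_sections_subring tf_inj L [set P].
have [sO _] := spec_local sP PO.
have /choice[g gP] : forall i, exists g : J -> K, (forall j, local P (g j)) /\
    r i = \sum_j g j ^+ q * basis_element j.
  by move=> i; have [g gP rE] := base_coordinates (Rr i); exists g.
exists (fun j => \sum_i a i * g i j) => [j|].
  by apply: subring_sum => // i _; apply: subringM => //; apply: (spec_sub sP PO); case: (gP i).
under [RHS]eq_bigr => j _ do rewrite expr_frob_sum // mulr_suml.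
rewrite exchange_big; apply: eq_bigr => i _ /=; rewrite {1}(gP i).2 mulr_sumr.
by apply: eq_bigr => j _; rewrite exprMn mulrA.
Qed.

Lemma pullback_flat_at O : spec (local P) O -> flat O (pullback O).
Proof.
move=> PO; have [sO _] := spec_local (ring_of_sections_subring tf_inj L [set P]) PO.
apply: (@flat_of_basis _ _ (pullback O) _ basis_element) => //.
- exact: pullback_module.
- by move=> j; apply: pullback_base => //; exact: basis_element_base.
- by move=> u; exact: pullback_coordinates.
- by move=> c _; exact: basis_independent.
Qed.

Lemma base_common_denominator (T : finType) (c : T -> K) :
  exists b, [/\ base b, b != 0 & forall j, base (b * c j)].
Proof.
have sR := ring_of_sections_subring tf_inj L setT.
have /choice[ab abP] : forall j, exists ab : K * K,
    [/\ base ab.1, base ab.2, ab.2 != 0 & c j = ab.1 / ab.2].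
  by move=> j; have [a [b H]] := base_fractions tf_inj tf_fraction ff genus1 P0 degL (c j); exists (a, b).
exists (\prod_j (ab j).2); split.
- by apply: subring_prod => // j _; case: (abP j).
- by rewrite prodf_seq_neq0; apply/allP => j _ /=; case: (abP j).
move=> j; have [Ra _ b0 ->] := abP j.
rewrite (bigD1 j) //= mulrAC [X in X * _]mulrC divfK //.
by apply: subringM => //; apply: subring_prod => // l _; case: (abP l).
Qed.

Lemma flat_pullback_function (O O1 : set K) : spec (local P) O -> local_ring O1 ->
  base `<=` O1 -> dominates O O1 -> flat O1 (pullback O1) ->
  exists f, O1 (term f 0) /\ P f = 1.
Proof.
move=> PO lO1 RO1 OO1 flatO1; have sP := ring_of_sections_subring tf_inj L [set P].
have lO := spec_local sP PO; have [sO _] := lO; have [sO1 _] := lO1; have [O1O _] := OO1.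
have pullbackS x : mcar (x : pullback O1) -> mcar (x : pullback O).
  by move=> [n [a [r [Oa Rr ->]]]]; exists n, a, r; split=> // i; exact: O1O.
have /choice[co coP] : forall x : K, exists c : J -> K, mcar (x : pullback O1) ->
    (forall j, O (c j)) /\ x = \sum_j c j ^+ q * basis_element j.
  move=> x; have [/pullbackS/(pullback_coordinates PO)[c Oc xE]|nx] := pselect (mcar (x : pullback O1)).
    by exists c.
  by exists (fun=> 0).
have co_uniq x c : mcar (x : pullback O1) -> x = \sum_j c j ^+ q * basis_element j -> co x =1 c.
  move=> Mx xE j; have [_ xE'] := coP x Mx; apply/eqP; rewrite -subr_eq0; apply/eqP; move: j.
  apply: basis_independent; under eq_bigr => j _ do rewrite expr_frobB // mulrBl.
  by rewrite sumrB -xE -xE' subrr.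
(* The wanted f is the coordinate on [basis_element (0, 1)] of a section of q L of order q + 1. *)
have q2 := q_gt1; pose i0 := Ordinal q_gt0; pose m1 := Ordinal q_gt1.
have [|h [h0 Dh Ph]] := section_exact_order ff genus1 P0 (D := L *+ q - << P >> *+ q.+1) P.
  rewrite degB !degMn degU -[deg L *+ q]mulr_natr natz.
  (* The degree q d - (q + 1) is at least 2 unless d = q = 2, and in that case d would be a power of
     p. *)
  have d2 : deg L != 2 \/ (2 < q)%N.
    have [q3|q_le2] := ltnP 2 q; [by right|left].
    apply/eqP => dE; have q2' : q = 2%N by apply/eqP; rewrite eqn_leq q_le2 q2.
    by apply: (degL_not_power (m := e)); rewrite dE q2'.
  have aux (d : int) (n : nat) : 2 <= d -> (1 < n)%N -> d != 2 \/ (2 < n)%N -> 2 <= d * n%:Z - n.+1%:Z.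
    by move=> dd nn [/eqP d3|n3]; nia.
  by have := aux _ _ degL q2 d2; lia.
have hE : sections (L *+ (i0 + q * 1)) setT h.
  rewrite /= add0n muln1; apply/sectionsP => Q _; apply: order_geW ((sectionsP _ _ _).1 Dh Q I).
  by rewrite multB lerN2 lerBlDr lerDl multMn mult_point; case: eqP; lia.
have {}Ph : P h = q.+1%:Z - mult P L * q%:Z by rewrite Ph multB !multMn mult_point_eq; lia.
have [c cE cP] := frobenius_coordinates ff genus1 P0 pF (v0 i0) (@v_distinct i0) h.
have wE := term_coordinates cE (fun m _ => leq_b1 (eps (i0, m))).
rewrite /= add0n muln1 in wE hE.
have Rw : base (term h q) by apply/ring_of_sections_term.
have Mw := pullback_base sO1 Rw.
(* Sections of degree 0 are constants, so order 1 does not occur among them. Hence this basis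
   element has degree q in t, and its coordinate has degree 0, as a function on the curve should. *)
have eps1 : eps (i0, m1).
  apply: contraT => /negbTE eps1; have [_ + + _] := vP (i0, m1).
  rewrite /basis_degree eps1 /= muln0 mulr0n => /sections0E v_reg.
  have [a ->] : constant iota (v (i0, m1)).
    by apply: (no_pole_constant ff genus1 P0) => Q; exact: v_reg.
  by rewrite placeC mulr0.
(* Some term has the same order as h, which is q + 1 relative to q L. Modulo q this order occurs for
   m = 1 only, so q P(c m1) + 1 = q + 1. *)
have c1 : P (c m1) = 1.
  have [m [cm Em]] : exists m, c m != 0 /\ P h = P (c m) * q%:Z + P (v (i0, m)).
    apply: contrapT => nm; suff : order_ge P (P h + 1) h by rewrite order_geE //; lia.
    rewrite {2}cE; apply: order_ge_sum => m _; have [->|cm] := eqVneq (c m) 0.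
      by left; rewrite expr0n gtn_eqF // mul0r.
    right; rewrite placeM ?expf_neq0 // placeX -mulr_natr natz.
    have [_ le] := cP m cm; rewrite -ltzD1 in le *; move: le; rewrite ltzD1 le_eqVlt => /orP[/eqP E|]; last by lia.
    by case: nm; exists m.
  have v1 : P (v (i0, m1)) = 1 - mult P L * q%:Z by rewrite v_order eps1 muln1.
  have mE : m = m1.
    apply: (@v_distinct i0 m m1 (1 - P (c m))).
    by rewrite v1 mulrBl; move: Em; rewrite Ph; lia.
  move: Em; rewrite mE v1 Ph => E.
  have : (P (c m1) - 1) * q%:Z = 0 by rewrite mulrBl; lia.
  by move/eqP; rewrite mulf_eq0 => /orP[|]; lia.
exists (c m1); split=> //.
pose g (j : J) := if j.1 == i0 then term (c j.2) (1 - eps (i0, j.2)) else 0.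
have wg : term h q = \sum_j g j ^+ q * basis_element j.
  rewrite sum_pair [RHS](bigD1 i0) //= [X in _ = _ + X]big1 ?addr0 => [|i /negbTE i0i].
    by rewrite wE; apply: eq_bigr => m _; rewrite /g /= ?eqxx.
  by rewrite big1 // => m _; rewrite /g /= i0i expr0n gtn_eqF // mul0r.
have gE := co_uniq _ _ Mw wg.
have [b [Rb b0 bco]] := base_common_denominator (co (term h q)).
have -> : term (c m1) 0 = co (term h q) (i0, m1) by rewrite gE /g /= ?eqxx eps1.
have Mco x y : mcar (x : pullback O1) -> mcar (y : pullback O1) -> mcar (x + y : pullback O1).
  by move=> Mx My; have := @module_sum K O1 (pullback O1) bool [:: true; false] xpredT (fun i => if i then x else y) (pullback_module sO1); rewrite !big_cons big_nil addr0; apply; case.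
have H := @flat_coordinates K O1 O (pullback O1) #|{: J}| (fun l x => co x (enum_val l))
  (fun l => basis_element (enum_val l)) (term h q) b lO1 lO OO1 (pullback_module sO1) flatO1.
have -> : co (term h q) (i0, m1) = co (term h q) (enum_val (enum_rank (i0, m1))) by rewrite enum_rankK.
apply: H => //.
- by move=> l x Mx; case: (coP x Mx).
- move=> l x y Mx My; apply: (co_uniq _ (fun j => co x j + co y j)); first exact: Mco.
  under eq_bigr => j _ do rewrite expr_frobD // mulrDl.
  by rewrite big_split; congr (_ + _); [case: (coP x Mx)|case: (coP y My)].
- move=> l a x Oa Mx; apply: (co_uniq _ (fun j => a * co x j)).
    by case: (pullback_module sO1) => _ MA _ _ _; exact: MA.
  under eq_bigr => j _ do rewrite exprMn -mulrA.
  by rewrite -mulr_sumr /=; congr (_ * _); case: (coP x Mx).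
- by move=> l; apply: pullback_base => //; exact: basis_element_base.
- move=> l l'; rewrite (co_uniq _ (fun j => (j == enum_val l')%:R)).
  + by rewrite (inj_eq enum_val_inj).
  + by apply: pullback_base => //; exact: basis_element_base.
  rewrite (bigD1 (enum_val l')) //= eqxx expr1n mul1r big1 ?addr0 // => j /negbTE ->.
  by rewrite expr0n gtn_eqF // mul0r.
- exact: RO1.
- by move=> l; apply: RO1.
pose T : finType := J.
rewrite /= {1}(coP _ Mw).2 mulr_sumr (reindex (@enum_val T T)) /=; last exact: onW_bij (enum_val_bij T).
by apply: eq_bigr => j _; rewrite exprMn mulrA.
Qed.

End AtPlace.
End FrobeniusPullback.

(** * Comparison of the resolution with the normalized F-blowup *)

Section NormalizedBlowup.
Variables (k : closedFieldType) (F : fieldType) (iota : {rmorphism k -> F}).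
Variables (K : fieldType) (tf : {rmorphism {poly F} -> K}).
Hypothesis tf_inj : injective tf.
Hypothesis tf_fraction : forall x : K, exists a b, b != 0 /\ x = tf a / tf b.
Variable L : {freeg (place iota)}.
Hypotheses (ff : is_function_field iota) (genus1 : has_genus iota 1).
Variable P0 : place iota.
Hypothesis degL : 2 <= deg L.
Variables (p e : nat).
Hypothesis pk : p \in [pchar k].
Hypothesis e_gt0 : (0 < e)%N.
Hypothesis degL_not_power : forall m : nat, deg L <> (p ^ m)%N%:Z.
Local Notation term := (term tf).
Local Notation local P := (ring_of_sections tf L [set P]).
Local Notation base := (ring_of_sections tf L setT).
Implicit Types (f b : F) (x y z : K) (O N V : set K) (P Q : place iota).

Lemma resolution_flattening :
  is_flattening base (frobenius_pushforward p e base) (resolution tf L).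
Proof.
split; first exact: (resolution_modification tf_inj ff genus1 P0 degL).
move=> O /(resolutionP tf_inj L ff genus1 P0)[P PO].
have [eps [v vP]] := basis_sections_exist tf ff genus1 P0 degL pk e_gt0 P.
exact: (pullback_flat_at tf_inj tf_fraction ff genus1 P0 degL pk e_gt0 degL_not_power vP PO).
Qed.

Lemma integral_function O f b : is_subring O -> (forall c, O (term (iota c) 0)) ->
  O (term f 0) -> ~ constant iota f -> regular_where iota f b -> integral_closure O (term b 0).
Proof.
move=> sO Ok Of fc fb; have [r rm rb] := regular_where_integral ff genus1 P0 fc fb.
have termE g : term g 0 = (tf \o polyC) g by rewrite /term /= expr0 alg_polyC.
have O0 a c : O (term a 0) -> O (term c 0) -> O (term (a * c) 0).
  by move=> Oa Oc; rewrite -[0%N]/(0 + 0)%N -termM; exact: subringM.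
exists (map_poly (tf \o polyC) (map_poly (evk iota f) r)); split.
- by rewrite !monic_map.
- move=> i; rewrite !coef_map /= (evk_sum _ _ (leqnn _)).
  rewrite -[tf _]termE; elim/big_ind: _ => [|x y|j _].
  + by rewrite term0; exact: subring0.
  + by rewrite termD; exact: subringD.
  apply: (O0) => //; elim: (j : nat) => [|n IH]; first by rewrite expr0 term10; exact: subring1.
  by rewrite exprS; exact: O0.
by rewrite termE /root horner_map rb rmorph0.
Qed.

(** A function b regular at P is (s b) / s, where s is a unit at P and vanishes along the poles of b
    at which f is regular; s and s b are then regular where f is. Such an s exists because f has a
    pole Q, where s may have any pole. *)
Lemma resolution_local_le P O' N f : spec (local P) O' -> is_subring N -> base `<=` N -> P f = 1 ->
  (forall b, regular_where iota f b -> N (term b 0)) ->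
  (forall x, N x -> x != 0 -> O' x^-1 -> N x^-1) -> O' `<=` N.
Proof.
move=> PO' sN RN Pf fN Ninv; have sP := ring_of_sections_subring tf_inj L [set P].
suff PN : local P `<=` N.
  move=> x /(spec_fraction sP PO')[a [b [Pa Pb b0 Ob ->]]].
  apply: subringM => //; first exact: PN.
  by apply: Ninv => //; exact: PN.
apply: (local_sub tf_inj ff genus1 P0 degL sN RN) => b /= Pb; rewrite /functions_of /=.
have [->|b0] := eqVneq b 0; first by rewrite term0; exact: subring0.
have [Q Qf] : exists Q : place iota, 0 < Q f^-1.
  apply: (nonconstant_zero ff genus1 P0) => -[c fE].
  by have : P f = 0; [rewrite -[f]invrK fE -fmorphV placeC|rewrite Pf].
have PQ : P != Q by apply/eqP => PQ; move: Qf; rewrite -PQ placeV Pf.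
pose Z := fgpos (- divisor ff genus1 P0 b).
have ZE R : mult R Z = Num.max 0 (- R b) by rewrite mult_fgpos multN mult_divisor.
have [s [s0 Zs Ps]] := section_pole_at ff genus1 P0 (- Z) PQ.
have {}Ps : P s = 0 by rewrite Ps multN opprK ZE; move: Pb; rewrite order_geE //; lia.
have sR R : order_ge R 0 f -> order_ge R (mult R Z) s.
  move=> Rf; rewrite -[mult R Z]opprK -multN; apply: ((sectionsP _ _ _).1 Zs R) => RQ.
  move: Rf; rewrite RQ => -[f0|]; first by move: Qf; rewrite f0 invr0 place0.
  by move: Qf; rewrite placeV; lia.
have Ns : N (term s 0).
  by apply: fN => R /sR; apply: order_geW; rewrite ZE; lia.
have Nsb : N (term (s * b) 0).
  apply: fN => R /sR Rs; apply: order_geW (order_geM Rs (or_intror (lexx (R b)))).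
  by rewrite ZE; lia.
have t0 : term s 0 != 0 by rewrite term_eq0.
rewrite -(mulKf t0 (term b 0)); apply: subringM => //; last by rewrite termM.
by apply: Ninv => //; apply: (spec_sub sP PO'); exact: local_unit.
Qed.

(** For O' in the resolution, dominating O, the centre of O' on the integral closure of O turns out
    to be O'. For N over the closure of O, a valuation ring V dominating N has a centre O' on the
    resolution, and N = O'. Since N may come from any prime of the closure, V need not dominate O;
    but its centre [O1] in the chart B of O contains O, and by uniqueness of centres [O1] is the
    local ring of the blowup that O' dominates. *)
Theorem resolution_normalized_blowup (FB : set (set K)) :
  is_F_blowup p e base FB -> resolution tf L = normalization FB.
Proof.
move=> [[[[n [A [Afg FBE]]] FBval] FBflat] FBuniv].
have dom := FBuniv _ resolution_flattening.
have AO O : FB O -> exists B, [/\ is_subring B, base `<=` B, spec B O & spec B `<=` FB].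
  rewrite FBE => -[i iO]; exists (A i); case: (Afg i) => sA RA _.
  by split=> // O1 ?; exists i.
have FBlocal O : FB O -> local_ring O /\ base `<=` O.
  move=> /AO[B [sB RB BO _]]; split; first exact: spec_local BO.
  exact: subset_trans RB (spec_sub sB BO).
have key P O' O : spec (local P) O' -> FB O -> dominates O' O ->
    exists f, O (term f 0) /\ P f = 1.
  move=> PO' FO O'O; have [lO RO] := FBlocal O FO.
  have [eps [v vP]] := basis_sections_exist tf ff genus1 P0 degL pk e_gt0 P.
  exact: (flat_pullback_function tf_inj tf_fraction ff genus1 P0 degL pk e_gt0 degL_not_power vP PO' lO RO O'O (FBflat O FO)).
have fnc P f : P f = 1 -> ~ constant iota f by move=> + [c fE]; rewrite fE placeC.
have basek c : base (term (iota c) 0) by exact: ring_of_sectionsC.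
have closure_sub P O' O : spec (local P) O' -> O `<=` O' -> integral_closure O `<=` O'.
  move=> PO' OO'; apply: subset_trans (spec_local_normal tf_inj tf_fraction PO').
  exact: integral_closureS.
apply/seteqP; split=> [O' resO'|N [O FO CN]].
  have [O FO O'O] := dom O' resO'.
  have [P PO'] := (resolutionP tf_inj L ff genus1 P0 O').1 resO'.
  have lO' := spec_local (ring_of_sections_subring tf_inj L [set P]) PO'.
  have [[sO _] RO] := FBlocal O FO.
  have [f [Of Pf]] := key P O' O PO' FO O'O.
  have sC := integral_closure_subring sO.
  have CO' := closure_sub P O' O PO' O'O.1.
  have [N CN O'N] := spec_centre sC lO' CO'.
  suff -> : O' = N by exists O.
  apply/seteqP; split; last exact: O'N.1.
  have CsubN := spec_sub sC CN.
  apply: (resolution_local_le PO' _ _ Pf).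
  - exact: (spec_local sC CN).1.
  - exact: subset_trans RO (subset_trans (integral_closure_sub sO) CsubN).
  - move=> b fb; apply: CsubN; apply: (integral_function sO _ Of (fnc P f Pf) fb).
    by move=> c; exact: RO.
  - by move=> x Nx x0; exact: dominates_inv O'N Nx x0.
have [B [sB RB BO BFB]] := AO O FO.
have [[sO _] RO] := FBlocal O FO.
have sC := integral_closure_subring sO.
have lN := spec_local sC CN; have CsubN := spec_sub sC CN.
have [V vV VN] := chevalley lN; have lV := valuation_ring_local vV.
have ON : O `<=` N := subset_trans (integral_closure_sub sO) CsubN.
have OV : O `<=` V := subset_trans ON VN.1.
have RV : base `<=` V := subset_trans RO OV.
have [O' [[resO' VO'] _]] := resolution_valuative tf_inj ff genus1 P0 degL vV RV.
have [P PO'] := (resolutionP tf_inj L ff genus1 P0 O').1 resO'.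
have lO' := spec_local (ring_of_sections_subring tf_inj L [set P]) PO'.
have [O2 FO2 O'O2] := dom O' resO'.
have BV : B `<=` V := subset_trans (spec_sub sB BO) OV.
have [O1 BO1 VO1] := spec_centre sB lV BV.
have O12 : O1 = O2.
  have [O3 [_ uniq]] := FBval V vV RV.
  by rewrite -(uniq O1) ?(uniq O2) //; split=> //; [exact: dominates_trans O'O2|exact: BFB].
rewrite -{}O12 in FO2 O'O2.
have sO1 := (spec_local sB BO1).1.
have OO1 : O `<=` O1 := spec_dominated_le sB sO1 BO (spec_sub sB BO1) VO1 OV.
have CO' := closure_sub P O' O PO' (subset_trans OO1 O'O2.1).
have NO' : N `<=` O' := spec_dominated_le sC lO'.1 CN CO' VO' VN.1.
suff O'N : O' `<=` N by rewrite (_ : N = O') //; apply/seteqP.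
have [f [O1f Pf]] := key P O' O1 PO' FO2 O'O2.
apply: (resolution_local_le PO' lN.1 _ Pf).
- exact: subset_trans RO ON.
- move=> b fb.
  (* The function is integral over [O1] only. Some s in B, a unit in [O1], makes s times it integral
     over B; as s is a unit in V, it is one in N. *)
  have O1b : integral_closure O1 (term b 0).
    apply: (integral_function sO1 _ O1f (fnc P f Pf) fb) => c.
    exact: (spec_sub sB BO1) (RB _ (basek c)).
  have [s [Bs s0 O1s sb]] := integral_over_localization sB BO1 O1b.
  have Os := spec_sub sB BO Bs.
  rewrite -(mulKf s0 (term b 0)); apply: subringM; first exact: lN.1.
    by apply: (dominates_inv VN (ON _ Os) s0); exact: VO1.1.
  by apply: CsubN; apply: integral_closureS sb; exact: spec_sub BO.
- by move=> x Nx x0 O'x; apply: (dominates_inv VN Nx x0); exact: VO'.1.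
Qed.

End NormalizedBlowup.

Theorem proposition4p18
  (k : closedFieldType) (p : nat) (char_k : p \in [pchar k])
  (F : fieldType) (iota : {rmorphism k -> F}) (E_elliptic : is_elliptic iota)
  (L : {freeg (place iota)}) (L_ample : ample L)
  (not_F_pure : ~ F_pure p (section_ring L setT))
  (self_int_le : zero_section_self_intersection L <= - 2%:Z)
  (d_not_power : forall m : nat,
     - zero_section_self_intersection L <> (p ^ m)%N%:Z)
  (e : nat) (e_ge1 : (1 <= e)%N)
  (FB : set (set (Kt F))) (FB_blowup : is_F_blowup p e (section_ring L setT) FB) :
  min_resolution L = normalization FB.
Proof.
have [ff genus1] := E_elliptic.
have degL : 2 <= deg L by move: self_int_le; rewrite /zero_section_self_intersection lerN2.
have degL_not_power m : deg L <> (p ^ m)%N%:Z.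
  by have := d_not_power m; rewrite /zero_section_self_intersection opprK.
(* The results on the curve are relative to one chosen place; a divisor of positive degree provides
   it. *)
have [P0 _] : exists P0 : place iota, P0 \in dom L.
  case E: (dom L) => [|P0 s]; last by exists P0; exact: mem_head.
  by have /eqP L0 : L == 0 by [rewrite -dom_eq0 E]; rewrite L0 deg0 in degL.
have tf_inj : injective (@FracField.tofrac {poly F}).
  by move=> a b /eqP; rewrite tofrac_eq => /eqP.
exact: (resolution_normalized_blowup (tf := @FracField.tofrac {poly F}) tf_inj
  (@fraction_exists {poly F}) ff genus1 P0 degL char_k e_ge1 degL_not_power FB_blowup).
Qed.
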